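(* Let $N,r$ be positive integers and let $\mathbf{Q}=(q_{ij})_{i,j=1}^r$ be a complex matrix with $q_{ij}q_{ji}=1$ for $1\le i,j\le r$. Let $W$ be any restricted $\mathcal{A}_{\mathbf Q}[\theta_N]$-module. Then there exists a unique structure of a $\theta_N$-twisted $V_{\mathbf Q}$-module $Y_W$ on $W$ with $$Y_W(u^{(i)},z)=X_i^\theta(z),\qquad Y_W(v^{(i)},z)=Y_i^\theta(z)\qquad (1\le i\le r).$$ On the other hand, for any $\theta_N$-twisted $V_{\mathbf Q}$-module $(W,Y_W)$, $W$ is a restricted $\mathcal{A}_{\mathbf Q}[\theta_N]$-module with $$X_i^\theta(z)=Y_W(u^{(i)},z),\qquad Y_i^\theta(z)=Y_W(v^{(i)},z)\qquad (1\le i\le r).$$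
   Context: Scalars are $\mathbb{C}$; $\mathbb{N}=\{0,1,2,\dots\}$; $\omega_N=\exp(2\pi\sqrt{-1}/N)$. Formal binomials $(x\pm y)^\alpha$ are expanded in nonnegative powers of $y$. $W((x_1^{1/N},x_2^{1/N}))$ is the space of formal series with coefficients in $W$ and exponents in $\frac1N\mathbb{Z}$ bounded below in each variable; the substitution $x_1^{1/N}=(x_2+x_0)^{1/N}$ replaces $x_1^{m/N}$ by $(x_2+x_0)^{m/N}$, expanded in nonnegative powers of $x_0$. A nonlocal vertex algebra is a vector space $V$ with a linear map $Y(\cdot,x):V\to\mathrm{Hom}(V,V((x)))$, $v\mapsto Y(v,x)=\sum_n v_nx^{-n-1}$, and $\mathbf 1\in V$ such that $Y(\mathbf 1,x)v=v$, $Y(v,x)\mathbf 1\in V[[x]]$, $\lim_{x\to0}Y(v,x)\mathbf 1=v$, and for all $u,v,w\in V$ there is $l\in\mathbb{N}$ with $(x_0+x_2)^lY(u,x_0+x_2)Y(v,x_2)w=(x_0+x_2)^lY(Y(u,x_0)v,x_2)w$. An automorphism $\sigma$ is a linear bijection with $\sigma(\mathbf 1)=\mathbf 1$ and $\sigma(Y(u,x)v)=Y(\sigma u,x)\sigma v$. If $\sigma^N=1$, a $\sigma$-twisted $V$-module is a vector space $W$ with a linear map $Y_W:V\to\mathrm{Hom}(W,W((x^{1/N})))$ such that $Y_W(\mathbf 1,x)=1_W$; $Y_W(\sigma v,x)=\lim_{x^{1/N}\to\omega_N^{-1}x^{1/N}}Y_W(v,x)$ for $v\in V$; and for $u,v\in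 V$ there is $k\in\mathbb{N}$ with $(x_1-x_2)^kY_W(u,x_1)Y_W(v,x_2)\in\mathrm{Hom}(W,W((x_1^{1/N},x_2^{1/N})))$ and $x_0^kY_W(Y(u,x_0)v,x_2)=\left((x_1-x_2)^kY_W(u,x_1)Y_W(v,x_2)\right)|_{x_1^{1/N}=(x_2+x_0)^{1/N}}$. $\mathcal{A}_{\mathbf Q}$ is the unital associative $\mathbb{C}$-algebra with generators $X_{i,n},Y_{i,n}$ ($1\le i\le r$, $n\in\mathbb{Z}$) and relations $$X_{i,m}X_{j,n}=q_{ij}X_{j,n}X_{i,m},\quad Y_{i,m}Y_{j,n}=q_{ij}Y_{j,n}Y_{i,m},\quad X_{i,m}Y_{j,n}-q_{ji}Y_{j,n}X_{i,m}=\delta_{i,j}\delta_{m+n+1,0}.$$ Put $X_i(z)=\sum_{n\in\mathbb{Z}}X_{i,n}z^{-n-1}$, $Y_i(z)=\sum_{n\in\mathbb{Z}}Y_{i,n}z^{-n-1}$. Let $J_{\mathbf Q}$ be the left ideal of $\mathcal{A}_{\mathbf Q}$ generated by all $X_{i,n},Y_{i,n}$ with $n\ge0$, $V_{\mathbf Q}=\mathcal{A}_{\mathbf Q}/J_{\mathbf Q}$, $\mathbf 1=1+J_{\mathbf Q}$, $u^{(i)}=X_{i,-1}\mathbf 1$, $v^{(i)}=Y_{i,-1}\mathbf 1$. It is known that there is a unique quantum vertex algebra structure on $V_{\mathbf Q}$ (only its underlying nonlocal vertex algebra structure matters here) with vacuum vector $\mathbf 1$ and $Y(u^{(i)},z)=X_i(z)$,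 $Y(v^{(i)},z)=Y_i(z)$ for $1\le i\le r$; it is generated by the vectors $u^{(i)},v^{(i)}$. $\theta_N$ is the automorphism of $V_{\mathbf Q}$ of order $N$ determined by $\theta_N(u^{(i)})=\omega_Nu^{(i)}$, $\theta_N(v^{(i)})=\omega_N^{-1}v^{(i)}$ (induced by the algebra automorphism $X_{i,n}\mapsto\omega_NX_{i,n}$, $Y_{i,n}\mapsto\omega_N^{-1}Y_{i,n}$ of $\mathcal{A}_{\mathbf Q}$). $\mathcal{A}_{\mathbf Q}[\theta_N]$ is the unital associative algebra with generators $X^\theta_{i,m},Y^\theta_{i,n}$ ($1\le i\le r$, $m\in\frac1N+\mathbb{Z}$, $n\in-\frac1N+\mathbb{Z}$) and relations $$X^\theta_{i,m}X^\theta_{j,n}=q_{ij}X^\theta_{j,n}X^\theta_{i,m},\quad Y^\theta_{i,m}Y^\theta_{j,n}=q_{ij}Y^\theta_{j,n}Y^\theta_{i,m},\quad X^\theta_{i,m}Y^\theta_{j,n}-q_{ji}Y^\theta_{j,n}X^\theta_{i,m}=\delta_{i,j}\delta_{m+n+1,0}$$ for all $1\le i,j\le r$ and all indices $m,n$ in the respective index sets. Put $X_i^\theta(x)=\sum_{m\in\frac1N+\mathbb{Z}}X^\theta_{i,m}x^{-m-1}$, $Y_i^\theta(x)=\sum_{n\in-\frac1N+\mathbb{Z}}Y^\theta_{i,n}x^{-n-1}$. An $\mathcal{A}_{\mathbf Q}[\theta_N]$-module $W$ is restricted if for any $w\in W$ and $1\le i\le r$, $X^\theta_{i,m}w=0$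 and $Y^\theta_{i,n}w=0$ for $m\in\frac1N+\mathbb{Z}$, $n\in-\frac1N+\mathbb{Z}$ sufficiently large. *)

(* Defs.v *)
From HB Require Import structures.
From mathcomp Require Import all_boot all_order all_algebra.
From mathcomp Require Import complex generic_quotient ring_quotient.
From mathcomp Require Import finmap zify.
From mathcomp Require Import boolp classical_sets functions cardinality fsbigop.
From mathcomp Require Import reals trigo.

Set Implicit Arguments.
Unset Strict Implicit.
Unset Printing Implicit Defensive.

Import Order.TTheory GRing.Theory Num.Theory.
Local Open Scope ring_scope.
Local Open Scope quotient_scope.

Declare Scope aterm_scope.
Delimit Scope aterm_scope with AT.

(* The unital associative K-algebra with generators G and relations rel:
   algebra terms modulo the least congruence that contains rel and the axioms of
   unital associative K-algebras.  It may be the zero ring, hence it is only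
   given the structures pzRingType and lmodType (with palg_scalerAl and
   palg_scalerAr below), mathcomp's algType being restricted to nonzero rings. *)
Section PresentedAlgebra.
Variables (K : comNzRingType) (G : Type).

Inductive aterm :=
| AGen of G
| ACst of K
| AAdd of aterm & aterm
| AMul of aterm & aterm.

HB.instance Definition _ := gen_eqMixin aterm.
HB.instance Definition _ := gen_choiceMixin aterm.

Notation "t + u" := (AAdd t u) : aterm_scope.
Notation "t * u" := (AMul t u) : aterm_scope.

Variable rel : aterm -> aterm -> Prop.

Inductive acong : aterm -> aterm -> Prop :=
| acong_refl t : acong t t
| acong_sym t u : acong t u -> acong u t
| acong_trans t u v : acong t u -> acong u v -> acong t v
| acong_add t t' u u' :
    acong t t' -> acong u u' -> acong (t + u)%AT (t' + u')%AT
| acong_mul t t' u u' :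
    acong t t' -> acong u u' -> acong (t * u)%AT (t' * u')%AT
| acong_addA t u v : acong (t + (u + v))%AT (t + u + v)%AT
| acong_addC t u : acong (t + u)%AT (u + t)%AT
| acong_add0 t : acong (ACst 0 + t)%AT t
| acong_addN t : acong (ACst (-1) * t + t)%AT (ACst 0)
| acong_mulA t u v : acong (t * (u * v))%AT (t * u * v)%AT
| acong_mul1 t : acong (ACst 1 * t)%AT t
| acong_mulDl t u v : acong ((t + u) * v)%AT (t * v + u * v)%AT
| acong_mulDr t u v : acong (t * (u + v))%AT (t * u + t * v)%AT
| acong_cstD a b : acong (ACst (a + b)) (ACst a + ACst b)%AT
| acong_cstM a b : acong (ACst (a * b)) (ACst a * ACst b)%AT
| acong_cstC a t : acong (ACst a * t)%AT (t * ACst a)%AT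
| acong_rel t u : rel t u -> acong t u.

Definition acongb (t u : aterm) : bool := `[< acong t u >].

Lemma acongb_refl : reflexive acongb.
Proof. by move=> t; apply/asboolP; exact: acong_refl. Qed.

Lemma acongb_sym : ssrbool.symmetric acongb.
Proof. by move=> t u; apply/asboolP/asboolP; exact: acong_sym. Qed.

Lemma acongb_trans : ssrbool.transitive acongb.
Proof.
by move=> u t v /asboolP tu /asboolP uv; apply/asboolP; exact: acong_trans uv.
Qed.

Canonical acongb_equiv := EquivRel acongb acongb_refl acongb_sym acongb_trans.

Definition palg := {eq_quot acongb}.
HB.instance Definition _ := Choice.on palg.
HB.instance Definition _ := EqQuotient.on palg.

Definition pcls (t : aterm) : palg := \pi_palg t.

Lemma pclsP t u : pcls t = pcls u <-> acong t u.
Proof.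
split=> [/eqmodP /asboolP //|tu]; apply/eqmodP; exact/asboolP.
Qed.

Lemma pcls_repr (a : palg) : pcls (repr a) = a. Proof. exact: reprK. Qed.

Lemma repr_pcls t : acong (repr (pcls t)) t.
Proof. by apply/pclsP; rewrite pcls_repr. Qed.

Lemma palgP (P : palg -> Prop) : (forall t, P (pcls t)) -> forall a, P a.
Proof. by move=> PP a; rewrite -[a]pcls_repr. Qed.

Definition padd (a b : palg) := pcls (repr a + repr b)%AT.
Definition pmul (a b : palg) := pcls (repr a * repr b)%AT.
Definition popp (a : palg) := pcls (ACst (-1) * repr a)%AT.

Lemma paddE t u : padd (pcls t) (pcls u) = pcls (t + u)%AT.
Proof. apply/pclsP/acong_add; exact: repr_pcls. Qed.

Lemma pmulE t u : pmul (pcls t) (pcls u) = pcls (t * u)%AT.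
Proof. apply/pclsP/acong_mul; exact: repr_pcls. Qed.

Lemma poppE t : popp (pcls t) = pcls (ACst (-1) * t)%AT.
Proof. apply/pclsP/acong_mul; [exact: acong_refl|exact: repr_pcls]. Qed.

Lemma paddA : associative padd.
Proof.
elim/palgP=> t; elim/palgP=> u; elim/palgP=> v.
by rewrite !paddE; apply/pclsP/acong_addA.
Qed.

Lemma paddC : commutative padd.
Proof.
by elim/palgP=> t; elim/palgP=> u; rewrite !paddE; apply/pclsP/acong_addC.
Qed.

Lemma padd0 : left_id (pcls (ACst 0)) padd.
Proof. by elim/palgP=> t; rewrite !paddE; apply/pclsP/acong_add0. Qed.

Lemma paddN : left_inverse (pcls (ACst 0)) popp padd.
Proof. by elim/palgP=> t; rewrite poppE !paddE; apply/pclsP/acong_addN. Qed.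

HB.instance Definition _ := GRing.isZmodule.Build palg paddA paddC padd0 paddN.

Lemma pmulA : associative pmul.
Proof.
elim/palgP=> t; elim/palgP=> u; elim/palgP=> v.
by rewrite !pmulE; apply/pclsP/acong_mulA.
Qed.

Lemma pmul1l : left_id (pcls (ACst 1)) pmul.
Proof. by elim/palgP=> t; rewrite !pmulE; apply/pclsP/acong_mul1. Qed.

Lemma pmul1r : right_id (pcls (ACst 1)) pmul.
Proof.
elim/palgP=> t; rewrite !pmulE; apply/pclsP.
exact: acong_trans (acong_sym (acong_cstC _ _)) (acong_mul1 _).
Qed.

Lemma pmulDl : left_distributive pmul padd.
Proof.
elim/palgP=> t; elim/palgP=> u; elim/palgP=> v.
by rewrite !(paddE, pmulE); apply/pclsP/acong_mulDl.
Qed.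

Lemma pmulDr : right_distributive pmul padd.
Proof.
elim/palgP=> t; elim/palgP=> u; elim/palgP=> v.
by rewrite !(paddE, pmulE); apply/pclsP/acong_mulDr.
Qed.

HB.instance Definition _ := GRing.Zmodule_isPzRing.Build palg
  pmulA pmul1l pmul1r pmulDl pmulDr.

Definition pscale (c : K) (a : palg) : palg := pcls (ACst c) * a.

Lemma pclsD t u : pcls (t + u)%AT = pcls t + pcls u.
Proof. by rewrite -paddE. Qed.

Lemma pclsM t u : pcls (t * u)%AT = pcls t * pcls u.
Proof. by rewrite -pmulE. Qed.

Lemma pscaleA a b v : pscale a (pscale b v) = pscale (a * b) v.
Proof.
rewrite /pscale mulrA -pclsM; congr (_ * _).
by apply/pclsP/acong_sym/acong_cstM.
Qed.

Lemma pscale1 : left_id 1 pscale. Proof. exact: mul1r. Qed.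

Lemma pscaleDr : right_distributive pscale +%R.
Proof. by move=> c a b; rewrite /pscale mulrDr. Qed.

Lemma pscaleDl v : {morph pscale^~ v : a b / a + b >-> a + b}.
Proof.
move=> a b; rewrite /pscale -mulrDl -pclsD; congr (_ * _).
exact/pclsP/acong_cstD.
Qed.

HB.instance Definition _ := GRing.Zmodule_isLmodule.Build K palg
  pscaleA pscale1 pscaleDr pscaleDl.

Lemma pcls_cst c : pcls (ACst c) = c *: (1 : palg).
Proof. by rewrite -[RHS]/(pcls (ACst c) * 1) mulr1. Qed.

Lemma palg_scalerAl c (a b : palg) : c *: (a * b) = (c *: a) * b.
Proof. exact: mulrA. Qed.

Lemma palg_scalerAr c (a b : palg) : c *: (a * b) = a * (c *: b).
Proof.
rewrite -[LHS]/(pcls (ACst c) * (a * b)) -[c *: b]/(pcls (ACst c) * b) !mulrA.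
congr (_ * _); rewrite -[a]pcls_repr -!pclsM; exact/pclsP/acong_cstC.
Qed.

Definition pgen (g : G) : palg := pcls (AGen g).

Lemma palg_ind (P : palg -> Prop) :
    (forall g, P (pgen g)) -> P 1 ->
    (forall a b, P a -> P b -> P (a + b)) ->
    (forall a b, P a -> P b -> P (a * b)) ->
    (forall c a, P a -> P (c *: a)) ->
  forall a, P a.
Proof.
move=> Pg P1 PD PM PZ; elim/palgP; elim=> [//|c|t Pt u Pu|t Pt u Pu].
- by rewrite pcls_cst; apply: PZ.
- by rewrite pclsD; apply: PD.
- by rewrite pclsM; apply: PM.
Qed.

(* Universal property, the target being a ring B that is a K-algebra through
   the central ring morphism iota. *)
Section Lift.
Variables (B : pzRingType) (iota : {rmorphism K -> B}) (f : G -> B).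

Fixpoint aeval (t : aterm) : B :=
  match t with
  | AGen g => f g
  | ACst c => iota c
  | AAdd t u => aeval t + aeval u
  | AMul t u => aeval t * aeval u
  end.

Definition plift (a : palg) : B := aeval (repr a).

Hypothesis iota_central : forall c b, iota c * b = b * iota c.
Hypothesis f_rel : forall t u, rel t u -> aeval t = aeval u.

Lemma aeval_acong t u : acong t u -> aeval t = aeval u.
Proof.
elim=> {t u} //=.
- by move=> t u v _ -> _ ->.
- by move=> t t' u u' _ -> _ ->.
- by move=> t t' u u' _ -> _ ->.
- by move=> t u v; rewrite addrA.
- by move=> t u; rewrite addrC.
- by move=> t; rewrite rmorph0 add0r.
- by move=> t; rewrite rmorphN1 mulN1r addNr rmorph0.
- by move=> t u v; rewrite mulrA.
- by move=> t; rewrite rmorph1 mul1r.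
- by move=> t u v; rewrite mulrDl.
- by move=> t u v; rewrite mulrDr.
- by move=> a b; rewrite rmorphD.
- by move=> a b; rewrite rmorphM.
Qed.

Lemma plift_cls t : plift (pcls t) = aeval t.
Proof. exact/aeval_acong/repr_pcls. Qed.

Lemma plift_gen g : plift (pgen g) = f g.
Proof. exact: plift_cls. Qed.

Lemma plift1 : plift 1 = 1.
Proof. by rewrite plift_cls /= rmorph1. Qed.

Lemma pliftD a b : plift (a + b) = plift a + plift b.
Proof.
by elim/palgP: a => t; elim/palgP: b => u; rewrite -pclsD !plift_cls.
Qed.

Lemma pliftM a b : plift (a * b) = plift a * plift b.
Proof.
by elim/palgP: a => t; elim/palgP: b => u; rewrite -pclsM !plift_cls.
Qed.

Lemma pliftZ c a : plift (c *: a) = iota c * plift a.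
Proof. by rewrite -[c *: a]/(pcls (ACst c) * a) pliftM plift_cls. Qed.

End Lift.

Lemma palg_in_is_zmod : zmod_morphism (fun c : K => c *: (1 : palg)).
Proof. by move=> a b; rewrite scalerBl. Qed.

Lemma palg_in_is_monoid : monoid_morphism (fun c : K => c *: (1 : palg)).
Proof. by split=> [|a b]; rewrite ?scale1r // -palg_scalerAl mul1r scalerA. Qed.

Definition palg_in (c : K) : palg := c *: (1 : palg).
HB.instance Definition _ := GRing.isZmodMorphism.Build K palg palg_in
  palg_in_is_zmod.
HB.instance Definition _ := GRing.isMonoidMorphism.Build K palg palg_in
  palg_in_is_monoid.

Lemma palg_in_central c a : palg_in c * a = a * palg_in c.
Proof. by rewrite /palg_in -palg_scalerAl mul1r -palg_scalerAr mulr1. Qed.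

Definition is_module (W : lmodType K) (act : palg -> W -> W) : Prop :=
  [/\ forall w, linear (act^~ w),
      forall a, linear (act a),
      forall w, act 1 w = w
    & forall a b w, act (a * b) w = act a (act b w)].

(* The quotient of the algebra by the left ideal generated by S. *)
Section CyclicModule.
Variable S : palg -> Prop.

Inductive left_ideal : palg -> Prop :=
| left_ideal0 : left_ideal 0
| left_ideal_gen s : S s -> left_ideal s
| left_idealD a b : left_ideal a -> left_ideal b -> left_ideal (a + b)
| left_idealM a b : left_ideal b -> left_ideal (a * b).

Definition left_idealb (a : palg) : bool := `[< left_ideal a >].

Lemma left_idealb_zmod : zmod_closed left_idealb.
Proof.
split; first exact/asboolP/left_ideal0.
move=> a b /asboolP Sa /asboolP Sb; apply/asboolP/left_idealD => //.
by rewrite -mulN1r; exact: left_idealM.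
Qed.

HB.instance Definition _ := GRing.isZmodClosed.Build palg left_idealb
  left_idealb_zmod.

Definition lquot :=
  Quotient.quot (GRing.ZmodClosed.clone palg left_idealb _).
HB.instance Definition _ := Choice.on lquot.
HB.instance Definition _ := GRing.Zmodule.on lquot.
HB.instance Definition _ := ZmodQuotient.on lquot.

Definition lcls (a : palg) : lquot := \pi_lquot a.

Lemma lclsP a b : lcls a = lcls b <-> left_ideal (a - b).
Proof.
split=> [/eqP|ab]; first by rewrite -Quotient.idealrBE => /asboolP.
by apply/eqP; rewrite -Quotient.idealrBE; apply/asboolP.
Qed.

Lemma lcls_repr v : lcls (repr v) = v. Proof. exact: reprK. Qed.

Lemma lquotP (P : lquot -> Prop) : (forall a, P (lcls a)) -> forall v, P v.
Proof. by move=> PP v; rewrite -[v]lcls_repr. Qed.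

Lemma lclsD a b : lcls (a + b) = lcls a + lcls b.
Proof. exact: pi_addr. Qed.

Definition lact (a : palg) (v : lquot) : lquot := lcls (a * repr v).

Lemma lactE a b : lact a (lcls b) = lcls (a * b).
Proof.
apply/lclsP; rewrite -mulrBr; apply: left_idealM.
by apply/lclsP; rewrite lcls_repr.
Qed.

Definition lscale (c : K) (v : lquot) : lquot := lact (palg_in c) v.

Lemma lactA a b v : lact a (lact b v) = lact (a * b) v.
Proof. by elim/lquotP: v => x; rewrite !lactE mulrA. Qed.

Lemma lact1 v : lact 1 v = v.
Proof. by elim/lquotP: v => x; rewrite lactE mul1r. Qed.

Lemma lactDr a : {morph lact a : u v / u + v}.
Proof.
by elim/lquotP=> x; elim/lquotP=> y; rewrite -lclsD !lactE -lclsD mulrDr.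
Qed.

Lemma lactDl v : {morph lact^~ v : a b / a + b}.
Proof. by elim/lquotP: v => x a b; rewrite !lactE -lclsD mulrDl. Qed.

Lemma lscaleA a b v : lscale a (lscale b v) = lscale (a * b) v.
Proof. by rewrite /lscale lactA -rmorphM. Qed.

Lemma lscale1 : left_id 1 lscale.
Proof. by move=> v; rewrite /lscale rmorph1 lact1. Qed.

Lemma lscaleDr : right_distributive lscale +%R.
Proof. by move=> c; exact: lactDr. Qed.

Lemma lscaleDl v : {morph lscale^~ v : a b / a + b}.
Proof. by move=> a b; rewrite /lscale rmorphD lactDl. Qed.

HB.instance Definition _ := GRing.Zmodule_isLmodule.Build K lquot
  lscaleA lscale1 lscaleDr lscaleDl.

Lemma lclsZ c a : lcls (c *: a) = c *: lcls a.
Proof.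
rewrite -[RHS]/(lact (palg_in c) (lcls a)) lactE /palg_in.
by rewrite -palg_scalerAl mul1r.
Qed.

Lemma lact_is_module : is_module lact.
Proof.
split; [|move=> a c|exact: lact1|by move=> a b v; rewrite lactA].
- elim/lquotP=> x c a b.
  by rewrite !lactE -lclsZ -lclsD mulrDl -palg_scalerAl.
- elim/lquotP=> x; elim/lquotP=> y.
  by rewrite -lclsZ -lclsD !lactE -lclsZ -lclsD mulrDr -palg_scalerAr.
Qed.

End CyclicModule.
End PresentedAlgebra.

Arguments AGen {K G} _.
Arguments ACst {K G} _.
Notation "t + u" := (AAdd t u) : aterm_scope.
Notation "t * u" := (AMul t u) : aterm_scope.

(* A formal series in x^{1/N} is a function f : int -> W, f s being the
   coefficient of x^{s/N}; in two variables, F s t is the coefficient of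
   x_1^{s/N} x_2^{t/N}.  Series in integral powers are the case N = 1. *)
Section FormalSeries.
Variables (K : fieldType) (W : lmodType K).

Definition laurent (f : int -> W) : Prop :=
  exists s0 : int, forall s, s < s0 -> f s = 0.

Definition laurent2 (F : int -> int -> W) : Prop :=
  exists s0 : int, forall s t, (s < s0) || (t < s0) -> F s t = 0.

Definition const_series (w : W) (s : int) : W := if s == 0 then w else 0.

Definition gbinom (alpha : K) (j : nat) : K :=
  (\prod_(i < j) (alpha - i%:R)) / j`!%:R.

(* Multiplication by (x_1 + e x_2)^k. *)
Definition mul_binom (N : nat) (e : K) (k : nat) (F : int -> int -> W) :
    int -> int -> W :=
  iter k (fun F s t => F (s - N%:Z) t + e *: F s (t - N%:Z)) F.

(* F(x_1, x_2) at x_1^{1/N} = (x_2 + x_0)^{1/N}, a series in x_0 (integral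
   powers) and x_2^{1/N}:
   x_1^{s/N} x_2^{t/N} = \sum_(j >= 0) gbinom (s/N) j x_0^j x_2^{s/N + t/N - j}.
   The sum over s is finite as soon as laurent2 F; fsbigop sums of infinite
   support are 0 by convention. *)
Definition subst_x2Dx0 (N : nat) (F : int -> int -> W) (a b : int) : W :=
  match a with
  | Posz j => (\sum_(s \in [set: int])
      gbinom (s%:~R / N%:R) j *: F s (b + N%:Z * j%:Z - s))%R
  | Negz _ => 0
  end.

(* F(x_1, x_2) at x_1 = x_0 + x_2, for integral powers:
   x_1^s x_2^t = \sum_(j >= 0) gbinom s j x_0^{s - j} x_2^{t + j}. *)
Definition subst_x0Dx2 (F : int -> int -> W) (a b : int) : W :=
  (\sum_(j \in [set: nat])
      gbinom (a + j%:Z)%:~R j *: F (a + j%:Z) (b - j%:Z))%R.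

End FormalSeries.

(* Y v w s is the coefficient of x^s in Y(v,x)w, i.e. v_n w = Y v w (- n - 1). *)
Record is_nonlocal_va (K : fieldType) (V : lmodType K) (vac : V)
    (Y : V -> V -> int -> V) : Prop := {
  nlva_linearl : forall w s, linear (fun v => Y v w s);
  nlva_linearr : forall v s, linear (fun w => Y v w s);
  nlva_laurent : forall v w, laurent (Y v w);
  nlva_vacuum : forall v, Y vac v = const_series v;
  nlva_creation : forall v s, s <= 0 -> Y v vac s = const_series v s;
  nlva_assoc : forall u v w, exists l : nat, forall a b,
    mul_binom 1 1 l (subst_x0Dx2 (fun s t => Y u (Y v w t) s)) a b =
    mul_binom 1 1 l (fun s t => Y (Y u v s) w t) a b
}.

Definition is_automorphism (K : fieldType) (V : lmodType K) (vac : V)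
    (Y : V -> V -> int -> V) (sigma : V -> V) : Prop :=
  [/\ linear sigma, bijective sigma, sigma vac = vac
    & forall u v s, sigma (Y u v s) = Y (sigma u) (sigma v) s].

(* The twisted modules of (V, vac, Y) for an automorphism sigma with
   sigma^N = 1, with zeta = omega_N; YW v w s is the coefficient of x^{s/N} in
   Y_W(v,x)w. *)
Record is_twisted_module (K : fieldType) (N : nat) (zeta : K)
    (V : lmodType K) (vac : V) (Y : V -> V -> int -> V) (sigma : V -> V)
    (W : lmodType K) (YW : V -> W -> int -> W) : Prop := {
  tw_linearl : forall w s, linear (fun v => YW v w s);
  tw_linearr : forall v s, linear (fun w => YW v w s);
  tw_laurent : forall v w, laurent (YW v w);
  tw_vacuum : forall w, YW vac w = const_series w;
  tw_sigma : forall v w s, YW (sigma v) w s = (zeta^-1) ^ s *: YW v w s;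
  tw_assoc : forall u v, exists k : nat,
    let F w := mul_binom N (-1) k (fun s t => YW u (YW v w t) s) in
    (forall w, laurent2 (F w)) /\
    (forall w a b,
       YW (Y u v (a - k%:Z)) w b = subst_x2Dx0 N (F w) a b)
}.

(* The algebra with generators X_{i,m}, Y_{i,n}, m in rho + Z, n in - rho + Z:
   A_Q is the case rho = 0 and A_Q[theta_N] the case rho = 1/N.  The integers m
   below stand for the indices rho + m, resp. - rho + m. *)
Section QuantumWeyl.
Variables (K : fieldType) (r : nat) (Q : 'M[K]_r) (rho : rat).

Inductive qgen :=
| QX of 'I_r & int
| QY of 'I_r & int.

Definition idxX (m : int) : rat := rho + m%:~R.
Definition idxY (m : int) : rat := - rho + m%:~R.

Notation tX i m := (AGen (QX i m)).
Notation tY i m := (AGen (QY i m)).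

Inductive qrel : aterm K qgen -> aterm K qgen -> Prop :=
| qrelXX i j m n :
    qrel (tX i m * tX j n)%AT (ACst (Q i j) * (tX j n * tX i m))%AT
| qrelYY i j m n :
    qrel (tY i m * tY j n)%AT (ACst (Q i j) * (tY j n * tY i m))%AT
| qrelXY i j m n :
    qrel (tX i m * tY j n + ACst (- Q j i) * (tY j n * tX i m))%AT
         (ACst ((i == j) && (idxX m + idxY n + 1 == 0))%:R).

Definition qalg := palg qrel.
HB.instance Definition _ := GRing.PzRing.on qalg.
HB.instance Definition _ := GRing.Lmodule.on qalg.

Definition genX (i : 'I_r) (m : int) : qalg := pgen qrel (QX i m).
Definition genY (i : 'I_r) (m : int) : qalg := pgen qrel (QY i m).

(* X_i(x)w = \sum_m X_{i,m} w x^{-m-1} and likewise Y_i(x)w, as series in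
   x^{1/N}; each of the sums below has at most one term. *)
Definition seriesX (N : nat) (W : lmodType K) (act : qalg -> W -> W)
    (i : 'I_r) (w : W) (s : int) : W :=
  (\sum_(m \in [set m : int | - idxX m - 1 = s%:~R / N%:R])
     act (genX i m) w)%R.

Definition seriesY (N : nat) (W : lmodType K) (act : qalg -> W -> W)
    (i : 'I_r) (w : W) (s : int) : W :=
  (\sum_(m \in [set m : int | - idxY m - 1 = s%:~R / N%:R])
     act (genY i m) w)%R.

Definition restricted (W : lmodType K) (act : qalg -> W -> W) : Prop :=
  forall (w : W) (i : 'I_r), exists M : rat,
    (forall m, M <= idxX m -> act (genX i m) w = 0) /\
    (forall m, M <= idxY m -> act (genY i m) w = 0).

(* The scaling X_{i,m} |-> z X_{i,m}, Y_{i,n} |-> z^-1 Y_{i,n}. *)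
Definition qscale_gen (z : K) (g : qgen) : qalg :=
  match g with
  | QX i m => z *: genX i m
  | QY i m => z^-1 *: genY i m
  end.

Definition qscale (z : K) : qalg -> qalg :=
  plift (@palg_in K qgen qrel) (qscale_gen z).

Lemma qscale_rel z : z != 0 -> forall t u, qrel t u ->
  aeval (@palg_in K qgen qrel) (qscale_gen z) t =
  aeval (@palg_in K qgen qrel) (qscale_gen z) u.
Proof.
move=> z0 t u; have E t1 u1 (h : qrel t1 u1) := (pclsP qrel t1 u1).2 (acong_rel h).
case=> i j m n /=; rewrite -!palg_scalerAl -!palg_scalerAr !scalerA /palg_in.
- move: (E _ _ (qrelXX i j m n)); rewrite !pclsM pcls_cst -!palg_scalerAl mul1r.
  by rewrite -!/(pgen _ _) -!/(genX _ _) => ->; rewrite scalerA mulr1 mulrC !mulrA.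
- move: (E _ _ (qrelYY i j m n)); rewrite !pclsM pcls_cst -!palg_scalerAl mul1r.
  by rewrite -!/(pgen _ _) -!/(genY _ _) => ->; rewrite scalerA mulr1 mulrC !mulrA.
- move: (E _ _ (qrelXY i j m n)).
  rewrite pclsD !pclsM !pcls_cst -!palg_scalerAl mul1r.
  rewrite -!/(pgen _ _) -!/(genX _ _) -!/(genY _ _) => <-.
  by rewrite mulfV // mulrVK ?unitfE // scale1r mulr1.
Qed.

Section ScaleMorphism.
Variables (z : K) (z0 : z != 0).
Let rz := qscale_rel z0.
Let cz := @palg_in_central K qgen qrel.

Lemma qscaleX i m : qscale z (genX i m) = z *: genX i m.
Proof. exact: (plift_gen cz rz). Qed.

Lemma qscaleY i m : qscale z (genY i m) = z^-1 *: genY i m.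
Proof. exact: (plift_gen cz rz). Qed.

Lemma qscale1 : qscale z 1 = 1.
Proof. exact: (plift1 cz rz). Qed.

Lemma qscaleD : {morph qscale z : a b / a + b}.
Proof. exact: (pliftD cz rz). Qed.

Lemma qscaleM : {morph qscale z : a b / a * b}.
Proof. exact: (pliftM cz rz). Qed.

Lemma qscaleZ c : {morph qscale z : a / c *: a}.
Proof.
by move=> a; rewrite [LHS](pliftZ cz rz) /palg_in -palg_scalerAl mul1r.
Qed.

End ScaleMorphism.

Lemma qalg_ind (P : qalg -> Prop) :
    (forall i m, P (genX i m)) -> (forall i m, P (genY i m)) -> P 1 ->
    (forall a b, P a -> P b -> P (a + b)) ->
    (forall a b, P a -> P b -> P (a * b)) ->
    (forall c a, P a -> P (c *: a)) ->
  forall a, P a.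
Proof. by move=> PX PY; apply: palg_ind => -[]. Qed.

Lemma qscale_comp y z a : y != 0 -> z != 0 ->
  qscale y (qscale z a) = qscale (y * z) a.
Proof.
move=> y0 z0; have yz0 : y * z != 0 by rewrite mulf_neq0.
elim/qalg_ind: a => [i m|i m||a b IHa IHb|a b IHa IHb|c a IH].
- by rewrite !qscaleX // qscaleZ // qscaleX // scalerA mulrC.
- by rewrite !qscaleY // qscaleZ // qscaleY // scalerA invfM mulrC.
- by rewrite !qscale1.
- by rewrite !qscaleD // IHa IHb.
- by rewrite !qscaleM // IHa IHb.
- by rewrite !qscaleZ // IH.
Qed.

Lemma qscale_id a : qscale 1 a = a.
Proof.
have o0 : (1 : K) != 0 := oner_neq0 _.
elim/qalg_ind: a => [i m|i m||a b IHa IHb|a b IHa IHb|c a IH].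
- by rewrite qscaleX // scale1r.
- by rewrite qscaleY // invr1 scale1r.
- by rewrite qscale1.
- by rewrite qscaleD // IHa IHb.
- by rewrite qscaleM // IHa IHb.
- by rewrite qscaleZ // IH.
Qed.

End QuantumWeyl.

Section MulBinomLemmas.
Variables (K : fieldType) (V : lmodType K).
Implicit Types F : int -> int -> V.

Lemma fsbig_inj_linear (T : choiceType) (f : {linear V -> V}) (g : T -> V) :
  injective f ->
  (\sum_(j \in [set: T]) f (g j) = f (\sum_(j \in [set: T]) g j))%R.
Proof.
move=> fI; rewrite raddf_sum.
congr (\big[_/_]_(i <- _) _); rewrite /finite_support !unlock; congr (fset_set _).
by apply/seteqP; split=> x [_ /= H]; split=> // E; apply: H;
  [rewrite E raddf0|apply: fI; rewrite E raddf0].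
Qed.

Lemma mul_binomD N (e : K) k l F :
  mul_binom N e (k + l) F = mul_binom N e k (mul_binom N e l F).
Proof. by rewrite /mul_binom iterD. Qed.

Lemma mul_binom_linear N (e : K) k (f : {linear V -> V}) F s t :
  f (mul_binom N e k F s t) = mul_binom N e k (fun a b => f (F a b)) s t.
Proof.
elim: k s t => [//|k IH] s t.
by rewrite /mul_binom !iterS linearD linearZ -!/(mul_binom _ _ _ _) !IH.
Qed.

Lemma mul_binom_sub N (e : K) k F G s t :
  mul_binom N e k F s t - mul_binom N e k G s t =
  mul_binom N e k (fun a b => F a b - G a b) s t.
Proof.
elim: k s t => [//|k IH] s t.
rewrite /mul_binom !iterS -!/(mul_binom _ _ _ _) -!IH scalerBr.
by rewrite opprD addrACA.
Qed.

Lemma mul_binom_trunc (e : K) k F s0 : (forall s t, s < s0 -> F s t = 0) ->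
  forall s t, s < s0 -> mul_binom 1 e k F s t = 0.
Proof.
move=> F0; elim: k => [//|k IH] s t ss0.
rewrite /mul_binom !iterS -!/(mul_binom _ _ _ _) !IH ?scaler0 ?addr0 //.
lia.
Qed.

Lemma mul_binom1_inj F s0 : (forall s t, s < s0 -> F s t = 0) ->
  (forall s t, F (s - 1) t + 1 *: F s (t - 1) = 0) -> forall s t, F s t = 0.
Proof.
move=> F0 H.
have S n : forall s t, s < s0 + n%:Z -> F s t = 0.
  elim: n => [|n IH] s t; first by rewrite addr0; apply: F0.
  move=> sn; have := H s (t + 1); rewrite IH; last by lia.
  by rewrite scale1r add0r addrK.
move=> s t; apply: (S (absz (s - s0)).+1); lia.
Qed.

Lemma mul_binom_inj k F s0 : (forall s t, s < s0 -> F s t = 0) ->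
  (forall s t, mul_binom 1 1 k F s t = 0) -> forall s t, F s t = 0.
Proof.
elim: k => [//|k IH] F0 H; apply: IH => //.
apply: (@mul_binom1_inj _ s0); first exact: mul_binom_trunc.
exact: H.
Qed.
Definition linear_pack (f : V -> V) (hf : linear f) : {linear V -> V} :=
  HB.pack f (GRing.isLinear.Build K V V *:%R f hf).
End MulBinomLemmas.

Section VQ.
Variables (K : fieldType) (r : nat) (Q : 'M[K]_r).

Notation AQ := (qalg Q 0).

Inductive JQ_gen : AQ -> Prop :=
| JQ_genX i (n : int) : 0 <= n -> JQ_gen (genX Q 0 i n)
| JQ_genY i (n : int) : 0 <= n -> JQ_gen (genY Q 0 i n).

Definition VQ := lquot JQ_gen.
HB.instance Definition _ := GRing.Lmodule.on VQ.

Definition VQact (a : AQ) (v : VQ) : VQ := lact a v.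
Definition VQvac : VQ := lcls JQ_gen 1.
Definition VQu (i : 'I_r) : VQ := VQact (genX Q 0 i (-1)) VQvac.
Definition VQv (i : 'I_r) : VQ := VQact (genY Q 0 i (-1)) VQvac.

(* The map of V_Q induced by qscale z. *)
Definition VQscale (z : K) (v : VQ) : VQ := lcls JQ_gen (qscale z (repr v)).

Section ScaleLemmas.
Variables (z : K) (z0 : z != 0).

Lemma qscale_JQ (a : AQ) : left_ideal JQ_gen a -> left_ideal JQ_gen (qscale z a).
Proof.
elim=> {a} [|s Js|a b _ Ja _ Jb|a b _ Jb].
- have -> : qscale z 0 = 0 :> AQ.
    by rewrite -[X in qscale z X](scale0r (1 : AQ)) qscaleZ // scale0r.
  exact: left_ideal0.
- have JZ c (b : AQ) : left_ideal JQ_gen b -> left_ideal JQ_gen (c *: b).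
    by rewrite -[b in c *: b]mul1r palg_scalerAl; exact: left_idealM.
  by case: Js => i n n0; rewrite ?(qscaleX, qscaleY) //;
    apply/JZ/left_ideal_gen; constructor.
- by rewrite qscaleD //; exact: left_idealD.
- by rewrite qscaleM //; exact: left_idealM.
Qed.

Lemma VQscaleE (a : AQ) : VQscale z (lcls JQ_gen a) = lcls JQ_gen (qscale z a).
Proof.
apply/lclsP; set b := repr _.
have -> : qscale z b - qscale z a = qscale z (b - a).
  by rewrite -!scaleN1r qscaleD // qscaleZ.
by apply/qscale_JQ/lclsP; rewrite /b lcls_repr.
Qed.

Lemma VQscale_linear : linear (VQscale z).
Proof.
move=> c; elim/lquotP=> a; elim/lquotP=> b.
by rewrite -lclsZ -lclsD !VQscaleE -lclsZ -lclsD qscaleD // qscaleZ.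
Qed.

Lemma VQscale_vac : VQscale z VQvac = VQvac.
Proof. by rewrite VQscaleE qscale1. Qed.

Lemma VQscale_act (a : AQ) v :
  VQscale z (VQact a v) = VQact (qscale z a) (VQscale z v).
Proof.
by elim/lquotP: v => b; rewrite /VQact VQscaleE !lactE VQscaleE qscaleM.
Qed.

Lemma VQscale_u i : VQscale z (VQu i) = z *: VQu i.
Proof.
rewrite VQscale_act VQscale_vac qscaleX //.
by rewrite /VQu /VQact /VQvac !lactE -lclsZ palg_scalerAl.
Qed.

Lemma VQscale_v i : VQscale z (VQv i) = z^-1 *: VQv i.
Proof.
rewrite VQscale_act VQscale_vac qscaleY //.
by rewrite /VQv /VQact /VQvac !lactE -lclsZ palg_scalerAl.
Qed.

End ScaleLemmas.

Lemma VQscale_iter z n v : z != 0 -> iter n (VQscale z) v = VQscale (z ^+ n) v.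
Proof.
move=> z0; elim/lquotP: v => a; elim: n => [|n IH].
  by rewrite expr0 /VQscale qscale_id lcls_repr.
by rewrite iterS IH !VQscaleE ?expf_neq0 // qscale_comp ?expf_neq0 // exprS.
Qed.

Lemma VQscale_id v : VQscale 1 v = v.
Proof. by rewrite /VQscale qscale_id lcls_repr. Qed.
End VQ.

Section Automorphism.
Variables (K : fieldType) (r : nat) (Q : 'M[K]_r).
Variables (z : K) (z0 : z != 0).
Let th : {linear VQ Q -> VQ Q} :=
  linear_pack (@VQscale_linear K r Q z z0).

Let thE x : th x = VQscale z x. Proof. by []. Qed.

Let thI : injective th.
Proof.
elim/lquotP=> x; elim/lquotP=> y /(congr1 (VQscale z^-1)).
by rewrite !thE !VQscaleE ?invr_neq0 // !qscale_comp ?invr_neq0 // mulVf // !qscale_id.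
Qed.

Variable Y : VQ Q -> VQ Q -> int -> VQ Q.
Hypothesis hY : is_nonlocal_va (VQvac Q) Y.
Hypothesis hX : forall i, Y (VQu Q i) = seriesX 1 (@VQact K r Q) i.
Hypothesis hV : forall i, Y (VQv Q i) = seriesY 1 (@VQact K r Q) i.

Lemma VQact_seriesX i w m : seriesX 1 (@VQact K r Q) i w (- m - 1) = VQact (genX Q 0 i m) w.
Proof.
rewrite /seriesX (_ : mkset _ = [set m]%classic) ?fsbig_set1 //.
apply/seteqP; split=> x /=; rewrite /idxX add0r divr1 rmorphB rmorphN /=.
  by move=> /addIr /oppr_inj /intr_inj.
by move=> ->.
Qed.

Lemma VQact_seriesY i w m : seriesY 1 (@VQact K r Q) i w (- m - 1) = VQact (genY Q 0 i m) w.
Proof.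
rewrite /seriesY (_ : mkset _ = [set m]%classic) ?fsbig_set1 //.
apply/seteqP; split=> x /=; rewrite /idxY oppr0 add0r divr1 rmorphB rmorphN /=.
  by move=> /addIr /oppr_inj /intr_inj.
by move=> ->.
Qed.

Let P (a : VQ Q) := forall w s, th (Y a w s) = Y (th a) (th w) s.

Let L0 b t : Y 0 b t = 0.
Proof.
by have := nlva_linearl hY b t (-1) 0 0; rewrite !scaleN1r oppr0 addr0 addNr.
Qed.

Let P_nth u v s : P u -> P v -> P (Y u v s).
Proof.
move=> Pu Pv w t.
have [l1 H1] := nlva_assoc hY u v w.
have [l2 H2] := nlva_assoc hY (th u) (th v) (th w).
apply/eqP; rewrite -subr_eq0; apply/eqP.
rewrite Pu.
pose F a b := th (Y (Y u v a) w b).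
pose G a b := Y (Y (th u) (th v) a) (th w) b.
have [s1 T1] := nlva_laurent hY u v.
rewrite -Pu -/(F s t).
have -> : Y (th (Y u v s)) (th w) t = G s t by rewrite /G Pu.
apply: (@mul_binom_inj _ _ (l1 + l2) (fun a b => F a b - G a b) s1).
  move=> a b ab; rewrite /F /G -Pu T1 //.
  by rewrite raddf0 !L0 raddf0 subrr.
move=> a b; rewrite -mul_binom_sub; apply/eqP; rewrite subr_eq0; apply/eqP.
rewrite {1}addnC !mul_binomD.
have E1 : mul_binom 1 1 l1 F =
  mul_binom 1 1 l1 (subst_x0Dx2 (fun s t => th (Y u (Y v w t) s))).
  apply/funext=> a'; apply/funext=> b'.
  rewrite -(mul_binom_linear 1 1 l1 th) -H1 mul_binom_linear.
  congr (mul_binom _ _ _ _ _ _); apply/funext=> a1; apply/funext=> b1.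
  rewrite /subst_x0Dx2 -(fsbig_inj_linear _ thI).
  by under eq_fsbigr do rewrite linearZ.
have E2 : mul_binom 1 1 l2 G =
  mul_binom 1 1 l2 (subst_x0Dx2 (fun s t => th (Y u (Y v w t) s))).
  apply/funext=> a'; apply/funext=> b'; rewrite -H2.
  congr (mul_binom _ _ _ (subst_x0Dx2 _) _ _).
  by apply/funext=> a1; apply/funext=> b1; rewrite Pu Pv.
by rewrite E1 E2 -!mul_binomD addnC.
Qed.

Let P_u i : P (VQu Q i).
Proof.
move=> w s; have -> : s = - (- s - 1) - 1 by lia.
rewrite hX VQact_seriesX !thE VQscale_act // VQscale_u // qscaleX //.
have -> : Y (z *: VQu Q i) = fun w s => z *: Y (VQu Q i) w s.
  apply/funext=> w'; apply/funext=> s'.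
  have := nlva_linearl hY w' s' z (VQu Q i) 0; rewrite addr0 => ->.
  by rewrite L0 addr0.
rewrite hX VQact_seriesX; elim/lquotP: (VQscale _ _) => x.
by rewrite /VQact !lactE -lclsZ palg_scalerAl.
Qed.

Let P_v i : P (VQv Q i).
Proof.
move=> w s; have -> : s = - (- s - 1) - 1 by lia.
rewrite hV VQact_seriesY !thE VQscale_act // VQscale_v // qscaleY //.
have -> : Y (z^-1 *: VQv Q i) = fun w s => z^-1 *: Y (VQv Q i) w s.
  apply/funext=> w'; apply/funext=> s'.
  have := nlva_linearl hY w' s' z^-1 (VQv Q i) 0; rewrite addr0 => ->.
  by rewrite L0 addr0.
rewrite hV VQact_seriesY; elim/lquotP: (VQscale _ _) => x.
by rewrite /VQact !lactE -lclsZ palg_scalerAl.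
Qed.

Let P_lin c a b : P a -> P b -> P (c *: a + b).
Proof.
move=> Pa Pb w s; have L := nlva_linearl hY.
by rewrite (L w s) linearP Pa Pb linearP (L (th w) s).
Qed.

Let P_all a : P a.
Proof.
suff H x : forall v, P v -> P (VQact x v).
  elim/lquotP: a => x; rewrite -[x]mulr1.
  have := H x (VQvac Q); rewrite /VQact /VQvac lactE; apply.
  move=> w s; rewrite [th (VQvac Q)]VQscale_vac // (nlva_vacuum hY) (nlva_vacuum hY).
  by rewrite /const_series; case: eqP => // _; rewrite raddf0.
elim/qalg_ind: x => [i m|i m||a1 b IHa IHb|a1 b IHa IHb|c a1 IH] v Pv.
- by rewrite -VQact_seriesX -hX; apply: P_nth => //; apply: P_u.
- by rewrite -VQact_seriesY -hV; apply: P_nth => //; apply: P_v.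
- by rewrite /VQact lact1.
- rewrite /VQact lactDl -[lact a1 v]scale1r.
  by apply: P_lin; [exact: IHa|exact: IHb].
- by rewrite /VQact -lactA; apply: IHa; apply: IHb.
- have -> : VQact (c *: a1) v = c *: VQact a1 v + 0.
    by elim/lquotP: v {Pv} => x; rewrite /VQact !lactE addr0 -lclsZ palg_scalerAl.
  apply: P_lin; first exact: IH.
  by move=> w s; rewrite raddf0 !L0 raddf0.
Qed.

Lemma VQscale_automorphism : is_automorphism (VQvac Q) Y (VQscale z).
Proof.
split; [exact: VQscale_linear| |exact: VQscale_vac|exact: P_all].
exists (VQscale z^-1) => v; elim/lquotP: v => x;
  by rewrite !VQscaleE ?invr_neq0 // qscale_comp ?invr_neq0 // ?mulVf ?mulfV //
    qscale_id.
Qed.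

End Automorphism.

Section Theta.
Variable R : realType.

(* exp (2 pi sqrt(-1) / N) *)
Definition omega (N : nat) : R[i] :=
  (cos (2 * pi / N%:R) +i* sin (2 * pi / N%:R))%C.

Definition theta (N r : nat) (Q : 'M[R[i]]_r) : VQ Q -> VQ Q :=
  @VQscale _ r Q (omega N).

Lemma omegaX N : (0 < N)%N -> omega N ^+ N = 1.
Proof.
move=> N0.
have H k : omega N ^+ k =
    (cos (2 * pi / N%:R *+ k) +i* sin (2 * pi / N%:R *+ k))%C.
  elim: k => [|k IH]; first by rewrite expr0 !mulr0n cos0 sin0.
  rewrite exprS IH (mulrS (2 * pi / N%:R)) cosD sinD /omega; simpc.
  by congr (_ +i* _)%C; rewrite addrC.
rewrite H -mulr_natr mulfVK ?pnatr_eq0 -?lt0n // mulr_natl cos2pi sin2pi.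
by [].
Qed.

Lemma omega_neq0 N : (0 < N)%N -> omega N != 0.
Proof.
move=> N0; apply/eqP => w0; have := omegaX N0.
by rewrite w0 expr0n (negPf (lt0n_neq0 N0)) => /esym/eqP; rewrite oner_eq0.
Qed.

Lemma theta_order N r (Q : 'M[R[i]]_r) v : (0 < N)%N ->
  iter N (@theta N r Q) v = v.
Proof. by move=> N0; rewrite VQscale_iter ?omega_neq0 // omegaX // VQscale_id. Qed.

Lemma theta_automorphism N r (Q : 'M[R[i]]_r) (Y : VQ Q -> VQ Q -> int -> VQ Q) :
    (0 < N)%N -> is_nonlocal_va (VQvac Q) Y ->
    (forall i, Y (VQu Q i) = seriesX 1 (@VQact _ _ Q) i) ->
    (forall i, Y (VQv Q i) = seriesY 1 (@VQact _ _ Q) i) ->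
  is_automorphism (VQvac Q) Y (@theta N r Q).
Proof. by move=> N0; apply: VQscale_automorphism; exact: omega_neq0. Qed.

End Theta.

(* Main.v *)
Require Import Defs.
From HB Require Import structures.
From mathcomp Require Import all_boot all_order all_algebra.
From mathcomp Require Import complex.
From mathcomp Require Import zify ring lra.
From mathcomp Require Import boolp classical_sets functions fsbigop.
From mathcomp Require Import reals trigo.
Set Implicit Arguments.
Unset Strict Implicit.
Unset Printing Implicit Defensive.
Import Order.TTheory GRing.Theory Num.Theory.
Local Open Scope ring_scope.

(* Series in x_1, x_2 with exponents bounded below are determined by their
   expansions at x_1 = x_2 + x_0.  On a restricted module W, the generating
   fields are q-local, and (a_n c)(x_2) is read off as a coefficient of the
   expansion of (x_1 - x_2)^k a(x_1) c(x_2).  Comparing the two orders of the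
   expansions of a(x_1) b(x_2) c(x_3) at x_1 = x_3 + t, x_2 = x_3 + y shows that
   these operations satisfy the relations of A_Q on the span of the fields that
   are q-local with the generating ones (a set closed under a_n by Dong's
   lemma).  Since the identity field is killed by the modes n >= 0, V_Q maps to
   that span: this is Y_W.  Associativity for (a_m u, v) follows from the one for
   (a, u), (a, v), (u, v) by computing a(x_3 + y + z) u(x_3 + y) v(x_3) in two
   ways and using the associativity of Y.  Conversely, on a twisted module the
   expansions of a(x_1) b(x_2) 1 show that the fields of the generators commute up
   to q after multiplication by (x_1 - x_2)^k; on a line of fixed total degree,
   multiplication by x_1 - x_2 is a difference operator, which yields the
   commutation relations of the modes. *)

(** * Finite sums and binomial coefficients *)

(** Two obstacles shape the argument. First, the scalar in q-locality depends on the monomial in the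
    generators, and a sum of fields with different scalars need not be q-local with the generating
    fields. Locality is therefore used on monomials only, and just the linear consequences are
    extended to their span. Second, the order k in the definition of a twisted module may depend on
    u and v but not on the vector of W. Binomial factors are thus cancelled with orders uniform in
    that vector, which is why many statements read [exists k, forall w].

    Multiplication by x_1 - x_2 is not injective on series that are unbounded in both directions:
    its kernel consists of delta series. Every cancellation needs a lower bound on exponents; where
    there is none, the delta series is the contraction term of the relations.

    The twist is invisible to the products a_n c, which are coefficients of integral powers of x_0.
    So it is the untwisted algebra A_Q that acts on fields over W, and N enters through the supports
    of the fields modulo N. *)

Section FiniteSums.
Variables (K : fieldType) (T : choiceType).
Implicit Types (V W : lmodType K).

(** The sum [tsum] is 0 by default on infinite supports, so its linearity needs [finsup]; bounding
    the support by a sequence lets several families share one range. *)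
Definition finsup V (f : T -> V) := exists r : seq T, forall s, s \notin r -> f s = 0.

Definition tsum V (f : T -> V) : V := (\sum_(s \in [set: T]) f s)%R.

Lemma tsumE V (f : T -> V) (r : seq T) : uniq r ->
  (forall s, s \notin r -> f s = 0) -> tsum f = \sum_(s <- r) f s.
Proof.
move=> ur f0; rewrite /tsum (fsbigE r) //; last by move=> i _; exact: f0.
by under eq_bigl do rewrite in_setT.
Qed.

Lemma tsumE_undup V (f : T -> V) (r : seq T) :
  (forall s, s \notin r -> f s = 0) -> tsum f = \sum_(s <- undup r) f s.
Proof. by move=> f0; apply: tsumE (undup_uniq _) _ => s; rewrite mem_undup; exact: f0. Qed.

Lemma finsupD V (f g : T -> V) : finsup f -> finsup g -> finsup (fun s => f s + g s).
Proof.
move=> [r fr] [q gq]; exists (r ++ q) => s; rewrite mem_cat negb_or => /andP[sr sq].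
by rewrite fr // gq // addr0.
Qed.

Lemma finsupZ V (f : T -> V) (c : K) : finsup f -> finsup (fun s => c *: f s).
Proof. by move=> [r fr]; exists r => s sr; rewrite fr ?scaler0. Qed.

Lemma finsup0 V : finsup (fun _ : T => 0 : V).
Proof. by exists [::]. Qed.

Lemma tsumD V (f g : T -> V) : finsup f -> finsup g ->
  tsum (fun s => f s + g s) = tsum f + tsum g.
Proof.
move=> [r fr] [q gq].
have H s : s \notin r ++ q -> f s = 0 /\ g s = 0.
  by rewrite mem_cat negb_or => /andP[sr sq]; rewrite fr // gq.
rewrite !(@tsumE_undup _ _ (r ++ q)) -?big_split //.
- by move=> s /H[_ ->].
- by move=> s /H[-> _].
- by move=> s /H[-> ->]; rewrite addr0.
Qed.

Lemma tsum_lin V W (f : T -> V) (h : {additive V -> W}) : finsup f ->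
  h (tsum f) = tsum (fun s => h (f s)).
Proof.
move=> [r fr]; rewrite !(@tsumE_undup _ _ r) ?raddf_sum // => s sr.
by rewrite fr // raddf0.
Qed.

Lemma tsumZ V (f : T -> V) (c : K) : finsup f ->
  tsum (fun s => c *: f s) = c *: tsum f.
Proof.
move=> [r fr]; rewrite !(@tsumE_undup _ _ r) ?scaler_sumr // => s sr.
by rewrite fr // scaler0.
Qed.

Lemma tsumN V (f : T -> V) : finsup f -> tsum (fun s => - f s) = - tsum f.
Proof.
move=> ff; rewrite -scaleN1r -tsumZ //; congr tsum.
by apply/funext => s; rewrite scaleN1r.
Qed.

Lemma tsum_sum V I (r : seq I) (P : pred I) (f : I -> T -> V) :
  (forall i, finsup (f i)) ->
  tsum (fun s => \sum_(i <- r | P i) f i s) = \sum_(i <- r | P i) tsum (f i).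
Proof.
move=> ff; suff: finsup (fun s => \sum_(i <- r | P i) f i s) /\
  tsum (fun s => \sum_(i <- r | P i) f i s) = \sum_(i <- r | P i) tsum (f i) by case.
elim: r => [|i r [IHf IH]].
  under [X in finsup X]funext do rewrite big_nil.
  under [X in tsum X]funext do rewrite big_nil.
  by split; [exact: finsup0|rewrite big_nil (@tsumE_undup _ _ [::]) ?big_nil].
under [X in finsup X]funext do rewrite big_cons.
under [X in tsum X]funext do rewrite big_cons.
rewrite big_cons; case: ifP => // _; rewrite -IH; split; first exact: finsupD.
exact: tsumD.
Qed.

Lemma tsum1 V (f : T -> V) (t : T) : (forall s, s != t -> f s = 0) -> tsum f = f t.
Proof.
move=> f0; rewrite (@tsumE _ _ [:: t]) ?big_seq1 // => s; rewrite inE; exact: f0.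
Qed.

Lemma tsum_eq0 V (f : T -> V) : (forall s, f s = 0) -> tsum f = 0.
Proof. by move=> f0; rewrite (@tsumE _ _ [::]) ?big_nil. Qed.

Lemma eq_tsum V (f g : T -> V) : f =1 g -> tsum f = tsum g.
Proof. by move=> /funext ->. Qed.

End FiniteSums.

Lemma tsum_reindex (K : fieldType) (V : lmodType K) (T U : choiceType)
    (h : T -> U) (h' : U -> T) (f : U -> V) : cancel h h' -> cancel h' h ->
  tsum f = tsum (fun s => f (h s)).
Proof.
by move=> hK h'K; rewrite /tsum (reindex_fsbigT h) //; exists h'.
Qed.

Lemma exchange_tsum (K : fieldType) (V : lmodType K) (T U : choiceType)
    (f : T -> U -> V) (r : seq T) (q : seq U) :
  (forall s t, (s \notin r) || (t \notin q) -> f s t = 0) ->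
  tsum (fun s => tsum (fun t => f s t)) = tsum (fun t => tsum (fun s => f s t)).
Proof.
move=> f0; rewrite (@tsumE_undup _ _ _ _ r).
  rewrite (@tsumE_undup _ _ _ _ q).
    transitivity (\sum_(s <- undup r) \sum_(t <- undup q) f s t).
      by apply: eq_bigr => s _; apply: tsumE_undup => t tq; rewrite f0 // tq orbT.
    rewrite exchange_big; apply: eq_bigr => t _; apply/esym/tsumE_undup.
    by move=> s sr; rewrite f0 // sr.
  by move=> t tq; apply: tsum_eq0 => s; rewrite f0 // tq orbT.
by move=> s sr; apply: tsum_eq0 => t; rewrite f0 // sr.
Qed.

Definition zrange (lo hi : int) : seq int :=
  [seq lo + i%:Z | i <- iota 0 (absz (hi - lo)).+1].

Lemma notin_zrange lo hi s : s \notin zrange lo hi -> (s < lo) || (hi < s).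
Proof.
apply: contraNT; rewrite negb_or -!leNgt => /andP[ls sh].
apply/mapP; exists (absz (s - lo)); last by lia.
by rewrite mem_iota; lia.
Qed.

Lemma finsup_zrange (K : fieldType) (V : lmodType K) (f : int -> V) lo hi :
  (forall s, (s < lo) || (hi < s) -> f s = 0) -> finsup f.
Proof. by move=> f0; exists (zrange lo hi) => s /notin_zrange; exact: f0. Qed.

Lemma tsum_shift (K : fieldType) (V : lmodType K) (f : int -> V) n :
  tsum (fun s => f (s + n)) = tsum f.
Proof.
by symmetry; apply: (@tsum_reindex _ _ _ _ _ (fun s => s - n)) => s; rewrite ?addrK ?subrK.
Qed.

Section Binomials.
Variable K : numFieldType.
Implicit Types a b : K.

Lemma gbinom0 a : gbinom a 0 = 1.
Proof. by rewrite /gbinom big_ord0 fact0 divr1. Qed.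

Lemma gbinomS a j : j.+1%:R * gbinom a j.+1 = (a - j%:R) * gbinom a j.
Proof.
rewrite /gbinom big_ord_recr /= factS natrM.
have h1 : j.+1%:R != 0 :> K by rewrite pnatr_eq0.
have h2 : (j`!)%:R != 0 :> K by rewrite pnatr_eq0 -lt0n fact_gt0.
move: h1 h2; move: (j.+1%:R : K) (j`!%:R : K) (\prod_(i < j) _) => c d p c0 d0.
by field; rewrite c0 d0.
Qed.

Lemma natS_inj j a b : j.+1%:R * a = j.+1%:R * b -> a = b.
Proof. by apply: mulfI; rewrite pnatr_eq0. Qed.
Arguments natS_inj j {a b} _.

Lemma gbinom0S j : gbinom (0 : K) j.+1 = 0.
Proof.
elim: j => [|j IH]; first by apply: (natS_inj 0%N); rewrite gbinomS subrr mul0r mulr0.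
apply: (natS_inj j.+1); rewrite gbinomS mulr0.
by rewrite IH mulr0.
Qed.

Lemma gbinom_pascal a j : gbinom (a + 1) j.+1 = gbinom a j.+1 + gbinom a j.
Proof.
have H c : gbinom c 1 = c :> K by apply: (natS_inj 0%N); rewrite gbinomS gbinom0 subr0 mulr1 mul1r.
elim: j => [|j IH]; first by rewrite !H gbinom0.
apply: (natS_inj j.+1); rewrite gbinomS IH [RHS]mulrDr gbinomS.
have := gbinomS a j; rewrite -!natr1.
move: (gbinom a j) (gbinom a j.+1) => x y E.
transitivity ((a - j%:R) * y + (a - j%:R) * x); first by ring.
by rewrite -E; ring.
Qed.

(** Induction on j: in the l-th summand a + b - j is split as (a - l) + (b - (j - l)), and [gbinomS]
    absorbs each part by raising one of the two indices. The weights l and j + 1 - l that arise add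
    up to j + 1. *)
Lemma gbinom_vandermonde a b j :
  gbinom (a + b) j = \sum_(l < j.+1) gbinom a l * gbinom b (j - l).
Proof.
elim: j => [|j IH]; first by rewrite big_ord1 !gbinom0 mulr1.
apply: (natS_inj j); rewrite gbinomS IH.
transitivity (\sum_(l < j.+2) (l%:R * gbinom a l) * gbinom b (j.+1 - l)
    + \sum_(l < j.+2) gbinom a l * ((j.+1 - l)%:R * gbinom b (j.+1 - l))).
  rewrite [X in _ = X + _]big_ord_recl /= mulr0n !mul0r add0r.
  rewrite [X in _ = _ + X]big_ord_recr /= subnn mul0r mulr0 addr0 -big_split mulr_sumr.
  apply: eq_bigr => l _ /=; have lj : (l <= j)%N by rewrite -ltnS.
  rewrite /bump /= add1n subSS gbinomS subSn // gbinomS natrB //; ring.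
rewrite -big_split mulr_sumr; apply: eq_bigr => l _ /=.
have lj : (l <= j.+1)%N by rewrite -ltnS.
rewrite natrB //; ring.
Qed.

Lemma gbinom_mul a i l :
  gbinom a i * gbinom (a - i%:R) l = 'C(i + l, l)%:R * gbinom a (i + l).
Proof.
elim: l => [|l IH]; first by rewrite addn0 bin0 gbinom0 mulr1 mul1r.
apply: (natS_inj l); rewrite mulrCA gbinomS mulrCA IH.
rewrite [RHS]mulrA -natrM addnS -mul_bin_diag natrM /= [X in _ = X * _]mulrC -[RHS]mulrA gbinomS.
by rewrite mulrCA natrD opprD addrA.
Qed.

Lemma gbinom_nat n j : gbinom (n%:R : K) j = 'C(n, j)%:R.
Proof.
elim: n j => [|n IH] [|j]; rewrite ?gbinom0 ?bin0 //.
  by rewrite gbinom0S.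
by rewrite -natr1 gbinom_pascal !IH binS natrD.
Qed.

End Binomials.

(** * Expansions at x_1 = x_2 + x_0 *)

Section LinearPack.
Variables (K : pzRingType) (V W : lmodType K).
Definition lin_pack (f : V -> W) (hf : linear f) : {linear V -> W} :=
  HB.pack f (GRing.isLinear.Build K V W *:%R f hf).
End LinearPack.

Section LinearFun.
Variables (K : pzRingType) (V W : lmodType K) (f : V -> W) (hf : linear f).
Lemma linf0 : f 0 = 0. Proof. exact: (raddf0 (lin_pack hf)). Qed.
Lemma linfD u v : f (u + v) = f u + f v. Proof. exact: (raddfD (lin_pack hf)). Qed.
Lemma linfZ c u : f (c *: u) = c *: f u. Proof. by have := hf c u 0; rewrite linf0 !addr0. Qed.
Lemma raddf_lin_sum I (r : seq I) (P : pred I) (F : I -> V) :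
  f (\sum_(i <- r | P i) F i) = \sum_(i <- r | P i) f (F i).
Proof. exact: (raddf_sum (lin_pack hf)). Qed.
End LinearFun.

Lemma tsum_linear (K : fieldType) (T : choiceType) (V W : lmodType K) (f : T -> V)
    (h : V -> W) : linear h -> finsup f -> h (tsum f) = tsum (fun s => h (f s)).
Proof. by move=> hl; exact: (tsum_lin (lin_pack hl)). Qed.

Section TwoVariables.
Variables (K : numFieldType) (N : nat).
Implicit Types (V W : lmodType K).

Local Notation mulZ := (mul_binom N (-1)).
Local Notation subst := (subst_x2Dx0 N).

Lemma mul_binomS V (e : K) M k (F : int -> int -> V) s t :
  mul_binom M e k.+1 F s t =
  mul_binom M e k F (s - M%:Z) t + e *: mul_binom M e k F s (t - M%:Z).
Proof. by []. Qed.

Lemma mul_binomSr V (e : K) M k (F : int -> int -> V) :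
  mul_binom M e k.+1 F = mul_binom M e k (mul_binom M e 1 F).
Proof. by rewrite -mul_binomD addn1. Qed.

(** The dependence of [h] on the exponents, with period [M], is there for the character
    [z^-1 ^ (s + t)] of [YW_scale]. *)
Lemma mul_binom_additive V W (e : K) M k (h : int -> int -> V -> W) F s t :
  (forall s t, h (s - M%:Z) t = h s t) -> (forall s t, h s (t - M%:Z) = h s t) ->
  (forall s t, linear (h s t)) ->
  h s t (mul_binom M e k F s t) = mul_binom M e k (fun s t => h s t (F s t)) s t.
Proof.
move=> h1 h2 hl; elim: k s t => [//|k IH] s t.
by rewrite !mul_binomS (linfD (hl s t)) (linfZ (hl s t)) -!IH h1 h2.
Qed.

Lemma mul_binom_lin V W (e : K) M k (h : V -> W) (hl : linear h) F s t :
  h (mul_binom M e k F s t) = mul_binom M e k (fun s t => h (F s t)) s t.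
Proof. exact: (@mul_binom_additive _ _ e M k (fun _ _ => h)). Qed.

Lemma mul_binom_comb V (e : K) M k c (F G : int -> int -> V) s t :
  mul_binom M e k (fun s t => c *: F s t + G s t) s t =
  c *: mul_binom M e k F s t + mul_binom M e k G s t.
Proof.
elim: k s t => [//|k IH] s t; rewrite !mul_binomS !IH !scalerDr !scalerA.
by rewrite [e * c]mulrC addrACA.
Qed.

Lemma laurent2_comb V c (F G : int -> int -> V) : laurent2 F -> laurent2 G ->
  laurent2 (fun s t => c *: F s t + G s t).
Proof.
move=> [a Fa] [b Gb]; exists (Num.min a b) => s t st.
by rewrite Fa ?Gb ?scaler0 ?addr0 //; lia.
Qed.

Lemma laurent2_mul V (e : K) M k (F : int -> int -> V) :
  laurent2 F -> laurent2 (mul_binom M e k F).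
Proof.
move=> [a Fa]; exists a; elim: k => [//|k IH] s t st.
by rewrite mul_binomS !IH ?scaler0 ?addr0 //; lia.
Qed.

(* Coefficient of x_0^a in (1 + x_0)^{s/N}, extended by 0 to a < 0. *)
Definition gb (s a : int) : K :=
  match a with Posz j => gbinom (s%:~R / N%:R) j | Negz _ => 0 end.

Lemma finsup_diag V (F : int -> int -> V) (c : int -> K) n : laurent2 F ->
  finsup (fun s => c s *: F s (n - s)).
Proof.
move=> [a Fa]; apply: (@finsup_zrange _ _ _ a (n - a)) => s sn.
by rewrite Fa ?scaler0 //; lia.
Qed.

Lemma substE V (F : int -> int -> V) a b :
  subst F a b = tsum (fun s => gb s a *: F s (b + N%:Z * a - s)).
Proof. by case: a => [//|a]; rewrite tsum_eq0 // => s; rewrite scale0r. Qed.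

Lemma subst_comb V c (F G : int -> int -> V) a b : laurent2 F -> laurent2 G ->
  subst (fun s t => c *: F s t + G s t) a b = c *: subst F a b + subst G a b.
Proof.
move=> LF LG; rewrite !substE -tsumZ; last exact: finsup_diag.
rewrite -tsumD; try exact: finsup_diag; last first.
  exact/finsupZ/finsup_diag.
by apply: eq_tsum => s; rewrite scalerDr !scalerA mulrC.
Qed.

Lemma subst_lin V W (h : V -> W) (hl : linear h) (F : int -> int -> V) a b :
  laurent2 F -> h (subst F a b) = subst (fun s t => h (F s t)) a b.
Proof.
move=> LF; rewrite !substE (tsum_linear hl); last exact: finsup_diag.
by apply: eq_tsum => s; rewrite /= (linfZ hl).
Qed.

Lemma subst_mulX2 V (F : int -> int -> V) a b :
  subst (fun s t => F s (t - N%:Z)) a b = subst F a (b - N%:Z).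
Proof. by rewrite !substE; apply: eq_tsum => s; congr (_ *: F _ _); lia. Qed.

Hypothesis N0 : (0 < N)%N.

Lemma gb_shift s a : gb (s + N%:Z) a = gb s a + gb s (a - 1).
Proof.
have NK : (N%:R : K) != 0 by rewrite pnatr_eq0 -lt0n.
have E : (s + N%:Z)%:~R / N%:R = s%:~R / N%:R + 1 :> K.
  by rewrite rmorphD /= mulrDl mulfV.
case: a => [[|j]|j]; first by rewrite /= !gbinom0 addr0.
  by rewrite (_ : Posz j.+1 - 1 = Posz j) /= ?E ?gbinom_pascal //; lia.
by rewrite (_ : Negz j - 1 = Negz j.+1) /= ?addr0 //; lia.
Qed.

Lemma subst_mulX1 V (F : int -> int -> V) a b : laurent2 F ->
  subst (fun s t => F (s - N%:Z) t) a b = subst F a (b - N%:Z) + subst F (a - 1) b.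
Proof.
move=> LF; rewrite !substE -(tsum_shift _ N%:Z) -tsumD; try exact: finsup_diag.
apply: eq_tsum => s; rewrite gb_shift scalerDl addrK.
by congr (_ *: F _ _ + _ *: F _ _); lia.
Qed.

(** The factor x_1 - x_2 becomes x_0: Pascal's rule turns x_1 into x_2 + x_0, and the x_2 parts
    cancel. *)
Lemma subst_mulZ V k (F : int -> int -> V) a b : laurent2 F ->
  subst (mulZ k F) a b = subst F (a - k%:Z) b.
Proof.
move=> LF; elim: k a => [|k IH] a; first by rewrite subr0.
have L := laurent2_mul (-1) N k LF.
have Lx : laurent2 (fun s t => mulZ k F (s - N%:Z) t).
  by case: L => c Lc; exists c => s t st; rewrite Lc //; lia.
have Ly : laurent2 (fun s t => mulZ k F s (t - N%:Z)).
  by case: L => c Lc; exists c => s t st; rewrite Lc //; lia.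
transitivity (subst (fun s t => (-1) *: mulZ k F s (t - N%:Z) + mulZ k F (s - N%:Z) t) a b).
  by rewrite !substE; apply: eq_tsum => s; rewrite mul_binomS addrC.
rewrite subst_comb // subst_mulX1 // subst_mulX2 scaleN1r addKr IH.
by congr subst; lia.
Qed.

Lemma subst_neg V (F : int -> int -> V) a b : a < 0 -> subst F a b = 0.
Proof. by case: a. Qed.

(* g is the expansion of F at x_1 = x_2 + x_0, possibly with a pole of order k at
   x_0 = 0, the binomials being cleared before substituting. *)
Definition qexp V k (F g : int -> int -> V) :=
  laurent2 (mulZ k F) /\ forall a b, g (a - k%:Z) b = subst (mulZ k F) a b.

Lemma qexpSr V k (F g : int -> int -> V) :
  qexp k.+1 F g <-> qexp k (mulZ 1 F) (fun a b => g (a - 1) b).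
Proof.
rewrite /qexp -mul_binomSr; split=> -[L E]; split=> // a b; rewrite -E; congr g; lia.
Qed.

Lemma qexp_up V k (F g : int -> int -> V) : qexp k F g -> qexp k.+1 F g.
Proof.
move=> [L E]; split; first exact: (laurent2_mul (-1) N 1 L).
by move=> a b; rewrite -(addn1 k) addnC mul_binomD subst_mulZ // -E; congr g; lia.
Qed.

Lemma qexp_le V k l (F g : int -> int -> V) : (k <= l)%N -> qexp k F g -> qexp l F g.
Proof.
by move=> /subnK <-; elim: (l - k)%N => [//|m IH] /IH; rewrite addSn; exact: qexp_up.
Qed.

Lemma qexp_mulZ V k (F g : int -> int -> V) :
  qexp k F g -> qexp k (mulZ 1 F) (fun a b => g (a - 1) b).
Proof. by move=> /qexp_up /qexpSr. Qed.

(** When F is already bounded below, the factor cleared in F is an honest x_0^k after substitution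
    and can be shifted away. *)
Lemma qexp_down V k (F g : int -> int -> V) : laurent2 F -> qexp k F g -> qexp 0 F g.
Proof.
move=> L [_ E]; split=> // a b; rewrite subr0 -[RHS]/(subst F a b).
by have := E (a + k%:Z) b; rewrite subst_mulZ // addrK.
Qed.

Lemma qexp_comb V k c (F g F' g' : int -> int -> V) : qexp k F g -> qexp k F' g' ->
  qexp k (fun s t => c *: F s t + F' s t) (fun s t => c *: g s t + g' s t).
Proof.
move=> [L E] [L' E'].
have H : mulZ k (fun s t => c *: F s t + F' s t) =
    (fun s t => c *: mulZ k F s t + mulZ k F' s t).
  by apply/funext => s; apply/funext => t; exact: mul_binom_comb.
split; first by rewrite H; exact: laurent2_comb.
by move=> a b; rewrite H subst_comb // E E'.
Qed.

Lemma qexp0 V : qexp 0 (fun _ _ => 0 : V) (fun _ _ => 0).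
Proof.
split; first by exists 0.
by move=> a b; rewrite substE tsum_eq0 // => s; rewrite scaler0.
Qed.

Lemma qexp_uniq V k l (F g h : int -> int -> V) :
  qexp k F g -> qexp l F h -> forall a b, g a b = h a b.
Proof.
move=> /(qexp_le (leq_maxl k l))[_ Eg] /(qexp_le (leq_maxr k l))[_ Eh] a b.
by rewrite -(addrK (maxn k l)%:Z a) Eg Eh.
Qed.

Lemma qexp_trunc V k (F g : int -> int -> V) a b : qexp k F g -> a < - k%:Z -> g a b = 0.
Proof. by move=> [_ E] ak; rewrite -(addrK k%:Z a) E subst_neg //; lia. Qed.

Lemma eq_qexp V k (F g F' g' : int -> int -> V) :
  (forall s t, F s t = F' s t) -> (forall s t, g s t = g' s t) ->
  qexp k F g -> qexp k F' g'.
Proof.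
move=> EF Eg; have -> : F' = F by apply/funext => s; apply/funext => t.
by have -> : g' = g by apply/funext => s; apply/funext => t.
Qed.

End TwoVariables.

(** * Series in three variables *)

Section ThreeVariables.
Variables (K : numFieldType) (N : nat).
Implicit Types (V W : lmodType K).

Local Notation mulZ := (mul_binom N (-1)).
Local Notation subst := (subst_x2Dx0 N).

Lemma mul_binom_shift V (e : K) M k (F : int -> int -> V) c d s t :
  mul_binom M e k (fun s t => F (s + c) (t + d)) s t = mul_binom M e k F (s + c) (t + d).
Proof.
elim: k s t => [//|k IH] s t; rewrite !mul_binomS !IH.
by rewrite (addrAC s) (addrAC t).
Qed.

Lemma mul_binom_shiftl V (e : K) M k (F : int -> int -> V) c s t :
  mul_binom M e k (fun s t => F (s + c) t) s t = mul_binom M e k F (s + c) t.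
Proof.
have := mul_binom_shift e M k F c 0 s t; rewrite addr0 => <-.
by congr mul_binom; apply/funext => s'; apply/funext => t'; rewrite addr0.
Qed.

Lemma mul_binom_shiftr V (e : K) M k (F : int -> int -> V) d s t :
  mul_binom M e k (fun s t => F s (t + d)) s t = mul_binom M e k F s (t + d).
Proof.
have := mul_binom_shift e M k F 0 d s t; rewrite addr0 => <-.
by congr mul_binom; apply/funext => s'; apply/funext => t'; rewrite addr0.
Qed.

Lemma mul_binomD1 V (e : K) M k (F G : int -> int -> V) s t :
  mul_binom M e k (fun s t => F s t + G s t) s t = mul_binom M e k F s t + mul_binom M e k G s t.
Proof.
rewrite -[X in X + _]scale1r -mul_binom_comb.
by congr mul_binom; apply/funext => s'; apply/funext => t'; rewrite scale1r.
Qed.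

Lemma mul_binomZ1 V (e : K) M k c (F : int -> int -> V) s t :
  mul_binom M e k (fun s t => c *: F s t) s t = c *: mul_binom M e k F s t.
Proof.
elim: k s t => [//|k IH] s t; rewrite !mul_binomS !IH scalerDr !scalerA.
by rewrite [c * e]mulrC.
Qed.

Lemma mul_binom0 V (e : K) M k s t : mul_binom M e k (fun _ _ => 0 : V) s t = 0.
Proof. by elim: k s t => [//|k IH] s t; rewrite mul_binomS !IH scaler0 addr0. Qed.

Lemma laurent2D V (F G : int -> int -> V) : laurent2 F -> laurent2 G ->
  laurent2 (fun s t => F s t + G s t).
Proof.
move=> LF LG; have := laurent2_comb 1 LF LG; congr laurent2.
by apply/funext => s'; apply/funext => t'; rewrite scale1r.
Qed.

Lemma laurent2Z V c (F : int -> int -> V) : laurent2 F -> laurent2 (fun s t => c *: F s t).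
Proof. by case=> s0 F0; exists s0 => s t st; rewrite F0 ?scaler0. Qed.

Lemma laurent2_shiftl V (F : int -> int -> V) c : laurent2 F ->
  laurent2 (fun s t => F (s + c) t).
Proof. by case=> s0 F0; exists (s0 - `|c|) => s t st; apply: F0; lia. Qed.

Lemma laurent2_shiftr V (F : int -> int -> V) c : laurent2 F ->
  laurent2 (fun s t => F s (t + c)).
Proof. by case=> s0 F0; exists (s0 - `|c|) => s t st; apply: F0; lia. Qed.

(* Multiplication by (x_i - x_j)^k of series in x_1, x_2, x_3. *)
Definition mul12 V k (F : int -> int -> int -> V) s1 s2 s3 :=
  mulZ k (fun s1 s2 => F s1 s2 s3) s1 s2.
Definition mul13 V k (F : int -> int -> int -> V) s1 s2 s3 :=
  mulZ k (fun s1 s3 => F s1 s2 s3) s1 s3.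
Definition mul23 V k (F : int -> int -> int -> V) s1 s2 s3 := mulZ k (F s1) s2 s3.

Lemma mul12_13 V j k (F : int -> int -> int -> V) :
  mul12 j (mul13 k F) = mul13 k (mul12 j F).
Proof.
apply/funext=> s1; apply/funext=> s2; apply/funext=> s3.
elim: k s1 s2 s3 => [//|k IH] s1 s2 s3; rewrite [RHS]/mul13 mul_binomS -/(mul13 k _ _ _ _).
rewrite -/(mul13 k (mul12 j F) s1 s2 _) -!IH /mul12 -mul_binomZ1.
by rewrite -mul_binom_shiftl -mul_binomD1.
Qed.

Lemma mul12_23 V j k (F : int -> int -> int -> V) :
  mul12 j (mul23 k F) = mul23 k (mul12 j F).
Proof.
apply/funext=> s1; apply/funext=> s2; apply/funext=> s3.
elim: k s1 s2 s3 => [//|k IH] s1 s2 s3; rewrite [RHS]/mul23 mul_binomS.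
rewrite -!/(mul23 k (mul12 j F) s1 _ _) -!IH /mul12 -mul_binomZ1.
by rewrite -mul_binom_shiftr -mul_binomD1.
Qed.

Lemma mul13_23 V j k (F : int -> int -> int -> V) :
  mul13 j (mul23 k F) = mul23 k (mul13 j F).
Proof.
apply/funext=> s1; apply/funext=> s2; apply/funext=> s3.
elim: k s1 s2 s3 => [//|k IH] s1 s2 s3; rewrite [RHS]/mul23 mul_binomS.
rewrite -!/(mul23 k (mul13 j F) s1 _ _) -!IH /mul13 -mul_binomZ1.
by rewrite -mul_binom_shiftr -mul_binomD1.
Qed.

Definition laurent3 V (F : int -> int -> int -> V) :=
  exists s0 : int, forall s1 s2 s3, [|| s1 < s0, s2 < s0 | s3 < s0] -> F s1 s2 s3 = 0.

(* Sequences of two-variable series: multiplication by (x_1 - x_2) + e y, y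
   being the variable attached to the sequence index, and the corresponding
   multiplication on expansions in x_0. *)
Definition zy V (e : K) (D : int -> int -> int -> V) : int -> int -> int -> V :=
  fun n s t => mulZ 1 (D n) s t + e *: D (n - 1) s t.

Definition ty V (e : K) (g : int -> int -> int -> V) : int -> int -> int -> V :=
  fun n a b => g n (a - 1) b + e *: g (n - 1) a b.

Lemma iter_ty V e k (g : int -> int -> int -> V) n a b :
  iter k (ty e) g n a b = mul_binom 1 e k (fun a n => g n a b) a n.
Proof. by elim: k n a b => [//|k IH] n a b; rewrite mul_binomS -!IH. Qed.

Section Slices0.
Variables (V : lmodType K).
Implicit Types F : int -> int -> int -> V.

Definition slice1 F := forall s1, laurent2 (F s1).
Definition slice3 F := forall s3, laurent2 (fun s1 s2 => F s1 s2 s3).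
(** The substitution x_2 = x_3 + y followed by x_1 = x_3 + t; [i], [j] are the exponents of t, y,
    and [b] / N is that of x_3. *)
Definition subst2 F i j b := subst (fun s1 s3 => subst (F s1) j s3) i b.

Lemma slice1_mul12 k F : slice1 F -> slice1 (mul12 k F).
Proof.
move=> H; elim: k => [//|k IH] s1; rewrite /mul12.
exact: (laurent2D (IH (s1 - N%:Z)) (laurent2Z (-1) (laurent2_shiftl (- N%:Z) (IH s1)))).
Qed.

Lemma slice1_mul13 k F : slice1 F -> slice1 (mul13 k F).
Proof.
move=> H; elim: k => [//|k IH] s1; rewrite /mul13.
exact: (laurent2D (IH (s1 - N%:Z)) (laurent2Z (-1) (laurent2_shiftr (- N%:Z) (IH s1)))).
Qed.

Lemma slice3_mul13 k F : slice3 F -> slice3 (mul13 k F).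
Proof.
move=> H; elim: k => [//|k IH] s3; rewrite /mul13.
exact: (laurent2D (laurent2_shiftl (- N%:Z) (IH s3)) (laurent2Z (-1) (IH (s3 - N%:Z)))).
Qed.

Lemma slice3_mul23 k F : slice3 F -> slice3 (mul23 k F).
Proof.
move=> H; elim: k => [//|k IH] s3; rewrite /mul23.
exact: (laurent2D (laurent2_shiftr (- N%:Z) (IH s3)) (laurent2Z (-1) (IH (s3 - N%:Z)))).
Qed.

Lemma substD (F G : int -> int -> V) a b : laurent2 F -> laurent2 G ->
  subst (fun s t => F s t + G s t) a b = subst F a b + subst G a b.
Proof.
move=> LF LG; rewrite -[X in X + _]scale1r -subst_comb //.
by congr subst; apply/funext => s'; apply/funext => t'; rewrite scale1r.
Qed.

Lemma substZ c (F : int -> int -> V) a b : laurent2 F ->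
  subst (fun s t => c *: F s t) a b = c *: subst F a b.
Proof.
move=> LF; rewrite !substE -tsumZ; last exact: finsup_diag.
by apply: eq_tsum => s; rewrite !scalerA mulrC.
Qed.

Lemma laurent3_slice1 F : laurent3 F -> slice1 F.
Proof. by case=> s0 F0 s1; exists s0 => s t st; apply: F0; lia. Qed.

Lemma laurent3_slice3 F : laurent3 F -> slice3 F.
Proof. by case=> s0 F0 s1; exists s0 => s t st; apply: F0; lia. Qed.

Lemma subst2E F i j b : laurent3 F -> subst2 F i j b =
  tsum (fun s1 => tsum (fun s2 => (gb K N s1 i * gb K N s2 j) *:
    F s1 s2 (b + N%:Z * i + N%:Z * j - s1 - s2))).
Proof.
move=> LF; rewrite /subst2 substE; apply: eq_tsum => s1.
rewrite substE -tsumZ; last exact/finsup_diag/laurent3_slice1.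
by apply: eq_tsum => s2; rewrite scalerA; congr (_ *: F _ _ _); lia.
Qed.

Lemma exchange_laurent3 F (c : int -> int -> K) n : laurent3 F ->
  tsum (fun s1 => tsum (fun s2 => c s1 s2 *: F s1 s2 (n - s1 - s2))) =
  tsum (fun s2 => tsum (fun s1 => c s1 s2 *: F s1 s2 (n - s1 - s2))).
Proof.
case=> s0 F0; pose r := zrange s0 (n - s0 - s0).
apply: (@exchange_tsum _ _ _ _ _ r r) => s t /orP[]/notin_zrange st.
  have [h|h] := ltP t s0; first by rewrite F0 ?scaler0 // h orbT.
  by rewrite F0 ?scaler0 //; lia.
have [h|h] := ltP s s0; first by rewrite F0 ?scaler0 // h.
by rewrite F0 ?scaler0 //; lia.
Qed.

Lemma finsup_laurent3 F (c : int -> int -> K) n : laurent3 F ->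
  finsup (fun s1 => tsum (fun s2 => c s1 s2 *: F s1 s2 (n - s1 - s2))).
Proof.
case=> s0 F0; apply: (@finsup_zrange _ _ _ s0 (n - s0 - s0)) => s st.
apply: tsum_eq0 => t; have [h|h] := ltP t s0; first by rewrite F0 ?scaler0 // h orbT.
by rewrite F0 ?scaler0 //; lia.
Qed.

Lemma finsup_laurent3r F (c : int -> K) s1 n : laurent3 F ->
  finsup (fun s2 => c s2 *: F s1 s2 (n - s1 - s2)).
Proof. by move=> /laurent3_slice1 L; exact: finsup_diag. Qed.

(** Both sides are one finite sum over a plane s_1 + s_2 + s_3 = const, written as iterated sums in
    the two orders. *)
Lemma subst2_swap F i j b : laurent3 F ->
  subst2 (fun s2 s1 s3 => F s1 s2 s3) j i b = subst2 F i j b.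
Proof.
move=> LF; rewrite !subst2E //; last first.
  by case: LF => s0 F0; exists s0 => s1 s2 s3 H; apply: F0; lia.
rewrite [RHS]exchange_laurent3 //; apply: eq_tsum => s2; apply: eq_tsum => s1.
by rewrite mulrC; congr (_ *: F _ _ _); lia.
Qed.

Lemma subst23_mul13 k F n s1 s3 : slice1 F ->
  subst (mul13 k F s1) n s3 = mulZ k (fun s1 s3 => subst (F s1) n s3) s1 s3.
Proof.
move=> H; elim: k s1 s3 => [//|k IH] s1 s3.
rewrite mul_binomS -!IH; have L := slice1_mul13 k H.
transitivity (subst (fun s2 s3 => mul13 k F (s1 - N%:Z) s2 s3 +
   (-1) *: mul13 k F s1 s2 (s3 - N%:Z)) n s3); first by [].
rewrite substD //; last exact: (laurent2Z (-1) (laurent2_shiftr (- N%:Z) (L s1))).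
by rewrite substZ ?subst_mulX2 //; exact: (laurent2_shiftr (- N%:Z) (L s1)).
Qed.

Lemma subst12_mul23 k F n s2 s3 : slice3 F ->
  subst (fun s1 s2 => mul23 k F s1 s2 s3) n s2 =
  mulZ k (fun s2 s3 => subst (fun s1 s2 => F s1 s2 s3) n s2) s2 s3.
Proof.
move=> H; elim: k s2 s3 => [//|k IH] s2 s3.
rewrite mul_binomS -!IH; have L := slice3_mul23 k H.
transitivity (subst (fun s1 s2 => mul23 k F s1 (s2 - N%:Z) s3 +
   (-1) *: mul23 k F s1 s2 (s3 - N%:Z)) n s2); first by [].
rewrite substD; [|exact: (laurent2_shiftr (- N%:Z) (L s3))|exact: (laurent2Z (-1) (L (s3 - N%:Z)))].
by rewrite (subst_mulX2 N (fun s1 s2 => mul23 k F s1 s2 s3)) substZ //; exact: (L (s3 - N%:Z)).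
Qed.

End Slices0.

Hypothesis N0 : (0 < N)%N.

Lemma qexp_zy V e (D g : int -> int -> int -> V) :
  (forall n, exists k, qexp N k (D n) (g n)) ->
  forall n, exists k, qexp N k (zy e D n) (ty e g n).
Proof.
move=> H n; have [k Hk] := H n; have [l Hl] := H (n - 1).
exists (maxn l k); rewrite /zy /ty.
apply: (eq_qexp _ _ (qexp_comb e (qexp_le N0 (leq_maxl l k) Hl)
  (qexp_mulZ N0 (qexp_le N0 (leq_maxr l k) Hk)))) => s t; by rewrite addrC.
Qed.

Lemma qexp_iter_zy V e m (D g : int -> int -> int -> V) :
  (forall n, exists k, qexp N k (D n) (g n)) ->
  forall n, exists k, qexp N k (iter m (zy e) D n) (iter m (ty e) g n).
Proof. by move=> H; elim: m => [//|m IH]; apply: qexp_zy. Qed.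

Lemma qexp_mulZk V k m (F g : int -> int -> V) :
  qexp N k F g -> qexp N k (mulZ m F) (fun a b => g (a - m%:Z) b).
Proof.
elim: m => [|m IH] H; first by apply: (eq_qexp _ _ H) => // s t; rewrite subr0.
apply: (eq_qexp _ _ (qexp_mulZ N0 (IH H))) => // s t.
by congr g; lia.
Qed.

Section Slices.
Variables (V : lmodType K).
Implicit Types F : int -> int -> int -> V.

(** At x_2 = x_3 + y the factor x_1 - x_2 is (x_1 - x_3) - y, hence [zy (-1)]. *)
Lemma subst23_mul12 k F n s1 s3 : slice1 F ->
  subst (mul12 k F s1) n s3 =
  iter k (zy (-1)) (fun n s1 s3 => subst (F s1) n s3) n s1 s3.
Proof.
move=> H; elim: k n s1 s3 => [//|k IH] n s1 s3.
rewrite iterS {1}/zy mul_binomS /= -!IH.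
have L := slice1_mul12 k H; rewrite -/(mul12 k).
transitivity (subst (fun s2 s3 => mul12 k F (s1 - N%:Z) s2 s3 +
   (-1) *: mul12 k F s1 (s2 - N%:Z) s3) n s3); first by [].
rewrite substD //; last exact: (laurent2Z (-1) (laurent2_shiftl (- N%:Z) (L s1))).
rewrite substZ ?subst_mulX1 //; last exact: (laurent2_shiftl (- N%:Z) (L s1)).
by rewrite scalerDr addrA.
Qed.

(** At x_1 = x_2 + z the factor x_1 - x_3 is (x_2 - x_3) + z, hence [zy 1]. *)
Lemma subst12_mul13 k F n s2 s3 : slice3 F ->
  subst (fun s1 s2 => mul13 k F s1 s2 s3) n s2 =
  iter k (zy 1) (fun n s2 s3 => subst (fun s1 s2 => F s1 s2 s3) n s2) n s2 s3.
Proof.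
move=> H; elim: k n s2 s3 => [//|k IH] n s2 s3.
rewrite iterS {1}/zy mul_binomS /= -!IH.
have L := slice3_mul13 k H.
transitivity (subst (fun s1 s2 => mul13 k F (s1 - N%:Z) s2 s3 +
   (-1) *: mul13 k F s1 s2 (s3 - N%:Z)) n s2); first by [].
rewrite substD; [|exact: (laurent2_shiftl (- N%:Z) (L s3))|exact: (laurent2Z (-1) (L (s3 - N%:Z)))].
rewrite (subst_mulX1 N0 _ _ (L s3)) substZ; last exact: (L (s3 - N%:Z)).
by rewrite scale1r addrAC.
Qed.

Lemma laurent3_subst23 F j : laurent3 F -> laurent2 (fun s1 s3 => subst (F s1) j s3).
Proof.
case=> s0 F0; exists (s0 - `|s0| - N%:Z * `|j|) => s t st; rewrite substE tsum_eq0 // => s2.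
have Nj : N%:Z * j <= N%:Z * `|j| by rewrite ler_wpM2l // ler_norm.
have Nj0 : 0 <= N%:Z * `|j| by rewrite mulr_ge0.
have [h|h] := ltP s2 s0; first by rewrite F0 ?scaler0 // h orbT.
rewrite F0 ?scaler0 //; lia.
Qed.

Lemma laurent3_subst12 F i : laurent3 F ->
  laurent2 (fun s2 s3 => subst (fun s1 s2 => F s1 s2 s3) i s2).
Proof.
case=> s0 F0; exists (s0 - `|s0| - N%:Z * `|i|) => s t st; rewrite substE tsum_eq0 // => s2.
have Nj : N%:Z * i <= N%:Z * `|i| by rewrite ler_wpM2l // ler_norm.
have Nj0 : 0 <= N%:Z * `|i| by rewrite mulr_ge0.
have [h|h] := ltP s2 s0; first by rewrite F0 ?scaler0 // h.
rewrite F0 ?scaler0 //; lia.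
Qed.

End Slices.
End ThreeVariables.

(** * Composition of substitutions *)

Section Expansions.
Variables (K : numFieldType).

Section SubstX0.
Variables (V : lmodType K).
Implicit Types G : int -> int -> V.

Lemma subst_x0Dx2E G j0 (n : nat) i j : (forall i j, j < j0 -> G i j = 0) -> j - j0 < n%:Z ->
  subst_x0Dx2 G i j = \sum_(p < n) gbinom (i + p%:Z)%:~R p *: G (i + p%:Z) (j - p%:Z).
Proof.
move=> G0 nj; rewrite -(big_mkord xpredT (fun p : nat => gbinom (i + p%:Z)%:~R p *: G (i + p%:Z) (j - p%:Z))).
apply: tsumE (iota_uniq _ _) _ => p; rewrite mem_iota subn0 add0n /= => pn.
by rewrite G0 ?scaler0 //; lia.
Qed.

Lemma subst_x0Dx2_mulX0 G j0 i j : (forall i j, j < j0 -> G i j = 0) ->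
  subst_x0Dx2 (fun i j => G (i - 1) j) i j = subst_x0Dx2 G (i - 1) j + subst_x0Dx2 G i (j - 1).
Proof.
move=> G0; pose n := (absz (j - j0)).+1.
rewrite (@subst_x0Dx2E _ j0 n.+1) //; [|by move=> ? ?; exact: G0|by rewrite /n; lia].
rewrite (@subst_x0Dx2E G j0 n.+1 (i - 1)) //; last by rewrite /n; lia.
rewrite (@subst_x0Dx2E G j0 n i) //; last by rewrite /n; lia.
rewrite big_ord_recl [X in _ = X + _]big_ord_recl /= !gbinom0 !addr0 -addrA -big_split.
congr (_ + _); apply: eq_bigr => p _; rewrite /bump /= add1n.
have -> : i + p.+1%:Z = i + p%:Z + 1 by lia.
rewrite rmorphD /= gbinom_pascal scalerDl.
by congr (gbinom _%:~R _ *: G _ _ + gbinom _%:~R _ *: G _ _); lia.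
Qed.

Lemma subst_x0Dx2_mulX2 G i j c :
  subst_x0Dx2 (fun i j => G i (j - c)) i j = subst_x0Dx2 G i (j - c).
Proof. by apply: eq_tsum => p; congr (_ *: G _ _); lia. Qed.

Lemma subst_x0Dx2_comb G G' c j0 i j : (forall i j, j < j0 -> G i j = 0) ->
    (forall i j, j < j0 -> G' i j = 0) ->
  subst_x0Dx2 (fun i j => c *: G i j + G' i j) i j = c *: subst_x0Dx2 G i j + subst_x0Dx2 G' i j.
Proof.
move=> G0 G0'; pose n := (absz (j - j0)).+1.
rewrite !(@subst_x0Dx2E _ j0 n) //; try by rewrite /n; lia.
  rewrite scaler_sumr -big_split; apply: eq_bigr => p _ /=.
  by rewrite scalerDr !scalerA mulrC.
by move=> ? ? h; rewrite G0 // G0' // scaler0 addr0.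
Qed.

Lemma mul_binom_trunc2 (e : K) k G j0 : (forall i j, j < j0 -> G i j = 0) ->
  forall i j, j < j0 -> mul_binom 1 e k G i j = 0.
Proof.
by move=> G0; elim: k => [//|k IH] i j jj; rewrite mul_binomS !IH ?scaler0 ?addr0 //; lia.
Qed.

(** At x_1 = x_0 + x_2 the factor x_1 - x_2 becomes x_0, and in [subst_x0Dx2_mulD] the factor x_1
    becomes x_0 + x_2. The bound on the exponents of x_2 keeps all expansions finite. *)
Lemma subst_x0Dx2_mulB k G j0 i j : (forall i j, j < j0 -> G i j = 0) ->
  subst_x0Dx2 (mul_binom 1 (-1) k G) i j = subst_x0Dx2 G (i - k%:Z) j.
Proof.
move=> G0; elim: k i => [|k IH] i; first by rewrite subr0.
have Gk := mul_binom_trunc2 (-1) k G0.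
have -> : mul_binom 1 (-1) k.+1 G = (fun i j => (-1) *: mul_binom 1 (-1) k G i (j - 1)
    + mul_binom 1 (-1) k G (i - 1) j).
  by apply/funext => s; apply/funext => t; rewrite mul_binomS addrC.
rewrite (@subst_x0Dx2_comb _ _ _ j0); [|by move=> ? ? ?; apply: Gk; lia|by move=> ? ? ?; apply: Gk].
rewrite (subst_x0Dx2_mulX0 _ _ Gk) (subst_x0Dx2_mulX2 _ _ _ 1) scaleN1r addrC addrK IH.
by congr subst_x0Dx2; lia.
Qed.

Lemma subst_x0Dx2_mulD k G j0 i j : (forall i j, j < j0 -> G i j = 0) ->
  subst_x0Dx2 (fun i j => G (i - k%:Z) j) i j = mul_binom 1 1 k (subst_x0Dx2 G) i j.
Proof.
move=> G0; elim: k i j => [|k IH] i j.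
  by congr subst_x0Dx2; apply/funext => s; apply/funext => t; rewrite subr0.
rewrite mul_binomS scale1r -!IH -(@subst_x0Dx2_mulX0 _ j0).
  by congr subst_x0Dx2; apply/funext => s; apply/funext => t; congr G; lia.
by move=> ? ?; exact: G0.
Qed.

Lemma mul_binom_sym k G i j :
  mul_binom 1 1 k (fun j i => G i j) j i = mul_binom 1 (1 : K) k G i j.
Proof. by elim: k i j => [//|k IH] i j; rewrite !mul_binomS !IH !scale1r addrC. Qed.

End SubstX0.

Lemma subst_x0Dx2_lin (V W : lmodType K) (h : V -> W) (hl : linear h) G j0 i j :
  (forall i j, j < j0 -> G i j = 0) ->
  h (subst_x0Dx2 G i j) = subst_x0Dx2 (fun i j => h (G i j)) i j.
Proof.
move=> G0; pose n := (absz (j - j0)).+1.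
rewrite !(@subst_x0Dx2E _ _ j0 n) //; try by rewrite /n; lia.
  by rewrite (raddf_lin_sum hl); apply: eq_bigr => p _; rewrite (linfZ hl).
by move=> ? ? ?; rewrite G0 // (linf0 hl).
Qed.

Section Subst.
Variables (N : nat).
Hypothesis N0 : (0 < N)%N.
Implicit Types (V W : lmodType K).

Local Notation mulZ := (mul_binom N (-1)).
Local Notation subst := (subst_x2Dx0 N).

Lemma gb_vandermonde s1 s2 (i j : nat) :
  gb K N s1 i * gb K N (s1 + s2 - N%:Z * i%:Z) j =
  \sum_(l < j.+1) 'C(i + l, l)%:R * (gb K N s1 (i + l)%N * gb K N s2 (j - l)%N).
Proof.
have NK : (N%:R : K) != 0 by rewrite pnatr_eq0 -lt0n.
rewrite /gb (_ : (s1 + s2 - N%:Z * i%:Z)%:~R / N%:R =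
  (s1%:~R / N%:R - i%:R) + s2%:~R / N%:R); last first.
  by rewrite !rmorphB !rmorphD !rmorphM /=; field.
rewrite gbinom_vandermonde mulr_sumr; apply: eq_bigr => l _.
by rewrite /= [LHS]mulrA gbinom_mul -mulrA.
Qed.

(** Substituting x_1 = x_2 + z, then x_2 = x_3 + y, amounts to [subst2] at t = z + y. On
    coefficients this is [gb_vandermonde]: Vandermonde's identity for the exponent (s_1/N - i) +
    s_2/N, combined with [gbinom_mul]. *)
Lemma subst23_subst12 V (F : int -> int -> int -> V) i j b : laurent3 F ->
  subst (fun s2 s3 => subst (fun s1 s2 => F s1 s2 s3) i s2) j b =
  subst_x0Dx2 (fun i j => subst2 N F i j b) i j.
Proof.
move=> LF.
have S0 i' j' : i' < 0 -> subst2 N F i' j' b = 0 by move=> ?; rewrite /subst2 subst_neg.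
have S0' i' j' : j' < 0 -> subst2 N F i' j' b = 0.
  move=> j0; rewrite -subst2_swap // /subst2 subst_neg //.
case: j => j; last first.
  by rewrite subst_neg // (@subst_x0Dx2E _ _ 0 0) ?big_ord0.
case: i => i; last first.
  rewrite substE tsum_eq0; last by move=> s; rewrite subst_neg ?scaler0.
  symmetry; apply: tsum_eq0 => p; have [ip|ip] := ltP (Negz i + p%:Z) 0.
    by rewrite S0 ?scaler0.
  (* A nonnegative power of z + y contains no negative power of z: the coefficient is C(p - i - 1,
     p) = 0. *)
  have -> : Negz i + p%:Z = (p - i.+1)%:Z by lia.
  by rewrite -pmulrn gbinom_nat bin_small ?scale0r //; lia.
rewrite (@subst_x0Dx2E _ _ 0 j.+1) //; last by lia.
pose n := b + N%:Z * i%:Z + N%:Z * j%:Z.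
transitivity (tsum (fun s1 => tsum (fun s2 =>
    (gb K N s1 i * gb K N (s1 + s2 - N%:Z * i%:Z) j) *: F s1 s2 (n - s1 - s2)))).
  transitivity (tsum (fun s2 => tsum (fun s1 => (gb K N s1 i * gb K N s2 j) *:
     F s1 (s2 + N%:Z * i%:Z - s1) (b + N%:Z * j%:Z - s2)))).
    rewrite substE; apply: eq_tsum => s2; rewrite substE -tsumZ.
      by apply: eq_tsum => s1; rewrite scalerA mulrC.
       exact: (finsup_diag (fun s => gb K N s i) _ (laurent3_slice3 LF (b + N%:Z * j%:Z - s2))).
  case: LF => s0 F0; pose A := n - s0 - s0 - s0 + `|s0|.
  have Ni : 0 <= N%:Z * i%:Z by lia.
  have Nj : 0 <= N%:Z * j%:Z by lia.
  rewrite (@exchange_tsum _ _ _ _ _ (zrange (s0 + s0 - N%:Z * i%:Z) (b + N%:Z * j%:Z - s0))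
    (zrange s0 (n - s0 - s0))); last first.
    move=> s2 s1 st; case: (boolP [|| s1 < s0, s2 + N%:Z * i%:Z - s1 < s0 | b + N%:Z * j%:Z - s2 < s0]).
      by move=> h; rewrite F0 ?scaler0.
    by case/orP: st => /notin_zrange; rewrite /n; lia.
  apply: eq_tsum => s1; rewrite -(tsum_shift _ (s1 - N%:Z * i%:Z)); apply: eq_tsum => s2.
  by congr ((_ * gb _ _ _ _) *: F _ _ _); rewrite /n; lia.
transitivity (tsum (fun s1 => \sum_(l < j.+1) tsum (fun s2 => ('C(i + l, l)%:R *
    (gb K N s1 (i + l)%N * gb K N s2 (j - l)%N)) *: F s1 s2 (n - s1 - s2)))).
  apply: eq_tsum => s1; rewrite -tsum_sum => [|l]; last exact: finsup_laurent3r.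
  by apply: eq_tsum => s2; rewrite gb_vandermonde scaler_suml.
rewrite tsum_sum => [|l]; last exact: finsup_laurent3.
apply: eq_bigr => l _; have lj : (l <= j)%N by rewrite -ltnS.
rewrite (_ : i%:Z + l%:Z = (i + l)%N%:Z) // (_ : j%:Z - l%:Z = (j - l)%N%:Z); last by lia.
rewrite -pmulrn gbinom_nat subst2E // -tsumZ; last first.
  have := finsup_laurent3 (fun s1 s2 => gb K N s1 (i + l)%N * gb K N s2 (j - l)%N)
    (b + N%:Z * (i + l)%N%:Z + N%:Z * (j - l)%N%:Z) LF; exact.
apply: eq_tsum => s1; rewrite -tsumZ; last exact: finsup_laurent3r.
apply: eq_tsum => s2; rewrite scalerA; congr (_ *: F _ _ _).
have E : N%:Z * (i + l)%N%:Z + N%:Z * (j - l)%N%:Z = N%:Z * i%:Z + N%:Z * j%:Z.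
  by rewrite -!mulrDr -!PoszD; congr (_ * Posz _); lia.
by rewrite /n; lia.
Qed.

End Subst.
End Expansions.

(** * The commutator formula *)

Section Telescoping.
Variables (K : numFieldType) (N : nat).
Hypothesis N0 : (0 < N)%N.
Implicit Types (V W : lmodType K).

Local Notation mulZ := (mul_binom N (-1)).
Local Notation subst := (subst_x2Dx0 N).
Local Notation cls p s := (N%:Z %| s - p)%Z.

Lemma cls_shift (p s : int) : cls p (s - N%:Z) = cls p s.
Proof. by rewrite addrAC rpredBr ?dvdzz. Qed.

(* On a line s + t = n, multiplication by x_1 - x_2 is the difference operator of
   step N; P and Q have supports bounded on opposite sides of the line. *)
Lemma telescope V (P Q : int -> int -> V) (p s0 t0 : int) (C : int -> V) :
    (forall s t, t < t0 -> P s t = 0) -> (forall s t, s < s0 -> Q s t = 0) ->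
    (forall s t, P s t = Q s t + (if cls p s then C (s + t + N%:Z) else 0)) ->
  (forall s t, mulZ 1 P s t = mulZ 1 Q s t) /\ forall b, subst (mulZ 1 P) 0 b = C b.
Proof.
move=> P0 Q0 PQ; split=> [s t|b].
  rewrite !mul_binomS /= !PQ cls_shift scalerDr addrACA -[RHS]addr0; congr (_ + _).
  case: ifP => _; last by rewrite scaler0 addr0.
  by rewrite scaleN1r (_ : s - N%:Z + t = s + (t - N%:Z)) ?subrr //; lia.
(* [A] is a point of the class of p, at or below s0: to its left P equals the constant C b on that
   class and 0 off it. *)
pose A := p - N%:Z * (`|p| + `|s0|).
have As0 : A <= s0.
  have : `|p| + `|s0| <= N%:Z * (`|p| + `|s0|) by rewrite ler_peMl ?addr_ge0 //; lia.
  by rewrite /A; lia.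
pose u s := P s (b - N%:Z - s).
(* Removing the constant tail leaves the finitely supported [v], whose differences sum to 0. The
   difference of the tails, [W] below, lives at the single point [A] and contributes C b. *)
pose v s := u s - (if cls p s && (s < A) then C b else 0).
have uE s : s < s0 -> u s = if cls p s then C b else 0.
  by move=> ss; rewrite /u PQ Q0 // add0r; congr (if _ then C _ else _); lia.
have v0 s : (s < A) || (b - N%:Z - t0 < s) -> v s = 0.
  rewrite /v; have [sA _|sA /= st] := ltP s A.
    by rewrite andbT uE ?subrr //; lia.
  by rewrite andbF subr0 /u P0 //; lia.
have fv : finsup v by exact: finsup_zrange v0.
have fv' : finsup (fun s => v (s - N%:Z)).
  apply: (@finsup_zrange _ _ _ (A + N%:Z) (b - t0)) => s st; apply: v0; lia.
pose W s := if cls p s && ((s - N%:Z < A) (+) (s < A)) then C b else 0.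
have W0 s : s != A -> W s = 0.
  rewrite /W => sA; case: ifP => // /andP[ps].
  have [sA2|sA2|] := ltgtP s A; last by move=> E; rewrite E eqxx in sA.
    by rewrite (_ : s - N%:Z < A) //; lia.
  rewrite addbF => sN; have : cls A s.
    have -> : s - A = (s - p) + N%:Z * (`|p| + `|s0|) by rewrite /A; lia.
    by rewrite rpredD // dvdz_mulr.
  rewrite (_ : s - A = Posz (absz (s - A))); last by lia.
  by rewrite dvdzE /= gtnNdvd //; lia.
transitivity (tsum (fun s => (v (s - N%:Z) + - v s) + W s)).
  rewrite substE; apply: eq_tsum => s; rewrite [gb _ _ _ _]gbinom0 scale1r mul_binomS /= mulr0 addr0.
  rewrite scaleN1r /v /W cls_shift.
  have -> : P (s - N%:Z) (b - s) = u (s - N%:Z) by rewrite /u; congr P; lia.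
  have -> : P s (b - s - N%:Z) = u s by rewrite /u; congr P; lia.
  have aux (x y c d : V) : x - y = x - c - (y - d) + (c - d).
    rewrite -[LHS](subrK (c - d)); congr (_ + _).
    by rewrite !opprB addrACA [RHS]addrACA [- y - c]addrC.
  rewrite [LHS](aux _ _ (if cls p s && (s - N%:Z < A) then C b else 0)
    (if cls p s && (s < A) then C b else 0)); congr (_ + _).
  case: (cls p s) => /=; last by rewrite subrr.
  have [h|h] := ltP s A; first by rewrite (_ : s - N%:Z < A) ?subrr //; lia.
  by rewrite addbF subr0.
have fW : finsup W by exists [:: A] => s; rewrite inE => /W0.
rewrite tsumD //; last by apply: finsupD => //; case: fv => r rv; exists r => s /rv ->; rewrite oppr0.
rewrite tsumD //; last by case: fv => r rv; exists r => s /rv ->; rewrite oppr0.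
rewrite tsumN // (tsum_shift v) subrr add0r (tsum1 W0) /W ltxx addbF.
rewrite (_ : A - N%:Z < A) ?andbT; last by lia.
have -> // : cls p A.
by rewrite (_ : A - p = N%:Z * - (`|p| + `|s0|)) ?dvdz_mulr // /A; lia.
Qed.

Lemma laurent2_eq V (F G : int -> int -> V) s0 t0 :
    (forall s t, t < t0 -> F s t = 0) -> (forall s t, s < s0 -> G s t = 0) ->
  (forall s t, F s t = G s t) -> laurent2 F.
Proof.
move=> F0 G0 FG; exists (Num.min s0 t0) => s t; rewrite !lt_min.
by case/orP=> /andP[h1 h2]; [rewrite FG G0|rewrite F0].
Qed.

Lemma mul_binom_truncs V (e : K) k (G : int -> int -> V) s0 :
  (forall s t, s < s0 -> G s t = 0) ->
  forall s t, s < s0 -> mul_binom N e k G s t = 0.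
Proof.
by move=> G0; elim: k => [//|k IH] i j jj; rewrite mul_binomS !IH ?scaler0 ?addr0 //; lia.
Qed.

Lemma mul_binom_trunct V (e : K) k (G : int -> int -> V) t0 :
  (forall s t, t < t0 -> G s t = 0) ->
  forall s t, t < t0 -> mul_binom N e k G s t = 0.
Proof.
by move=> G0; elim: k => [//|k IH] i j jj; rewrite mul_binomS !IH ?scaler0 ?addr0 //; lia.
Qed.

Lemma mul_binom_cls V (e : K) k (G : int -> int -> V) p :
  (forall s t, ~~ cls p s -> G s t = 0) ->
  forall s t, ~~ cls p s -> mul_binom N e k G s t = 0.
Proof.
by move=> G0; elim: k => [//|k IH] i j jj; rewrite mul_binomS !IH ?cls_shift // scaler0 addr0.
Qed.

(** The hypothesis makes P - Q invariant under (s, t) -> (s - N, t + N). Being supported on the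
    class of p, it takes a single value there on each line of fixed degree, and [telescope]
    identifies this value. *)
Lemma commutator1 V (P Q : int -> int -> V) (p s0 t0 : int) :
    (forall s t, t < t0 -> P s t = 0) -> (forall s t, s < s0 -> Q s t = 0) ->
    (forall s t, ~~ cls p s -> P s t = 0) -> (forall s t, ~~ cls p s -> Q s t = 0) ->
    (forall s t, mulZ 1 P s t = mulZ 1 Q s t) ->
  forall s t, P s t = Q s t + (if cls p s then subst (mulZ 1 P) 0 (s + t + N%:Z) else 0).
Proof.
move=> P0 Q0 Pp Qp PQ.
pose d s t := P s t - Q s t.
have dS s t : d (s - N%:Z) (t + N%:Z) = d s t.
  have := PQ s (t + N%:Z); rewrite !mul_binomS /= !addrK !scaleN1r /d => /eqP.
  by rewrite subr_eq => /eqP ->; rewrite addrAC [_ - _ - _]addrAC subrr add0r addrC.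
have dM (m : nat) s t : d (s - N%:Z * m%:Z) (t + N%:Z * m%:Z) = d s t.
  elim: m s t => [|m IH] s t; first by rewrite mulr0 subr0 addr0.
  rewrite -[RHS]IH -[RHS]dS; congr d; lia.
pose C b := d p (b - N%:Z - p).
have PQC s t : P s t = Q s t + (if cls p s then C (s + t + N%:Z) else 0).
  case: ifPn => [|h]; last by rewrite Pp // Qp // addr0.
  case/dvdzP => q sq; rewrite /C.
  suff -> : d p (s + t + N%:Z - N%:Z - p) = d s t by rewrite /d addrC subrK.
  case: (intP q) sq => [|m|m] sq.
  - by congr d; lia.
  - by rewrite -(dM m.+1 s t); congr d; lia.
  - by rewrite -(dM m.+1 p); congr d; lia.
have [_ HC] := telescope P0 Q0 PQC.
by move=> s t; rewrite HC.
Qed.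

(** While more than one factor x_1 - x_2 is left, the correction of [commutator1] is a coefficient
    of g of index below -1, hence 0, and a factor can be cancelled. The last factor leaves the
    coefficient g (-1) of the simple pole. *)
Lemma commutator_formula V k (P Q g : int -> int -> V) (p s0 t0 : int) :
    (forall s t, t < t0 -> P s t = 0) -> (forall s t, s < s0 -> Q s t = 0) ->
    (forall s t, ~~ cls p s -> P s t = 0) -> (forall s t, ~~ cls p s -> Q s t = 0) ->
    (forall s t, mulZ k P s t = mulZ k Q s t) ->
    qexp N k P g -> (forall a b, a < -1 -> g a b = 0) ->
  forall s t, P s t = Q s t + (if cls p s then g (-1) (s + t + N%:Z) else 0).
Proof.
move=> P0 Q0 Pp Qp; elim: k => [|k IH] PQ Pg g0 s t.
  have -> : g (-1) (s + t + N%:Z) = 0 by apply: (qexp_trunc N0 _ Pg).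
  by rewrite if_same addr0; exact: PQ.
have H := commutator1 (mul_binom_trunct (-1) k P0) (mul_binom_truncs (-1) k Q0)
  (mul_binom_cls (-1) k Pp) (mul_binom_cls (-1) k Qp).
have E b : subst (mulZ 1 (mulZ k P)) 0 b = g (- k%:Z - 1) b.
  rewrite -mul_binomD; case: Pg => _ <-.
  by congr g; lia.
case: k => [|k] in IH PQ Pg H E *.
  by rewrite [LHS](H PQ s t) (E (s + t + N%:Z)) oppr0 add0r.
have {}H s' t' : mulZ k.+1 P s' t' = mulZ k.+1 Q s' t'.
  have -> := H _ s' t'; first by rewrite E g0 ?if_same ?addr0 //; lia.
  by move=> s1 t1; rewrite -!mul_binomD; exact: PQ.
apply: IH => //.
have L := laurent2_eq (mul_binom_trunct (-1) k.+1 P0) (mul_binom_truncs (-1) k.+1 Q0) H.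
split=> // a b; case: Pg => _ Eg.
have := Eg (a + 1) b; rewrite -[k.+2]addn1 addnC mul_binomD subst_mulZ // addrK => <-.
by congr g; lia.
Qed.

(** On a line of fixed degree, the sums of the coefficients weighted by [gbinom (u / N) j] vanish
    for all j. By [gbinomS] this persists after multiplying the weights by factors u/N - v/N, and a
    Lagrange product of such factors isolates the coefficient at s. *)
Lemma subst_inj V (F : int -> int -> V) : laurent2 F ->
  (forall j b, subst F j b = 0) -> forall s t, F s t = 0.
Proof.
case=> s0 F0 H s t; pose n := s + t; pose r := zrange s0 (n - s0).
have fF u : u \notin r -> F u (n - u) = 0.
  by move/notin_zrange => h; apply: F0; rewrite /n in h *; lia.
pose z u : K := u%:~R / N%:R.
have zI u v : z u = z v -> u = v.
  by move/(mulIf (invr_neq0 _))/intr_inj => ->; rewrite // pnatr_eq0 -lt0n.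
have G (q : seq int) (j : nat) : tsum (fun u => (gbinom (z u) j * \prod_(v <- q) (z u - z v))
    *: F u (n - u)) = 0.
  elim: q j => [|v q IH] j.
    rewrite -[RHS](H j (n - N%:Z * j%:Z)) substE; apply: eq_tsum => u.
    by rewrite big_nil mulr1; congr (_ *: F _ _); lia.
  have fin (c : int -> K) : finsup (fun u => c u *: F u (n - u)).
    by exists r => u /fF ->; rewrite scaler0.
  transitivity (tsum (fun u => j.+1%:R *: ((gbinom (z u) j.+1 * \prod_(v <- q) (z u - z v)) *: F u (n - u))
     + (j%:R - z v) *: ((gbinom (z u) j * \prod_(v <- q) (z u - z v)) *: F u (n - u)))).
    apply: eq_tsum => u; rewrite big_cons !scalerA -scalerDl; congr (_ *: _).
    by rewrite [j.+1%:R * _]mulrA gbinomS; ring.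
  rewrite tsumD; try exact/finsupZ/fin.
  by rewrite !tsumZ ?IH ?scaler0 ?addr0.
have [sr|sr] := boolP (s \in r); last by rewrite -(fF s sr) /n; congr F; lia.
have := G (rem s (undup r)) 0%N; rewrite (tsum1 (t := s)).
  rewrite gbinom0 mul1r => /eqP; rewrite scaler_eq0 => /orP[|/eqP <-]; last first.
    by rewrite /n; congr F; lia.
  rewrite prodf_seq_eq0 => /hasP[v vr] /=; rewrite subr_eq0 => /eqP/zI E.
  by move: vr; rewrite -E mem_rem_uniqF ?undup_uniq.
move=> u us; have [ur|ur] := boolP (u \in r); last by rewrite fF ?scaler0.
have ur' : u \in rem s (undup r) by rewrite mem_rem_uniq ?undup_uniq // !inE us mem_undup.
by rewrite (big_rem _ ur') /= subrr mul0r mulr0 scale0r.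
Qed.

End Telescoping.

(** * Expansions of products of three fields *)

Section Triples.
Variables (K : numFieldType) (N : nat).
Hypothesis N0 : (0 < N)%N.
Implicit Types (V W : lmodType K).

Local Notation mulZ := (mul_binom N (-1)).
Local Notation subst := (subst_x2Dx0 N).

Lemma qexp_unmulZ V m k (F g : int -> int -> V) :
  qexp N k (mulZ m F) (fun a b => g (a - m%:Z) b) -> qexp N (m + k) F g.
Proof.
elim: m F g => [|m IH] F g H; first by apply: (eq_qexp _ _ H) => // s t; rewrite subr0.
apply/(qexpSr N0)/IH; rewrite -mul_binomSr; apply: (eq_qexp _ _ H) => // s t.
by congr g; lia.
Qed.

Lemma iter_zy_trunc V e k (D : int -> int -> int -> V) m0 :
  (forall n s t, n < m0 -> D n s t = 0) ->
  forall n s t, n < m0 -> iter k (zy N e) D n s t = 0.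
Proof.
move=> D0; elim: k => [//|k IH] n s t nm; rewrite iterS /zy mul_binomS /= !IH //; try lia.
by rewrite !scaler0 !addr0.
Qed.

(** Induction on n from the lower bound m0: (x_1 - x_2) D n is the n-th term of [zy e D] minus e D
    (n - 1), and both are expanded already. Each step costs one factor x_1 - x_2; the index set [I],
    later the vectors of W, keeps this cost uniform. *)
Lemma qexp_removal1 V (I : Type) e (D g : int -> I -> int -> int -> V) m0 :
    (forall n i s t, n < m0 -> D n i s t = 0) ->
    (forall n i s t, n < m0 -> g n i s t = 0) ->
    (forall n, exists k, forall i, qexp N k (zy N e (D ^~ i) n) (ty e (g ^~ i) n)) ->
  forall n, exists k, forall i, qexp N k (D n i) (g n i).
Proof.
move=> D0 g0 H.
have S (m : nat) n : n < m0 + m%:Z -> exists k, forall i, qexp N k (D n i) (g n i).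
  elim: m n => [|m IH] n nm.
    exists 0%N => i; apply: (eq_qexp _ _ (qexp0 N V)) => s t.
      by rewrite D0 //; lia.
    by rewrite g0 //; lia.
  have [|k Hk] := IH (n - 1); first by lia.
  have [l Hl] := H n; exists (maxn k l).+1 => i; apply/(qexpSr N0).
  apply: (eq_qexp _ _ (qexp_comb (- e) (qexp_le N0 (leq_maxl k l) (Hk i))
     (qexp_le N0 (leq_maxr k l) (Hl i)))) => s t; rewrite ?/zy ?/ty /=.
    by rewrite scaleNr addrC addrK.
  by rewrite scaleNr addrC addrK.
by move=> n; apply: (S (absz (n - m0)).+1); lia.
Qed.

Lemma qexp_removal V (I : Type) e k (D g : int -> I -> int -> int -> V) m0 :
    (forall n i s t, n < m0 -> D n i s t = 0) ->
    (forall n i s t, n < m0 -> g n i s t = 0) ->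
    (forall n, exists l, forall i,
       qexp N l (iter k (zy N e) (D ^~ i) n) (iter k (ty e) (g ^~ i) n)) ->
  forall n, exists l, forall i, qexp N l (D n i) (g n i).
Proof.
elim: k D g => [//|k IH] D g D0 g0 H.
apply: (qexp_removal1 (e := e) D0 g0).
apply: (IH (fun n i => zy N e (D ^~ i) n) (fun n i => ty e (g ^~ i) n)).
- by move=> n i s t nm; rewrite /zy mul_binomS /= !D0 ?scaler0 ?addr0 //; lia.
- by move=> n i s t nm; rewrite /ty !g0 ?scaler0 ?addr0 //; lia.
- by move=> n; have [l Hl] := H n; exists l => i; have := Hl i; rewrite !iterSr.
Qed.

(* x_2 = x_3 + y followed by x_1 = x_3 + t in
   (x_1 - x_2)^k1 (x_1 - x_3)^k2 (x_2 - x_3)^k3 P; the y-coefficients of the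
   first substitution in (x_2 - x_3)^k3 P are D, and the t-expansions of the
   latter are g. *)
Lemma subst2_triple V (P D g : int -> int -> int -> V) k1 k2 k3 i j b :
    slice1 (mul23 N k3 P) ->
    (forall s1 n s3, subst (mul23 N k3 P s1) n s3 = D (n - k3%:Z) s1 s3) ->
    (forall n, exists l, qexp N l (D n) (g n)) ->
    laurent3 (mul12 N k1 (mul13 N k2 (mul23 N k3 P))) ->
  subst2 N (mul12 N k1 (mul13 N k2 (mul23 N k3 P))) i j b =
  mul_binom 1 (-1) k1 (fun i j => g (j - k3%:Z) (i - k2%:Z) b) i j.
Proof.
move=> S1 HD Hg L3; rewrite /subst2.
set T := fun s1 s3 => _.
have TE : T = iter k1 (zy N (-1)) (fun n => mulZ k2 (D (n - k3%:Z))) j.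
  apply/funext => s1; apply/funext => s3; rewrite /T.
  rewrite subst23_mul12 //; last exact: slice1_mul13.
  congr (iter k1 _ _ _ _ _); apply/funext => n; apply/funext => t1; apply/funext => t3.
  rewrite subst23_mul13 //; congr (mul_binom _ _ _ _ _ _).
  by apply/funext => u1; apply/funext => u3; exact: HD.
have LT : laurent2 T by exact: (laurent3_subst23 N0 _ L3).
have [l Hl] : exists l, qexp N l T
    (iter k1 (ty (-1)) (fun n a b => g (n - k3%:Z) (a - k2%:Z) b) j).
  rewrite TE; apply: (qexp_iter_zy N0) => n; have [l Hl] := Hg (n - k3%:Z).
  by exists l; exact: (qexp_mulZk N0).
have [_ H] := qexp_down N0 LT Hl; have := H i b.
by rewrite subr0 iter_ty => <-.
Qed.

(* x_1 = x_2 + z in (x_1 - x_2)^k1 (x_1 - x_3)^k2 (x_2 - x_3)^k3 P, the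
   z-coefficients of the substitution in (x_1 - x_2)^k1 P being H. *)
Lemma subst12_triple V (P H : int -> int -> int -> V) k1 k2 k3 n s2 s3 :
    slice3 (mul12 N k1 P) ->
    (forall n s2 s3, subst (fun s1 s2 => mul12 N k1 P s1 s2 s3) n s2 = H (n - k1%:Z) s2 s3) ->
  subst (fun s1 s2 => mul12 N k1 (mul13 N k2 (mul23 N k3 P)) s1 s2 s3) n s2 =
  iter k2 (zy N 1) (fun n => mulZ k3 (H (n - k1%:Z))) n s2 s3.
Proof.
move=> S3 HH; rewrite mul12_13 mul12_23.
rewrite subst12_mul13 //; last exact: slice3_mul23.
congr (iter k2 _ _ _ _ _); apply/funext => m; apply/funext => t2; apply/funext => t3.
rewrite subst12_mul23 //; congr (mul_binom _ _ _ _ _ _).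
by apply/funext => u1; apply/funext => u3; exact: HH.
Qed.

Lemma mul_binomC V (e : K) j k (F : int -> int -> V) :
  mul_binom 1 e j (mul_binom 1 e k F) = mul_binom 1 e k (mul_binom 1 e j F).
Proof. by rewrite -!mul_binomD addnC. Qed.

(* Both sides compute P at x_1 = x_3 + y + z, x_2 = x_3 + y.  The factor (z + y)^l
   of the associativity hypothesis is cancelled by [mul_binom_inj], then the
   factor (x_2 - x_3 + z)^k2 coefficientwise in z by [qexp_removal]. *)
Lemma iterate_expansion V (I : Type) (P D g H eta : I -> int -> int -> int -> V)
    (k1 k2 k3 l : nat) (m0 : int) :
    (forall w, slice1 (mul23 N k3 (P w))) ->
    (forall w s1 n s3, subst (mul23 N k3 (P w) s1) n s3 = D w (n - k3%:Z) s1 s3) ->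
    (forall w n, exists l, qexp N l (D w n) (g w n)) ->
    (forall w, laurent3 (mul12 N k1 (mul13 N k2 (mul23 N k3 (P w))))) ->
    (forall w, slice3 (mul12 N k1 (P w))) ->
    (forall w n s2 s3, subst (fun s1 s2 => mul12 N k1 (P w) s1 s2 s3) n s2 = H w (n - k1%:Z) s2 s3) ->
    (forall w, exists j0, forall n a b, n < j0 -> g w n a b = 0) ->
    (forall w b i j,
       mul_binom 1 1 l (subst_x0Dx2 (fun i j => g w j i b)) i j =
       mul_binom 1 1 l (fun i j => eta w i j b) i j) ->
    (forall w m s t, m < m0 -> H w m s t = 0) ->
    (forall w m s t, m < m0 -> eta w m s t = 0) ->
  forall m, exists k, forall w, qexp N k (H w m) (eta w m).
Proof.
move=> S1 HD Hg L3 S3 HH Tg assoc H0 eta0.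
pose Hs := fun n w => mulZ k3 (H w (n - k1%:Z)).
pose es := fun n w a b => eta w (n - k1%:Z) (a - k3%:Z) b.
suff X m : exists k, forall w, qexp N k (Hs m w) (es m w).
  move=> m; have [k Hk] := X (m + k1%:Z); exists (k3 + k)%N => w.
  apply: qexp_unmulZ; apply: (eq_qexp _ _ (Hk w)) => s t; rewrite /Hs /es ?addrK //.
apply: (qexp_removal (e := 1) (k := k2) (m0 := m0 + k1%:Z)).
- by move=> n w s t nm; rewrite /Hs -[RHS](mul_binom0 V (-1) N k3 s t);
    congr mul_binom; apply/funext => s'; apply/funext => t'; rewrite H0 //; lia.
- by move=> n w s t nm; rewrite /es eta0 //; lia.
move=> n; exists 0%N => w.
pose F := mul12 N k1 (mul13 N k2 (mul23 N k3 (P w))).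
have LF : laurent3 F := L3 w.
have E : iter k2 (zy N 1) (Hs^~ w) n = fun s2 s3 => subst (fun s1 s2 => F s1 s2 s3) n s2.
  by apply/funext => s2; apply/funext => s3; rewrite (subst12_triple (H := H w)) //.
rewrite E; split; first exact: (laurent3_subst12 N0 n (L3 w)).
move=> j b; rewrite subr0 [RHS](subst23_subst12 N0) //.
have [j0 gj0] := Tg w.
pose G := fun i j => g w j i b.
(* The differences x_1 - x_2, x_1 - x_3, x_2 - x_3 are now z, z + y and y, whence the prefactor z^k1
   (z + y)^k2 y^k3 of [R], and the same one in [TE]. *)
pose R := fun i j => mul_binom 1 1 k2 (fun i j => eta w i j b) (i - k1%:Z) (j - k3%:Z).
have -> : iter k2 (ty 1) (es^~ w) n j b = R n j.
  rewrite iter_ty mul_binom_sym /R; have := mul_binom_shift 1 1 k2 (fun i j => eta w i j b)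
    (- k1%:Z) (- k3%:Z) n j; exact.
pose T := subst_x0Dx2 (fun i j => subst2 N F i j b).
have TE : T = fun i j => mul_binom 1 1 k2 (subst_x0Dx2 G) (i - k1%:Z) (j - k3%:Z).
  apply/funext => i'; apply/funext => j'; rewrite /T.
  have -> : (fun i j => subst2 N F i j b) =
      mul_binom 1 (-1) k1 (fun i j => g w (j - k3%:Z) (i - k2%:Z) b).
    by apply/funext => i1; apply/funext => j1; exact: subst2_triple.
  rewrite (@subst_x0Dx2_mulB _ _ _ _ (j0 + k3%:Z)); last first.
    by move=> i1 j1 h; rewrite gj0 //; lia.
  rewrite (@subst_x0Dx2_mulD _ _ _ (fun i j => g w (j - k3%:Z) i b) (j0 + k3%:Z)); last first.
    by move=> i1 j1 h; rewrite gj0 //; lia.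
  rewrite -mul_binom_shiftr; congr mul_binom; apply/funext => i1; apply/funext => j1.
  exact: (subst_x0Dx2_mulX2 G).
rewrite -[RHS]/(T n j).
apply/esym/eqP; rewrite -subr_eq0; apply/eqP.
(* Cancelling (z + y)^l needs a lower bound in z: [T] has no negative powers of z, and [R] none
   below m0 + k1. *)
apply: (@mul_binom_inj _ _ l (fun i j => T i j - R i j) (Num.min 0 (m0 + k1%:Z))).
  move=> i1 j1; rewrite lt_min => /andP[i10 im]; rewrite /T -(subst23_subst12 N0) //.
  rewrite substE tsum_eq0 ?sub0r; last by move=> s; rewrite subst_neg ?scaler0.
  have H1 : i1 - k1%:Z < m0 by lia.
  rewrite /R; set i2 := i1 - k1%:Z in H1 *; apply/eqP; rewrite oppr_eq0; apply/eqP.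
  apply: (@mul_binom_trunc _ _ 1 k2 (fun i j => eta w i j b) m0) => //.
  by move=> s t sm; exact: eta0.
move=> i1 j1; rewrite -mul_binom_sub; apply/eqP; rewrite subr_eq0; apply/eqP.
rewrite TE /R !mul_binom_shift.
rewrite -(mul_binomD 1 1 l k2) addnC mul_binomD.
rewrite (_ : mul_binom 1 1 l (subst_x0Dx2 G) = mul_binom 1 1 l (fun i j => eta w i j b)).
  by rewrite mul_binomC.
by apply/funext => i2; apply/funext => j2; exact: assoc.
Qed.

End Triples.

(** * Local fields and their products *)

Section Fields.
Variables (K : numFieldType) (N : nat).
Hypothesis N0 : (0 < N)%N.

Local Notation mulZ := (mul_binom N (-1)).
Local Notation subst := (subst_x2Dx0 N).

(** In the lowest power of y only the (x_1 - x_2)-part of each factor contributes. *)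
Lemma iter_zy_low (V : lmodType K) e k (D : int -> int -> int -> V) m0 :
  (forall n s t, n < m0 -> D n s t = 0) -> iter k (zy N e) D m0 = mulZ k (D m0).
Proof.
move=> D0; elim: k => [//|k IH]; apply/funext => s; apply/funext => t.
rewrite iterS {1}/zy IH mul_binomS /= (iter_zy_trunc N0 e k D0) ?scaler0 ?addr0 //.
by lia.
Qed.

Lemma subst_const (V : lmodType K) (C : int -> V) a b :
  subst (fun s t => if s == 0 then C t else 0) a b = if a == 0 then C b else 0.
Proof.
rewrite substE (tsum1 (t := 0)); last by move=> s /negPf ->; rewrite scaler0.
rewrite eqxx subr0; case: a => [[|a]|a] /=; rewrite ?scale0r //.
  by rewrite gbinom0 scale1r mulr0 addr0.
by rewrite mul0r gbinom0S scale0r.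
Qed.

Lemma laurent2_const (V : lmodType K) (C : int -> V) : laurent C ->
  laurent2 (fun s t => if s == 0 then C t else 0).
Proof.
case=> s0 C0; exists (Num.min 0 s0) => s t; rewrite !lt_min => st; case: eqP => // s1.
by rewrite C0 //; lia.
Qed.

Section Swap.
Variable V : lmodType K.
Implicit Types F : int -> int -> int -> V.

Definition swap12 F s1 s2 s3 := F s2 s1 s3.

Lemma mul_binom_antisym k (F : int -> int -> V) s t :
  mulZ k (fun s t => F t s) s t = (-1) ^+ k *: mulZ k F t s.
Proof.
elim: k s t => [|k IH] s t; first by rewrite expr0 scale1r.
rewrite !mul_binomS !IH exprS scalerDr !scalerA addrC; congr (_ + _ *: _).
by rewrite mulrN1 mulN1r opprK.
Qed.

Lemma mul12_swap k F s1 s2 s3 :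
  mul12 N k (swap12 F) s1 s2 s3 = (-1) ^+ k *: swap12 (mul12 N k F) s1 s2 s3.
Proof. exact: (mul_binom_antisym k (fun s t => F s t s3)). Qed.

Lemma mul12Z k c F s1 s2 s3 :
  mul12 N k (fun s1 s2 s3 => c *: F s1 s2 s3) s1 s2 s3 = c *: mul12 N k F s1 s2 s3.
Proof. exact: mul_binomZ1. Qed.

Lemma mul13Z k c F s1 s2 s3 :
  mul13 N k (fun s1 s2 s3 => c *: F s1 s2 s3) s1 s2 s3 = c *: mul13 N k F s1 s2 s3.
Proof. exact: mul_binomZ1. Qed.

Lemma mul23Z k c F s1 s2 s3 :
  mul23 N k (fun s1 s2 s3 => c *: F s1 s2 s3) s1 s2 s3 = c *: mul23 N k F s1 s2 s3.
Proof. exact: mul_binomZ1. Qed.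

Definition mul123 k1 k2 k3 F := mul12 N k1 (mul13 N k2 (mul23 N k3 F)).

Lemma mul123Z k1 k2 k3 c F s1 s2 s3 :
  mul123 k1 k2 k3 (fun s1 s2 s3 => c *: F s1 s2 s3) s1 s2 s3 = c *: mul123 k1 k2 k3 F s1 s2 s3.
Proof.
rewrite /mul123 -mul12Z; congr mul12; apply/funext => t1; apply/funext => t2; apply/funext => t3.
rewrite -mul13Z; congr mul13; apply/funext => u1; apply/funext => u2; apply/funext => u3.
exact: mul23Z.
Qed.

Lemma mul123B k1 k2 k3 c F G s1 s2 s3 :
  mul123 k1 k2 k3 (fun s1 s2 s3 => F s1 s2 s3 - c *: G s1 s2 s3) s1 s2 s3 =
  mul123 k1 k2 k3 F s1 s2 s3 - c *: mul123 k1 k2 k3 G s1 s2 s3.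
Proof.
have B k (f g : int -> int -> V) s t :
    mulZ k (fun s t => f s t - c *: g s t) s t = mulZ k f s t - c *: mulZ k g s t.
  rewrite -scaleNr -mul_binomZ1 -mul_binomD1.
  by congr mul_binom; apply/funext => s'; apply/funext => t'; rewrite scaleNr.
rewrite /mul123 /mul12 -B.
congr mul_binom; apply/funext => t1; apply/funext => t2; rewrite /mul13 -B.
by congr mul_binom; apply/funext => u1; apply/funext => u3; rewrite /mul23 -B.
Qed.

Lemma mul123_12 k1 k2 k3 F : mul123 k1 k2 k3 F = mul13 N k2 (mul23 N k3 (mul12 N k1 F)).
Proof. by rewrite /mul123 mul12_13 mul12_23. Qed.

Lemma mul123_13 k1 k2 k3 F : mul123 k1 k2 k3 F = mul12 N k1 (mul23 N k3 (mul13 N k2 F)).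
Proof. by rewrite /mul123 mul13_23. Qed.

Lemma mul123_swap k1 k2 F s1 s2 s3 :
  mul123 k1 k2 k2 (swap12 F) s1 s2 s3 = (-1) ^+ k1 *: swap12 (mul123 k1 k2 k2 F) s1 s2 s3.
Proof.
rewrite /mul123 -mul12_swap; congr mul12.
have -> : mul23 N k2 (swap12 F) = swap12 (mul13 N k2 F) by [].
have -> : mul13 N k2 (swap12 (mul13 N k2 F)) = swap12 (mul23 N k2 (mul13 N k2 F)) by [].
by rewrite mul13_23.
Qed.

Lemma mul123_van k1 k2 k3 F (S : int -> int -> int -> bool) :
    (forall s1 s2 s3, S s1 s2 s3 -> [&& S (s1 - N%:Z) s2 s3, S s1 (s2 - N%:Z) s3 &
       S s1 s2 (s3 - N%:Z)]) ->
    (forall s1 s2 s3, S s1 s2 s3 -> F s1 s2 s3 = 0) ->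
  forall s1 s2 s3, S s1 s2 s3 -> mul123 k1 k2 k3 F s1 s2 s3 = 0.
Proof.
move=> SS F0.
have {}F0 : forall s1 s2 s3, S s1 s2 s3 -> mul23 N k3 F s1 s2 s3 = 0.
  elim: k3 => [//|k IH] s1 s2 s3 /SS/and3P[h1 h2 h3].
  by rewrite /mul23 mul_binomS -!/(mul23 N k F s1 _ _) !IH // scaler0 addr0.
have {}F0 : forall s1 s2 s3, S s1 s2 s3 -> mul13 N k2 (mul23 N k3 F) s1 s2 s3 = 0.
  elim: k2 => [//|k IH] s1 s2 s3 /SS/and3P[h1 h2 h3].
  by rewrite /mul13 mul_binomS -!/(mul13 N k (mul23 N k3 F) _ s2 _) !IH // scaler0 addr0.
rewrite /mul123; elim: k1 => [//|k IH] s1 s2 s3 /SS/and3P[h1 h2 h3].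
by rewrite /mul12 mul_binomS -!/(mul12 N k (mul13 N k2 (mul23 N k3 F)) _ _ s3) !IH // scaler0 addr0.
Qed.

End Swap.

Variable W : lmodType K.
Implicit Types a b c : W -> int -> W.

Definition lin_field a := forall s, linear (fun w => a w s).

Definition local k (q : K) a b := forall w s t,
  mulZ k (fun s t => a (b w t) s) s t = q *: mulZ k (fun s t => b (a w s) t) s t.

Lemma local_le k l q a b : (k <= l)%N -> local k q a b -> local l q a b.
Proof.
move=> /subnK <- H; elim: (l - k)%N => [//|m IH] w s t.
by rewrite addSn !mul_binomS !IH scalerDr !scalerA [q * _]mulrC.
Qed.

Definition triple a b c w : int -> int -> int -> W := fun s1 s2 s3 => a (b (c w s3) s2) s1.

Lemma triple_local12 a b c w k1 k2 k3 q : local k1 q a b ->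
  mul123 k1 k2 k3 (triple a b c w) =
  fun s1 s2 s3 => q *: mul123 k1 k2 k3 (fun s1 s2 s3 => b (a (c w s3) s1) s2) s1 s2 s3.
Proof.
move=> H; apply/funext => s1; apply/funext => s2; apply/funext => s3.
rewrite -mul123Z !mul123_12; congr (mul13 _ _ (mul23 _ _ _) _ _ _).
apply/funext => t1; apply/funext => t2; apply/funext => t3; rewrite mul12Z.
exact: (H (c w t3) t1 t2).
Qed.

Lemma local13_triple a b c w k1 k2 k3 q : lin_field b -> local k2 q a c ->
  mul123 k1 k2 k3 (fun s1 s2 s3 => b (a (c w s3) s1) s2) =
  fun s1 s2 s3 => q *: mul123 k1 k2 k3 (fun s1 s2 s3 => b (c (a w s1) s3) s2) s1 s2 s3.
Proof.
move=> bl H; apply/funext => s1; apply/funext => s2; apply/funext => s3.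
rewrite -mul123Z !mul123_13; congr (mul12 _ _ (mul23 _ _ _) _ _ _).
apply/funext => t1; apply/funext => t2; apply/funext => t3; rewrite mul13Z.
have := congr1 (b ^~ t2) (H w t1 t3).
by rewrite (linfZ (bl t2)) !(mul_binom_lin _ _ _ (bl t2)).
Qed.

(** The bound on s1 is obtained by moving a past b and c until it acts on w first. Those on s2 and
    s3 come from the cleared product of b and c, are uniform in s1 by linearity of a, and survive
    the other two factors. *)
Lemma laurent3_triple a b c w k1 k2 k3 q1 q2 :
    lin_field a -> lin_field b -> lin_field c -> laurent (a w) ->
    local k1 q1 a b -> local k2 q2 a c ->
    laurent2 (mulZ k3 (fun s t => b (c w t) s)) ->
  laurent3 (mul123 k1 k2 k3 (triple a b c w)).
Proof.
move=> al bl cl [A a0] ab ac [B bc0]; exists (Num.min A B) => s1 s2 s3 h.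
have [s1A|s1A] := ltP s1 A.
  rewrite (triple_local12 _ _ _ _ ab) (local13_triple _ _ _ bl ac).
  rewrite (@mul123_van _ _ _ _ _ (fun s1 _ _ => s1 < A)) ?scaler0 //.
    by move=> ? ? ?; lia.
  by move=> t1 t2 t3 ?; rewrite a0 // (linf0 (cl t3)) (linf0 (bl t2)).
rewrite -[mul123 k1 k2 k3 _]/(mul123 k1 k2 0 (mul23 N k3 (triple a b c w))).
apply: (@mul123_van _ _ _ _ _ (fun _ s2 s3 => (s2 < B) || (s3 < B))).
- by move=> ? ? ?; lia.
- move=> t1 t2 t3 tB; rewrite /mul23 /triple -(mul_binom_lin _ _ _ (al t1)) bc0 //.
  exact: (linf0 (al t1)).
- by move: h; rewrite !lt_min; lia.
Qed.

(* Dong's lemma: substituting x_2 = x_3 + y in the locality relation leaves the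
   factor (x_1 - x_3 - y)^k, removed coefficientwise in y at the cost of a power
   of x_1 - x_3. *)
Lemma local_prod a b c (cn : int -> W -> int -> W) k q1 q2 :
    lin_field a -> lin_field b ->
    local k q1 b a -> local k q2 b c ->
    (forall w, qexp N k (fun s t => a (c w t) s) (fun n s => cn n w s)) ->
  forall n, exists l, local l (q1 * q2) b (cn n).
Proof.
move=> al bl ba bc Hc.
pose D n w s1 s3 := b (cn n w s3) s1 - (q1 * q2) *: cn n (b w s1) s3.
suff X : forall n, exists l, forall w, qexp N l (D n w) (fun _ _ => 0).
  move=> n; have [l Hl] := X n; exists l => w s t.
  have [L E] := Hl w.
  have E0 j x : subst (mulZ l (D n w)) j x = 0 by rewrite -E.
  have := subst_inj N0 L E0 s t.
  have -> : D n w = (fun s t => (- (q1 * q2)) *: cn n (b w s) t + b (cn n w t) s).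
    by apply/funext => s1; apply/funext => s3; rewrite /D scaleNr addrC.
  by rewrite mul_binom_comb scaleNr addrC => /eqP; rewrite subr_eq0 => /eqP.
pose D' n w := mulZ k (D (n - k%:Z) w).
suff X : forall n, exists l, forall w, qexp N l (D' n w) (fun _ _ => 0).
  move=> n; have [l Hl] := X (n + k%:Z); exists (k + l)%N => w; apply: (qexp_unmulZ N0).
  by move: (Hl w); rewrite /D' addrK.
have cn0 m w s : m < - k%:Z -> cn m w s = 0 by move=> mk; exact: (qexp_trunc N0 _ (Hc w)).
have D0 m w s t : m < - k%:Z -> D m w s t = 0.
  by move=> mk; rewrite /D !cn0 // (linf0 (bl s)) scaler0 subr0.
apply: (qexp_removal N0 (e := -1) (k := k) (g := fun _ _ _ _ => 0) (m0 := 0)) => //.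
  move=> m w s t m0; rewrite /D' -[RHS](mul_binom0 W (-1) N k s t).
  by congr mul_binom; apply/funext => s'; apply/funext => t'; rewrite D0 //; lia.
move=> m; exists 0%N => w.
(* The field b at x_1 crosses a at x_2, then c at x_3, so the three binomial factors kill [P]; its
   expansion at x_2 = x_3 + y gives back [D]. *)
pose P s1 s2 s3 := triple b a c w s1 s2 s3 - (q1 * q2) *: a (c (b w s1) s3) s2.
have P0 s1 s2 s3 : mul123 k k k P s1 s2 s3 = 0.
  rewrite mul123B (triple_local12 _ _ _ _ ba) (local13_triple _ _ _ al bc).
  by rewrite scalerA subrr.
have SP s1 : mul23 N k P s1 = (fun s t => (- (q1 * q2)) *: mulZ k (fun s2 s3 => a (c (b w s1) s3) s2) s t
     + b (mulZ k (fun s2 s3 => a (c w s3) s2) s t) s1).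
  apply/funext => s2; apply/funext => s3.
  rewrite (mul_binom_lin _ _ _ (bl s1)) -mul_binom_comb.
  by congr mul_binom; apply/funext => t2; apply/funext => t3; rewrite scaleNr addrC.
have Lb s1 : laurent2 (fun s t => b (mulZ k (fun s2 s3 => a (c w s3) s2) s t) s1).
  by case: (Hc w) => -[s0 L0] _; exists s0 => s t st; rewrite L0 // (linf0 (bl s1)).
have S1 : slice1 (mul23 N k P).
  move=> s1; rewrite SP; apply: laurent2_comb; last exact: Lb.
  by case: (Hc (b w s1)).
have -> : iter k (zy N (-1)) (D' ^~ w) m = fun s1 s3 => 0.
  apply/funext => s1; apply/funext => s3.
  transitivity (subst (mul123 k k k P s1) m s3); last first.
    by rewrite substE tsum_eq0 // => s; rewrite P0 scaler0.
  rewrite subst23_mul12 //; last exact: slice1_mul13.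
  congr (iter k _ _ _ _ _); apply/funext => n; apply/funext => t1; apply/funext => t3.
  rewrite subst23_mul13 // /D'; congr (mul_binom _ _ _ _ _ _).
  apply/funext => u1; apply/funext => u3; rewrite SP.
  case: (Hc w) (Hc (b w u1)) => L1 E1 [L2 E2].
  rewrite subst_comb // -(subst_lin N (bl u1)) // -E1 -E2 /D scaleNr [RHS]addrC.
  by [].
have -> : iter k (ty (-1)) (fun _ : int => (fun _ _ : int => (0 : W))) m = fun _ _ => 0.
  by apply/funext => a1; apply/funext => b1; rewrite iter_ty mul_binom0.
exact: qexp0.
Qed.

End Fields.

(** * Relations and associativity for products of fields *)

Section FieldProducts.
Variables (K : numFieldType) (N : nat).
Hypothesis N0 : (0 < N)%N.

Local Notation mulZ := (mul_binom N (-1)).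
Local Notation subst := (subst_x2Dx0 N).

Variable W : lmodType K.
Implicit Types a b c u v : W -> int -> W.

(* cn is the sequence of products a_(n) c, normalised so that a_(n) c is the
   coefficient of x_0^n in Y(a, x_0) c. *)
Definition products k a c (cn : int -> W -> int -> W) :=
  forall w, qexp N k (fun s t => a (c w t) s) (fun n s => cn n w s).

Lemma products_le k l a c cn : (k <= l)%N -> products k a c cn -> products l a c cn.
Proof. by move=> kl H w; exact: (qexp_le N0 kl (H w)). Qed.

Lemma products_slice1 k a b c bn w : lin_field a -> products k b c bn ->
  slice1 (mul23 N k (triple a b c w)) /\
  forall s1 n s3, subst (mul23 N k (triple a b c w) s1) n s3 = a (bn (n - k%:Z) w s3) s1.
Proof.
move=> al H; case: (H w) => -[s0 L0] E.
have X s1 : mul23 N k (triple a b c w) s1 = fun s t => a (mulZ k (fun s t => b (c w t) s) s t) s1.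
  by apply/funext => s; apply/funext => t; rewrite (mul_binom_lin _ _ _ (al s1)).
split=> [s1|s1 n s3]; rewrite X; first by exists s0 => s t st; rewrite L0 // (linf0 (al s1)).
by rewrite E (subst_lin N (al s1)) //; exists s0.
Qed.

Lemma products_slice3 k a b c e w : products k a b e ->
  slice3 (mul12 N k (triple a b c w)) /\
  forall n s2 s3, subst (fun s1 s2 => mul12 N k (triple a b c w) s1 s2 s3) n s2 =
    e (n - k%:Z) (c w s3) s2.
Proof.
by move=> H; split=> [s3|n s2 s3]; case: (H (c w s3)) => // L E; rewrite E.
Qed.

Lemma products_van l a c cn : lin_field a -> products l a c cn ->
  (forall w s, c w s = 0) -> forall n w s, cn n w s = 0.
Proof.
move=> al H c0 n w s; apply: (qexp_uniq N0 (H w) (k := l) (l := 0) (h := fun _ _ => 0)).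
apply: (eq_qexp _ _ (qexp0 N W)) => // s1 t; rewrite c0 (linf0 (al s1)) //.
Qed.

(** Both sides sum G over an antidiagonal, with weights C(p, 0) and C(p, p). *)
Lemma subst1_0 (G : int -> int -> W) n :
  (forall i j, (i < 0) || (j < 0) -> G i j = 0) ->
  subst_x2Dx0 1 G 0 n = subst_x0Dx2 G 0 n.
Proof.
move=> G0; rewrite substE.
rewrite (@tsumE _ _ _ _ [seq p%:Z | p <- iota 0 (absz n).+1]); first last.
- move=> s; have [ps|ps] := ltP s 0; first by rewrite G0 ?ps // scaler0.
  case: s ps => // p _; rewrite mem_map; last by move=> ? ? [].
  by rewrite mem_iota => h; rewrite G0 ?scaler0 //; lia.
- by rewrite map_inj_uniq ?iota_uniq // => ? ? [].
rewrite big_map; symmetry; rewrite [LHS](@tsumE _ _ _ _ (iota 0 (absz n).+1)) ?iota_uniq //.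
  apply: eq_bigr => p _; rewrite [gb _ _ _ _]gbinom0 mulr0 addr0 add0r scale1r.
  by rewrite -pmulrn gbinom_nat binn scale1r.
by move=> p; rewrite mem_iota => h; rewrite G0 ?scaler0 //; lia.
Qed.

(** In the variables t, y of [subst2], locality of a and b says that [P0] and [Q0] agree after
    multiplication by t - y, so [commutator1] applies with N = 1. Its correction is the value at z =
    0, that is x_1 = x_2, of the cleared triple product. There the simple pole of a and b leaves
    (x_2 - x_3)^(2k) kappa c(x_3), and the power y^(2k) offsets the shifts by k in i and j. *)
Lemma commutator_prod a b c (an bn : int -> W -> int -> W) (ab ba : int -> int -> W -> int -> W)
    k q q' qa qb (e : int -> W -> int -> W) (kappa : K) :
    lin_field a -> lin_field b -> lin_field c ->
    (forall w, laurent (a w)) -> (forall w, laurent (b w)) -> (forall w, laurent (c w)) ->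
    local N 1 q a b -> local N 1 q' b a -> local N k qa a c -> local N k qb b c ->
    products k a c an -> products k b c bn ->
    (forall n, exists l, products l a (bn n) (ab n)) ->
    (forall n, exists l, products l b (an n) (ba n)) ->
    products 1 a b e -> (forall w, e (-1) w = const_series (kappa *: w)) ->
  forall i j w s, ab j i w s = q *: ba i j w s + (if i + j + 1 == 0 then kappa *: c w s else 0).
Proof.
move=> al bl cl aL bL cL lab lba lac lbc Pa Pb Pab Pba Pe ekappa i j w s.
pose F := mul123 N 1 k k (triple a b c w); pose F' := mul123 N 1 k k (triple b a c w).
have LF : laurent3 F by apply: (laurent3_triple N0 al bl cl (aL w) lab lac); case: (Pb w).
have LF' : laurent3 F' by apply: (laurent3_triple N0 bl al cl (bL w) lba lbc); case: (Pa w).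
have [S1 HD] := products_slice1 w al Pb.
have [S1' HD'] := products_slice1 w bl Pa.
have [S3 HH] := products_slice3 c w Pe.
pose g n x y := ab n x w y; pose g' n x y := ba n x w y.
have E x y z : subst2 N F x y z = mul_binom 1 (-1) 1 (fun x y => g (y - k%:Z) (x - k%:Z) z) x y.
  apply: (subst2_triple N0 (D := fun n s1 s3 => a (bn n w s3) s1)) => // n.
  by have [l Hl] := Pab n; exists l; exact: Hl.
have E' x y z : subst2 N F' x y z = mul_binom 1 (-1) 1 (fun x y => g' (y - k%:Z) (x - k%:Z) z) x y.
  apply: (subst2_triple N0 (D := fun n s1 s3 => b (an n w s3) s1)) => // n.
  by have [l Hl] := Pba n; exists l; exact: Hl.
(* The minus sign is that of x_1 - x_2 under the swap; in [PQ] the one of t - y compensates it. *)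
have FF' : F = fun s1 s2 s3 => (- q) *: swap12 F' s1 s2 s3.
  apply/funext => s1; apply/funext => s2; apply/funext => s3.
  rewrite /F (triple_local12 _ _ _ _ lab) -[fun _ _ _ => b _ _]/(swap12 (triple b a c w)).
  by rewrite mul123_swap expr1 scaleN1r scalerN scaleNr.
pose P0 z x y := g (y - k%:Z) (x - k%:Z) z.
pose Q0 z x y := q *: g' (x - k%:Z) (y - k%:Z) z.
have LsF' : laurent3 (swap12 F').
  by case: LF' => s0 F0; exists s0 => s1 s2 s3 h; apply: F0; lia.
have PQ z x y : mul_binom 1 (-1) 1 (P0 z) x y = mul_binom 1 (-1) 1 (Q0 z) x y.
  rewrite -E FF' /subst2.
  transitivity ((- q) *: subst2 N (swap12 F') x y z).
    rewrite /subst2 -substZ; last exact: (laurent3_subst23 N0 _ LsF').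
    congr subst; apply/funext => s1; apply/funext => s3; rewrite substZ //.
    exact: (laurent3_slice1 LsF').
  have -> : subst2 N (swap12 F') x y z = subst2 N F' y x z by exact: subst2_swap.
  rewrite E'.
  rewrite (mul_binomZ1 (-1) 1 1 q (fun x y => g' (x - k%:Z) (y - k%:Z) z)).
  rewrite !mul_binomS /= !scalerDr !scalerA addrC.
  by congr (_ *: _ + _ *: _); rewrite mulrN1 ?opprK.
have PT z x y : y < 0 -> P0 z x y = 0.
  move=> y0; rewrite /P0 /g; have [l Hl] := Pab (y - k%:Z).
  by rewrite (products_van al Hl) // => w1 s1; rewrite (qexp_trunc N0 _ (Pb w1)) //; lia.
have QT z x y : x < 0 -> Q0 z x y = 0.
  move=> x0; rewrite /Q0 /g'; have [l Hl] := Pba (x - k%:Z).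
  by rewrite (products_van bl Hl) ?scaler0 // => w1 s1; rewrite (qexp_trunc N0 _ (Pa w1)) //; lia.
have := commutator1 (N := 1) isT (p := 0) (PT s) (QT s) _ _ (PQ s) (i + k%:Z) (j + k%:Z).
rewrite dvd1z /P0 /Q0 /g /g' !addrK => ->; try by move=> x y; rewrite dvd1z.
congr (_ + _).
have -> : mul_binom 1 (-1) 1 (P0 s) = fun x y => subst2 N F x y s.
  by apply/funext => x; apply/funext => y; rewrite E.
rewrite subst1_0; last first.
  move=> x y /orP[x0|y0]; first by rewrite /subst2 subst_neg.
  by rewrite -(subst2_swap N x y s LF) /subst2 subst_neg.
rewrite -(subst23_subst12 N0) //.
pose H n s2 s3 := e n (c w s3) s2.
have H0 n s2 s3 : n < -1 -> H n s2 s3 = 0 by move=> n1; exact: (qexp_trunc N0 _ (Pe (c w s3))).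
have -> : (fun s2 s3 => subst (fun s1 s2 => F s1 s2 s3) 0 s2) =
    mulZ (k + k) (fun s2 s3 => if s2 == 0 then kappa *: c w s3 else 0).
  apply/funext => s2; apply/funext => s3; rewrite /F /mul123.
  rewrite [LHS](subst12_triple N0 (H := H) k k 0 s2 s3 S3 HH) mul_binomD.
  rewrite (@iter_zy_low K N N0 W 1 k _ 0); last first.
    move=> n t2 t3 n0; rewrite -[RHS](mul_binom0 W (-1) N k t2 t3).
    by congr mul_binom; apply/funext => u2; apply/funext => u3; apply: H0; lia.
  congr (mul_binom _ _ _ (mul_binom _ _ _ _) _ _).
  by apply/funext => u2; apply/funext => u3; rewrite /H sub0r ekappa.
rewrite subst_mulZ //; last first.
  by apply: (laurent2_const N0); case: (cL w) => s0 c0; exists s0 => t ts; rewrite c0 ?scaler0.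
rewrite subst_const; congr (if _ then _ else _).
by apply/eqP/eqP; lia.
Qed.

(** Here [e m] stands for a_m u, [auv n i] for a_i (u_n v) and [eta m n] for (a_m u)_n v. The
    associativity hypothesis relates these coefficients for each vector w, with l independent of
    w. *)
Lemma assoc_prod a u v (e uv : int -> W -> int -> W) (auv eta : int -> int -> W -> int -> W)
    k q1 q2 j0 m0 l :
    lin_field a -> lin_field u -> lin_field v -> (forall w, laurent (a w)) ->
    local N k q1 a u -> local N k q2 a v ->
    products k a u e -> products k u v uv ->
    (forall n, exists l, products l a (uv n) (auv n)) ->
    (forall n i w s, n < j0 -> auv n i w s = 0) ->
    (forall m w s, m < m0 -> e m w s = 0) ->
    (forall m n w s, m < m0 -> eta m n w s = 0) ->
    (forall w s i j,
       mul_binom 1 1 l (subst_x0Dx2 (fun i j => auv j i w s)) i j =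
       mul_binom 1 1 l (fun i j => eta i j w s) i j) ->
  forall m, exists k, products k (e m) v (eta m).
Proof.
move=> al ul vl aL lau lav Pe Puv Pauv T0 e0 eta0 Hassoc m.
have X := @iterate_expansion K N N0 W W (fun w => triple a u v w)
  (fun w n s1 s3 => a (uv n w s3) s1) (fun w n i x => auv n i w x)
  (fun w m s2 s3 => e m (v w s3) s2) (fun w m n x => eta m n w x) k k k l m0.
rewrite /products; apply: X.
- by move=> w; case: (products_slice1 w al Puv).
- by move=> w; case: (products_slice1 w al Puv).
- by move=> w n; have [l' Hl] := Pauv n; exists l'; exact: Hl.
- by move=> w; apply: (laurent3_triple N0 al ul vl (aL w) lau lav); case: (Puv w).
- by move=> w; case: (products_slice3 v w Pe).
- by move=> w; case: (products_slice3 v w Pe).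
- by move=> w; exists j0 => n i x y; exact: T0.
- by move=> w s i j; exact: Hassoc.
- by move=> w n s t; exact: e0.
- by move=> w n s t; exact: eta0.
Qed.

End FieldProducts.

(** * Modules over the quantum Weyl algebras *)

Section TermAction.
Variables (K : comNzRingType) (G : Type) (rel : aterm K G -> aterm K G -> Prop).
Variables (M : lmodType K) (U : M -> Prop) (f : G -> M -> M).
Hypothesis UD : forall c d, U c -> U d -> U (c + d).
Hypothesis UZ : forall k c, U c -> U (k *: c).
Hypothesis fU : forall x c, U c -> U (f x c).
Hypothesis fD : forall x c d, U c -> U d -> f x (c + d) = f x c + f x d.
Hypothesis fZ : forall x k c, U c -> f x (k *: c) = k *: f x c.

(** The operators are linear and satisfy the relations only on [U], so terms are evaluated on
    vectors directly rather than by [plift] into a ring of endomorphisms of [M]. *)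
Fixpoint tact (t : aterm K G) (c : M) : M :=
  match t with
  | AGen x => f x c
  | ACst k => k *: c
  | AAdd t u => tact t c + tact u c
  | AMul t u => tact t (tact u c)
  end.

Hypothesis f_rel : forall t u c, rel t u -> U c -> tact t c = tact u c.

Lemma tactU t c : U c -> U (tact t c).
Proof. by elim: t c => [x|k|t IHt u IHu|t IHt u IHu] c Uc /=; auto. Qed.

Lemma tactD t c d : U c -> U d -> tact t (c + d) = tact t c + tact t d.
Proof.
elim: t c d => [x|k|t IHt u IHu|t IHt u IHu] c d Uc Ud /=.
- exact: fD.
- exact: scalerDr.
- by rewrite IHt // IHu // addrACA.
- by rewrite IHu // IHt //; exact: tactU.
Qed.

Lemma tactZ t k c : U c -> tact t (k *: c) = k *: tact t c.
Proof.
elim: t k c => [x|l|t IHt u IHu|t IHt u IHu] k c Uc /=.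
- exact: fZ.
- by rewrite !scalerA mulrC.
- by rewrite IHt // IHu // scalerDr.
- by rewrite IHu // IHt //; exact: tactU.
Qed.

Lemma tact_acong t u : acong rel t u -> forall c, U c -> tact t c = tact u c.
Proof.
elim=> {t u} //=.
- by move=> t u _ IH c Uc; rewrite IH.
- by move=> t u v _ IH1 _ IH2 c Uc; rewrite IH1 // IH2.
- by move=> t t' u u' _ IH1 _ IH2 c Uc; rewrite IH1 // IH2.
- by move=> t t' u u' _ IH1 _ IH2 c Uc; rewrite IH2 // IH1 //; exact: tactU.
- by move=> t u v c Uc; rewrite addrA.
- by move=> t u c Uc; rewrite addrC.
- by move=> t c Uc; rewrite scale0r add0r.
- by move=> t c Uc; rewrite scaleN1r addNr scale0r.
- by move=> t c Uc; rewrite scale1r.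
- by move=> t u v c Uc; rewrite tactD //; exact: tactU.
- by move=> a b c Uc; rewrite scalerDl.
- by move=> a b c Uc; rewrite scalerA.
- by move=> a t c Uc; rewrite tactZ.
- by move=> t u tu c Uc; exact: f_rel.
Qed.

Definition pact (a : palg rel) (c : M) : M := tact (repr a) c.

Lemma pact_cls t c : U c -> pact (pcls rel t) c = tact t c.
Proof. exact/tact_acong/repr_pcls. Qed.

Lemma pact_gen x c : U c -> pact (pgen rel x) c = f x c.
Proof. exact: pact_cls. Qed.

Lemma pactU a c : U c -> U (pact a c).
Proof. exact: tactU. Qed.

Lemma pactP a b k c : U c -> pact (k *: a + b) c = k *: pact a c + pact b c.
Proof.
move=> Uc; elim/palgP: a => t; elim/palgP: b => u.
by rewrite -[k *: _]/(pcls rel (ACst k) * _) -pclsM -pclsD !pact_cls.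
Qed.

Lemma pactM a b c : U c -> pact (a * b) c = pact a (pact b c).
Proof.
move=> Uc; elim/palgP: a => t; elim/palgP: b => u.
by rewrite -pclsM !pact_cls //; exact: tactU.
Qed.

Lemma pact1 c : U c -> pact 1 c = c.
Proof. by move=> Uc; rewrite -[1]/(pcls rel (ACst 1)) pact_cls //= scale1r. Qed.

Lemma pact_linear a k c d : U c -> U d -> pact a (k *: c + d) = k *: pact a c + pact a d.
Proof. by move=> Uc Ud; rewrite /pact tactD ?tactZ //; exact: UZ. Qed.

Lemma pact0 c : U c -> pact 0 c = 0.
Proof. by move=> Uc; have := pactP 0 0 (-1) Uc; rewrite scaler0 addr0 scaleN1r addNr. Qed.

End TermAction.

Section Generators.
Variables (K : numFieldType) (r : nat) (Q : 'M[K]_r).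
Hypothesis QQ : forall i j, Q i j * Q j i = 1.

(* (true, i) stands for X_i and (false, i) for Y_i. *)
Definition gen rho (g : bool * 'I_r) (m : int) : qalg Q rho :=
  if g.1 then genX Q rho g.2 m else genY Q rho g.2 m.

Definition qq (g h : bool * 'I_r) : K :=
  if g.1 == h.1 then Q g.2 h.2 else Q h.2 g.2.

(** For the pair Y, X the defining relation of X, Y is solved for Y X by means of q_ij q_ji = 1,
    whence the factor -q. *)
Definition kap (g h : bool * 'I_r) : K :=
  if g.1 == h.1 then 0
  else if g.2 == h.2 then (if g.1 then 1 else - Q h.2 g.2) else 0.

Lemma idxXY_eq0 rho m n : (idxX rho m + idxY rho n + 1 == 0) = (m + n + 1 == 0).
Proof.
rewrite /idxX /idxY addrACA subrr add0r -rmorphD /= -[X in _ + X](rmorph1 (intr : int -> rat)).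
by rewrite -rmorphD intr_eq0.
Qed.

Lemma gen_rel rho g h m n : gen rho g m * gen rho h n =
  qq g h *: (gen rho h n * gen rho g m) + (if m + n + 1 == 0 then kap g h else 0) *: (1 : qalg Q rho).
Proof.
have E t u (tu : qrel Q rho t u) := (pclsP (qrel Q rho) t u).2 (acong_rel tu).
have XY i j k l : genX Q rho i k * genY Q rho j l =
    Q j i *: (genY Q rho j l * genX Q rho i k) +
    (if k + l + 1 == 0 then (i == j)%:R else 0) *: (1 : qalg Q rho).
  move: (E _ _ (qrelXY Q rho i j k l)); rewrite pclsD !pclsM !pcls_cst idxXY_eq0.
  rewrite -palg_scalerAl mul1r scaleNr => /eqP; rewrite subr_eq => /eqP ->.
  by rewrite addrC; congr (_ + _ *: _); case: (i == j); case: (_ == 0).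
case: g h => [[] i] [[] j]; rewrite /gen /qq /kap /=.
- rewrite if_same scale0r addr0.
  by move: (E _ _ (qrelXX Q rho i j m n)); rewrite !pclsM pcls_cst -palg_scalerAl mul1r.
- by rewrite XY; congr (_ + _ *: _); case: (i == j).
- rewrite XY scalerDr !scalerA QQ scale1r -addrA -scalerDl [n + m]addrC.
  rewrite -[LHS]addr0; congr (_ + _); apply/esym.
  case: (m + n + 1 == 0); last by rewrite mulr0 addr0 scale0r.
  have [->|ij] := eqVneq i j; first by rewrite /= mulr1 subrr scale0r.
  by rewrite /= mulr0 addr0 scale0r.
- rewrite if_same scale0r addr0.
  by move: (E _ _ (qrelYY Q rho i j m n)); rewrite !pclsM pcls_cst -palg_scalerAl mul1r.
Qed.

End Generators.

Section ModuleFields.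
Variables (K : numFieldType) (r : nat) (Q : 'M[K]_r) (N : nat).
Hypothesis N0 : (0 < N)%N.
Hypothesis QQ : forall i j, Q i j * Q j i = 1.
Local Notation AQ := (qalg Q N%:R^-1).
Variables (W : lmodType K) (act : AQ -> W -> W).

(** The modes of [g] lie in sg g / N + Z, and [theta] multiplies the vector of [g] in V_Q by omega_N
    to the power [sg g]. *)
Definition sg (g : bool * 'I_r) : int := if g.1 then 1 else -1.

(* The exponent of x^{1/N} that goes with the mode m. *)
Definition expo (g : bool * 'I_r) (m : int) : int := - (N%:Z * (m + 1)) - sg g.

Definition fld (g : bool * 'I_r) : W -> int -> W :=
  if g.1 then seriesX N act g.2 else seriesY N act g.2.

Local Notation gen := (gen Q N%:R^-1).

Lemma fldE g m w : fld g w (expo g m) = act (gen g m) w.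
Proof.
have NQ : (N%:R : rat) != 0 by rewrite pnatr_eq0 -lt0n.
have H (x : int) : - (N%:R^-1 *~ x + m%:~R) - 1 = (- (N%:Z * (m + 1)) - x)%:~R / N%:R :> rat.
  rewrite !rmorphB !rmorphN !rmorphM !rmorphD /= rmorph1 -[_ *~ x]mulrzr.
  by field.
rewrite /fld /gen /expo /sg; case: g => -[] i /=.
  rewrite /seriesX (_ : mkset _ = [set m]%classic) ?fsbig_set1 //.
  apply/seteqP; split=> x /=; rewrite /idxX -H mulr1z.
    by move=> /addIr /oppr_inj /addrI /intr_inj.
  by move=> ->.
rewrite /seriesY (_ : mkset _ = [set m]%classic) ?fsbig_set1 //.
apply/seteqP; split=> x /=; rewrite /idxY -H mulrN1z.
  by move=> /addIr /oppr_inj /addrI /intr_inj.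
by move=> ->.
Qed.

Lemma expo_cls g s : (N%:Z %| s + sg g)%Z -> exists m, s = expo g m.
Proof. by case/dvdzP => q sq; exists (- q - 1); rewrite /expo; lia. Qed.

Lemma expo_dvd g m : (N%:Z %| expo g m + sg g)%Z.
Proof. by rewrite /expo subrK -mulrN dvdz_mulr. Qed.

Lemma fld0 g w s : ~~ (N%:Z %| s + sg g)%Z -> fld g w s = 0.
Proof.
move=> sg0; have NQ : (N%:R : rat) != 0 by rewrite pnatr_eq0 -lt0n.
have H (x y m : int) : - (N%:R^-1 *~ x + m%:~R) - 1 = y%:~R / N%:R :> rat ->
    y = - (N%:Z * (m + 1)) - x.
  move=> E; apply: (@intr_inj rat).
  rewrite -[LHS](mulfVK NQ) -E !rmorphB !rmorphN !rmorphM !rmorphD /= rmorph1 -[_ *~ x]mulrzr.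
  by field.
move: sg0; rewrite /fld /sg; case: g => -[] i /= sg0.
  rewrite /seriesX (_ : mkset _ = set0) ?fsbig_set0 //.
  apply/seteqP; split=> // m /=; rewrite /idxX -[X in - (X + _)]mulr1z => /H E.
  by move: sg0; rewrite E subrK -mulrN dvdz_mulr.
rewrite /seriesY (_ : mkset _ = set0) ?fsbig_set0 //.
apply/seteqP; split=> // m /=; rewrite /idxY -[X in - (X + _)]mulrN1z => /H E.
by move: sg0; rewrite E subrK -mulrN dvdz_mulr.
Qed.

Lemma kap0 g h : sg g + sg h != 0 -> kap Q g h = 0.
Proof. by rewrite /sg /kap; case: g.1; case: h.1. Qed.

Lemma const_series_expo g h m n (w : W) :
  const_series (kap Q g h *: w) (expo g m + expo h n + N%:Z) =
  if m + n + 1 == 0 then kap Q g h *: w else 0.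
Proof.
rewrite /const_series /expo.
have [s0|/kap0 ->] := eqVneq (sg g + sg h) 0; last by rewrite scale0r !if_same.
have -> : - (N%:Z * (m + 1)) - sg g + (- (N%:Z * (n + 1)) - sg h) + N%:Z =
  - (N%:Z * (m + n + 1)) - (sg g + sg h) by lia.
by rewrite s0 subr0 oppr_eq0 mulf_eq0 -[X in X || _]/(N == 0%N) eqn0Ngt N0.
Qed.

Hypothesis act_mod : is_module act.

Lemma fld_lin g : lin_field (fld g).
Proof.
move=> s; have [/expo_cls[m ->]|h] := boolP (N%:Z %| s + sg g)%Z.
  by case: act_mod => _ al _ _ c v w; rewrite !fldE al.
by move=> c v w; rewrite !fld0 // scaler0 addr0.
Qed.

Lemma fld_commutator g h w s t :
  fld g (fld h w t) s = qq Q g h *: fld h (fld g w s) t +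
    (if (N%:Z %| s - (- sg g))%Z then const_series (kap Q g h *: w) (s + t + N%:Z) else 0).
Proof.
rewrite opprK; have [L1 L2 L3 L4] := act_mod.
have [/expo_cls[m ->]|hg] := boolP (N%:Z %| s + sg g)%Z; last first.
  by rewrite !(fld0 _ hg) (linf0 (fld_lin h t)) scaler0 addr0.
have Z0 a b : act (a *: (1 : AQ)) b = a *: b by rewrite (linfZ (L1 b)) L3.
have [/expo_cls[n ->]|hh] := boolP (N%:Z %| t + sg h)%Z; last first.
  (* A nonzero contraction requires sg g + sg h = 0, and then s + t + N = 0 would put t in the
     support of h. *)
  rewrite !(fld0 _ hh) (linf0 (fld_lin g _)) scaler0 add0r /const_series; case: eqP => // E.
  have [s0|/kap0 ->] := eqVneq (sg g + sg h) 0; last by rewrite scale0r.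
  case/negP: hh; have -> : t + sg h = N%:Z * (m + 1) - N%:Z * 1 + (sg g + sg h).
    by move: E; rewrite /expo; lia.
  by rewrite s0 addr0 rpredB // dvdz_mulr.
rewrite !fldE -!L4 gen_rel // (linfD (L1 w)) (linfZ (L1 w)) Z0 const_series_expo.
by case: ifP => // _; rewrite scale0r.
Qed.

Hypothesis act_res : restricted act.

Lemma fld_laurent g w : laurent (fld g w).
Proof.
case: (act_res w g.2) => B [BX BY]; have [b Bb] : exists b : int, B <= b%:~R.
  by exists (Num.ceil B); exact: Num.Theory.ceil_ge.
(* The 3 pays for m + 1 in [expo], for the sign [sg g], and for the offset 1/N of the rational
   indices, each costing at most one unit of m. *)
exists (- (N%:Z * (`|b| + 3))) => s sb.
have [/expo_cls[m sm]|h] := boolP (N%:Z %| s + sg g)%Z; last by rewrite fld0.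
have mb : b + 1 <= m.
  have : `|b| + 1 < m.
    have : N%:Z * (`|b| + 1) < N%:Z * m.
      move: sb; rewrite sm /expo /sg; case: g.1; have := N0; lia.
    by rewrite ltr_pM2l.
  by lia.
have N1 : (N%:R : rat)^-1 <= 1 by rewrite invf_le1 ?ltr0n // ler1n.
have N2 : 0 <= (N%:R : rat)^-1 by rewrite invr_ge0 ler0n.
have mB : B + 1 <= m%:~R.
  by apply: le_trans (_ : (b + 1)%:~R <= _); rewrite ?ler_int // rmorphD lerD2r.
rewrite sm fldE /gen; case: g.1.
  apply: BX; rewrite /idxX; apply: le_trans (_ : m%:~R <= _).
    by apply: le_trans mB; rewrite lerDl.
  by rewrite lerDr.
apply: BY; rewrite /idxY addrC lerBrDr; apply: le_trans mB.
by rewrite lerD2l.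
Qed.

End ModuleFields.

Section ModuleV.
Variables (K : numFieldType) (r : nat) (Q : 'M[K]_r).

Definition gv (g : bool * 'I_r) : VQ Q := if g.1 then VQu Q g.2 else VQv Q g.2.

Lemma VQactP a b k (v : VQ Q) : VQact (k *: a + b) v = k *: VQact a v + VQact b v.
Proof. by have [L _ _ _] := lact_is_module (@JQ_gen K r Q); exact: L. Qed.

Lemma VQact0 (v : VQ Q) : VQact 0 v = 0.
Proof. by have := VQactP 0 0 (-1) v; rewrite scaler0 addr0 scaleN1r addNr. Qed.

Lemma VQactZ k a (v : VQ Q) : VQact (k *: a) v = k *: VQact a v.
Proof. by rewrite -[k *: a]addr0 VQactP VQact0 addr0. Qed.

Lemma VQactM a b (v : VQ Q) : VQact (a * b) v = VQact a (VQact b v).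
Proof. by have [_ _ _ L] := lact_is_module (@JQ_gen K r Q); exact: L. Qed.

Lemma VQact1 (v : VQ Q) : VQact 1 v = v.
Proof. by have [_ _ L _] := lact_is_module (@JQ_gen K r Q); exact: L. Qed.

Lemma VQact_linear a : linear (@VQact K r Q a).
Proof. by have [_ L _ _] := lact_is_module (@JQ_gen K r Q); exact: L. Qed.

Lemma VQact_vac g m : 0 <= m -> VQact (gen Q 0 g m) (VQvac Q) = 0.
Proof.
move=> m0; rewrite /VQact /VQvac lactE mulr1.
rewrite -[RHS](scale0r (lcls (@JQ_gen K r Q) 1)) -lclsZ scale0r; apply/lclsP.
by rewrite subr0; apply: left_ideal_gen; rewrite /gen; case: g.1; constructor.
Qed.

(* P is meant for monomials in the generators applied to the vacuum vector, P' for
   their linear combinations. *)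
Lemma VQ_span (P P' : VQ Q -> Prop) : P (VQvac Q) ->
    (forall g m v, P v -> P (VQact (gen Q 0 g m) v)) ->
    (forall v, P v -> P' v) -> P' 0 -> (forall c u v, P' u -> P' v -> P' (c *: u + v)) ->
  forall v, P' v.
Proof.
move=> P1 Pg PP' P'0 P'D.
(* [S] is the linear span of [P], encoded as the intersection of all linear predicates containing
   [P]. *)
pose S v := forall P'' : VQ Q -> Prop, (forall v, P v -> P'' v) -> P'' 0 ->
  (forall c u v, P'' u -> P'' v -> P'' (c *: u + v)) -> P'' v.
suff H a v : S v -> S (VQact a v).
  elim/lquotP=> a; have := H a (VQvac Q); rewrite /VQact /VQvac lactE mulr1.
  by move=> H1; apply: H1 => // P'' PP'' _ _; exact: PP''.
elim/qalg_ind: a v => [i m|i m||a b IHa IHb|a b IHa IHb|c a IH] v Sv.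
- apply: (Sv (fun v => S (VQact (genX Q 0 i m) v))) => [u Pu|P'' _ ? _|c u u' Su Su' P'' h1 h2 h3].
  + by move=> P'' PP'' _ _; apply: PP''; exact: (Pg (true, i)).
  + by rewrite (linf0 (VQact_linear _)).
  + by rewrite VQact_linear; apply: (h3); [exact: Su|exact: Su'].
- apply: (Sv (fun v => S (VQact (genY Q 0 i m) v))) => [u Pu|P'' _ ? _|c u u' Su Su' P'' h1 h2 h3].
  + by move=> P'' PP'' _ _; apply: PP''; exact: (Pg (false, i)).
  + by rewrite (linf0 (VQact_linear _)).
  + by rewrite VQact_linear; apply: (h3); [exact: Su|exact: Su'].
- by rewrite VQact1.
- move=> P'' h1 h2 h3; rewrite -[a]scale1r VQactP; apply: (h3); [exact: IHa|exact: IHb].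
- by rewrite VQactM; exact: (IHa _ (IHb _ Sv)).
- move=> P'' h1 h2 h3; rewrite -[c *: a]addr0 VQactP; apply: (h3); first exact: IH.
  by rewrite VQact0.
Qed.

Variable Y : VQ Q -> VQ Q -> int -> VQ Q.
Hypothesis hY : is_nonlocal_va (VQvac Q) Y.
Hypothesis hX : forall i, Y (VQu Q i) = seriesX 1 (@VQact _ _ Q) i.
Hypothesis hV : forall i, Y (VQv Q i) = seriesY 1 (@VQact _ _ Q) i.

Lemma Y_gv g v n : Y (gv g) v n = VQact (gen Q 0 g (- n - 1)) v.
Proof.
rewrite {1}(_ : n = - (- n - 1) - 1); last by lia.
by rewrite /gv /gen; case: g.1; rewrite ?hX ?hV ?VQact_seriesX ?VQact_seriesY.
Qed.

Lemma Y0 v n : Y 0 v n = 0.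
Proof. exact: (linf0 (nlva_linearl hY v n)). Qed.

Lemma Yv0 v n : Y v 0 n = 0.
Proof. exact: (linf0 (nlva_linearr hY v n)). Qed.

End ModuleV.

(** * The products a_n c as an operation on fields *)

Section Products.
Variables (K : numFieldType) (N : nat).
Hypothesis N0 : (0 < N)%N.
Variable W : lmodType K.
Implicit Types a c : W -> int -> W.
Local Notation mulZ := (mul_binom N (-1)).
Local Notation subst := (subst_x2Dx0 N).

Definition compat a c := exists k, forall w, laurent2 (mulZ k (fun s t => a (c w t) s)).

(** The order of the pole is chosen arbitrarily; by [products_uniq] the result does not depend on
    it. The default 0 makes the operation total, since arbitrary fields need not be compatible. *)
Definition prodf a c : int -> W -> int -> W :=
  if pselect (compat a c) is left h then
    let k := projT1 (cid h) in
    fun n w s => subst (mulZ k (fun s t => a (c w t) s)) (n + k%:Z) s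
  else fun _ _ _ => 0.

Lemma prodfP a c : compat a c -> exists k, products N k a c (prodf a c).
Proof.
move=> h; rewrite /prodf; case: pselect => // h'; exists (projT1 (cid h')) => w.
split; first exact: (projT2 (cid h')).
by move=> i s; rewrite subrK.
Qed.

Lemma products_compat k a c cn : products N k a c cn -> compat a c.
Proof. by move=> H; exists k => w; case: (H w). Qed.

Lemma products_uniq k l a c cn cn' : products N k a c cn -> products N l a c cn' -> cn = cn'.
Proof.
move=> H H'; apply/funext => n; apply/funext => w; apply/funext => s.
exact: (qexp_uniq N0 (H w) (H' w)).
Qed.

Lemma prodfE k a c cn : products N k a c cn -> prodf a c = cn.
Proof.
by move=> H; have [l Hl] := prodfP (products_compat H); exact: products_uniq Hl H.
Qed.

Lemma products_comb k l a c d cn dn x : lin_field a ->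
    products N k a c cn -> products N l a d dn ->
  exists m, products N m a (x *: c + d) (fun n => x *: cn n + dn n).
Proof.
move=> al H H'; exists (maxn k l) => w.
apply: (eq_qexp _ _ (qexp_comb x (qexp_le N0 (leq_maxl k l) (H w))
  (qexp_le N0 (leq_maxr k l) (H' w)))) => // s t.
by rewrite -(al s).
Qed.

Lemma products_lin k a c cn n : lin_field a -> lin_field c -> products N k a c cn ->
  lin_field (cn n).
Proof.
move=> al cl H s x w w'.
apply: (qexp_uniq N0 (H (x *: w + w')) (l := k)
  (h := fun n s => x *: cn n w s + cn n w' s)).
by apply: (eq_qexp _ _ (qexp_comb x (H w) (H w'))) => // s1 t; rewrite -(al s1) -(cl t).
Qed.

Lemma products_laurent k a c cn n w : products N k a c cn -> laurent (cn n w).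
Proof.
move=> H; case: (H w) => -[s0 L0] E.
exists (s0 + s0 - N%:Z * (n + k%:Z)) => s ss; rewrite -(addrK k%:Z n) E substE tsum_eq0 // => t.
by rewrite L0 ?scaler0 //; lia.
Qed.

Definition vacf : W -> int -> W := fun w => const_series w.

(** The product with the identity field at index n is the n-th divided derivative of a. It is 0 for
    n < 0, which will make J_Q act by zero on [vacf]. *)
Lemma vacf_products a : lin_field a -> (forall w, laurent (a w)) ->
  products N 0 a vacf (fun n w s => gb K N (s + N%:Z * n) n *: a w (s + N%:Z * n)).
Proof.
move=> al aL w; have E s t : a (vacf w t) s = if t == 0 then a w s else 0.
  by rewrite /vacf /const_series; case: eqP => // _; rewrite (linf0 (al s)).
split.
  case: (aL w) => s0 a0; exists (Num.min 0 s0) => s t; rewrite lt_min /= E => st.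
  by case: eqP => // t0; rewrite a0 //; move: st; rewrite t0 lt_min; lia.
move=> i s; rewrite subr0 substE (tsum1 (t := s + N%:Z * i)).
  by rewrite /= E subrr eqxx.
move=> t ti; rewrite /= E; case: eqP; rewrite ?scaler0 // => /subr0_eq /eqP.
by rewrite eq_sym (negPf ti).
Qed.

Lemma vacf_local a k : lin_field a -> local N k 1 a vacf.
Proof.
move=> al; apply: (local_le (leq0n k)) => w s t; rewrite /= scale1r /vacf /const_series.
by case: eqP => // _; rewrite (linf0 (al s)).
Qed.

End Products.

(** * The twisted module of a restricted module *)

Section Existence.
Variables (K : numFieldType) (r : nat) (Q : 'M[K]_r) (N : nat).
Hypothesis N0 : (0 < N)%N.
Hypothesis QQ : forall i j, Q i j * Q j i = 1.
Variables (W : lmodType K) (act : qalg Q N%:R^-1 -> W -> W).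
Hypothesis act_mod : is_module act.
Hypothesis act_res : restricted act.

Local Notation field := (W -> int -> W).
Local Notation mulZ := (mul_binom N (-1)).
Local Notation subst := (subst_x2Dx0 N).
Local Notation fd := (fld act).
Local Notation prodg g c := (prodf N (fd g) c).

Let fl g : lin_field (fd g) := fld_lin N0 act_mod g.
Let fL g w : laurent (fd g w) := fld_laurent N0 act_res g w.

(** One side of the locality relation bounds the exponents of x_2, the other those of x_1. *)
Lemma local_laurent2 k q (a c : field) w : lin_field a -> lin_field c ->
  laurent (a w) -> laurent (c w) -> local N k q a c ->
  laurent2 (mulZ k (fun s t => a (c w t) s)).
Proof.
move=> al cl [s0 a0] [t0 c0] H.
apply: (@laurent2_eq _ W _ (fun s t => q *: mulZ k (fun s t => c (a w s) t) s t) s0 t0).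
- by apply: (mul_binom_trunct N0) => s t tt; rewrite c0 // (linf0 (al s)).
- move=> s t ss; rewrite (@mul_binom_truncs _ _ N0 _ _ _ _ s0) ?scaler0 //.
  by move=> s1 t1 h; rewrite a0 // (linf0 (cl t1)).
- exact: H.
Qed.

Lemma fld_local_exp g h :
  local N 1 (qq Q g h) (fd g) (fd h) /\
  forall w b, subst (mulZ 1 (fun s t => fd g (fd h w t) s)) 0 b = const_series (kap Q g h *: w) b.
Proof.
pose P w s t := fd g (fd h w t) s; pose R w s t := qq Q g h *: fd h (fd g w s) t.
have X w : (forall s t, mulZ 1 (P w) s t = mulZ 1 (R w) s t) /\
    forall b, subst (mulZ 1 (P w)) 0 b = const_series (kap Q g h *: w) b.
  have [s0 a0] := fL g w; have [t0 c0] := fL h w.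
  apply: (@telescope _ N N0 W (P w) (R w) (- sg g) s0 t0).
  - by move=> s t tt; rewrite /P c0 // (linf0 (fl g s)).
  - by move=> s t ss; rewrite /R a0 // (linf0 (fl h t)) scaler0.
  - by move=> s t; rewrite /P (fld_commutator N0 QQ act_mod).
by split=> [w s t|w]; have [H1 H2] := X w; rewrite // [LHS]H1 mul_binomZ1.
Qed.

Lemma fld_products g h : exists2 e, products N 1 (fd g) (fd h) e &
  forall w, e (-1) w = const_series (kap Q g h *: w).
Proof.
have [L H] := fld_local_exp g h.
exists (fun n w s => subst (mulZ 1 (fun s t => fd g (fd h w t) s)) (n + 1) s) => w.
  split; last by move=> i s; rewrite subrK.
  exact: (local_laurent2 (fl g) (fl h) (fL g w) (fL h w) L).
by apply/funext => s; rewrite addNr H.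
Qed.

(* lam is the charge of c: the scalars q produced when moving the generating
   fields across c. *)
Record good (lam : bool * 'I_r -> K) (c : field) : Prop := {
  good_lin : lin_field c;
  good_laurent : forall w, laurent (c w);
  good_local : forall g, exists k, local N k (lam g) (fd g) c
}.

Lemma good_local_uniform lam c : good lam c -> exists k, forall g, local N k (lam g) (fd g) c.
Proof.
move=> [_ _ H]; have [k Hk] := choice H; exists (\max_g k g)%N => g.
by apply: (local_le _ (Hk g)); exact: leq_bigmax.
Qed.

Lemma good_compat lam c g : good lam c -> compat N (fd g) c.
Proof.
move=> H; have [k Hk] := good_local H g; exists k => w.
by apply: (local_laurent2 (fl g) (good_lin H) (fL g w) (good_laurent H w) Hk).
Qed.

Lemma good_vac : good (fun _ => 1) (@vacf K W).
Proof.
split.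
- move=> s x u v; rewrite /vacf /const_series; case: eqP => // _; by rewrite scaler0 addr0.
- by move=> w; exists 0 => s s0; rewrite /vacf /const_series; case: eqP => // ss; lia.
- by move=> g; exists 0%N; exact: vacf_local.
Qed.

Lemma good_prod lam c g n : good lam c ->
  good (fun h => qq Q h g * lam h) (prodg g c n).
Proof.
move=> H; have [l Pc] := prodfP (good_compat g H).
split=> [|w|h].
- exact: (products_lin N0 n (fl g) (good_lin H) Pc).
- exact: (products_laurent N0 n w Pc).
have [k Hk] := good_local H h; pose m := maxn l k.+1.
have lm : (l <= m)%N by exact: leq_maxl.
have km : (k <= m)%N by apply: leq_trans (leq_maxr _ _); exact: leqnSn.
have m1 : (1 <= m)%N by apply: leq_trans (leq_maxr _ _).
apply: (local_prod N0 (fl g) (fl h) (local_le m1 (fld_local_exp h g).1) (local_le km Hk)).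
exact: (products_le N0 lm Pc).
Qed.

(** These are the relations of the untwisted algebra, the mode m being the coefficient of
    x_0^(-m-1). Uniformity of the locality order over the finitely many generators gives the common
    order [k]. *)
Lemma prod_rel_good lam c g h m n : good lam c ->
  prodg g (prodg h c (- n - 1)) (- m - 1) =
  qq Q g h *: prodg h (prodg g c (- m - 1)) (- n - 1) +
  (if m + n + 1 == 0 then kap Q g h else 0) *: c.
Proof.
move=> Hc; apply/funext => w; apply/funext => s.
have [l1 P1] := prodfP (good_compat g Hc); have [l2 P2] := prodfP (good_compat h Hc).
have [l3 L] := good_local_uniform Hc; pose k := maxn l1 (maxn l2 l3).
have k1 : (l1 <= k)%N by exact: leq_maxl.
have k2 : (l2 <= k)%N by rewrite /k maxnCA leq_maxl.
have k3 : (l3 <= k)%N by rewrite /k !leq_max leqnn !orbT.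
have [e Pe e1] := fld_products g h.
have X := commutator_prod N0 (fl g) (fl h) (good_lin Hc) (fL g) (fL h) (good_laurent Hc)
  (fld_local_exp g h).1 (fld_local_exp h g).1 (local_le k3 (L g)) (local_le k3 (L h))
  (products_le N0 k1 P1) (products_le N0 k2 P2)
  (fun j => prodfP (good_compat g (good_prod h j Hc)))
  (fun j => prodfP (good_compat h (good_prod g j Hc))) Pe e1 (- m - 1) (- n - 1) w s.
rewrite [LHS]X; congr (_ + _).
rewrite (_ : (- m - 1 + (- n - 1) + 1 == 0) = (m + n + 1 == 0)); last by apply/eqP/eqP; lia.
by case: ifP => // _; rewrite scale0r.
Qed.

(** Charges differ from one summand to another, so a sum need not be [good]; [good_span_props] lists
    what survives in linear combinations. *)
Inductive good_span : field -> Prop :=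
| good_span0 : good_span 0
| good_spanD x lam c d : good lam c -> good_span d -> good_span (x *: c + d).

Lemma good_span_good lam c : good lam c -> good_span c.
Proof. by move=> H; rewrite -[c]scale1r -[X in good_span X]addr0; exact: good_spanD H good_span0. Qed.

Lemma good_span_lin x c d : good_span c -> good_span d -> good_span (x *: c + d).
Proof.
move=> Sc Sd; elim: Sc => [|y lam c' d' H _ IH]; first by rewrite scaler0 add0r.
by rewrite scalerDr scalerA -addrA; exact: good_spanD H IH.
Qed.

Let UD c d : good_span c -> good_span d -> good_span (c + d).
Proof. by move=> Sc Sd; rewrite -[c]scale1r; exact: good_span_lin. Qed.

Let UZ x c : good_span c -> good_span (x *: c).
Proof. by move=> Sc; rewrite -[_ *: _]addr0; apply: good_span_lin => //; exact: good_span0. Qed.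

Lemma good_span_props c : good_span c ->
  [/\ lin_field c, forall w, laurent (c w) & forall g, compat N (fd g) c].
Proof.
elim=> [|x lam d e H _ [el eL eC]].
  split=> [s y u v|w|g]; first by rewrite scaler0 addr0.
    by exists 0.
  by exists 0%N => w; exists 0 => s t _; exact: (linf0 (fl g s)).
have dl := good_lin H; split=> [s y u v|w|g].
- rewrite -[LHS]/(x *: d (y *: u + v) s + e (y *: u + v) s) dl el.
  rewrite -![(x *: d + e) _ s]/(x *: d _ s + e _ s) !scalerDr !scalerA [x * y]mulrC.
  by rewrite addrACA.
- have [s0 d0] := good_laurent H w; have [t0 e0] := eL w.
  exists (Num.min s0 t0) => s; rewrite lt_min => /andP[h1 h2].
  by rewrite -[LHS]/(x *: d w s + e w s) d0 // e0 // scaler0 addr0.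
- have [k Pd] := prodfP (good_compat g H); have [l Pe] := prodfP (eC g).
  by have [m Pm] := products_comb N0 x (fl g) Pd Pe; exact: products_compat Pm.
Qed.

Lemma prodg_lin g n x c d : good_span c -> good_span d ->
  prodg g (x *: c + d) n = x *: prodg g c n + prodg g d n.
Proof.
move=> /good_span_props[_ _ cC] /good_span_props[_ _ dC].
have [k Pc] := prodfP (cC g); have [l Pd] := prodfP (dC g).
by have [m Pm] := products_comb N0 x (fl g) Pc Pd; rewrite (prodfE N0 Pm).
Qed.

Lemma prodg0 g n : prodg g 0 n = 0.
Proof.
have := prodg_lin g n (-1) good_span0 good_span0.
by rewrite scaler0 addr0 scaleN1r addNr.
Qed.

Let gD g n c d : good_span c -> good_span d -> prodg g (c + d) n = prodg g c n + prodg g d n.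
Proof. by move=> Sc Sd; rewrite -[c in LHS]scale1r prodg_lin // scale1r. Qed.

Let gZ g n x c : good_span c -> prodg g (x *: c) n = x *: prodg g c n.
Proof.
by move=> Sc; rewrite -[_ *: _]addr0 prodg_lin ?prodg0 ?addr0 //; exact: good_span0.
Qed.

Let gU g n c : good_span c -> good_span (prodg g c n).
Proof.
elim=> [|x lam d e H Se IH]; first by rewrite prodg0; exact: good_span0.
rewrite prodg_lin //; last exact: (good_span_good H).
exact: good_spanD (good_prod g n H) IH.
Qed.

Lemma prod_rel c g h m n : good_span c ->
  prodg g (prodg h c (- n - 1)) (- m - 1) =
  qq Q g h *: prodg h (prodg g c (- m - 1)) (- n - 1) +
  (if m + n + 1 == 0 then kap Q g h else 0) *: c.
Proof.
elim=> [|x lam d e H Se IH]; first by rewrite !prodg0 !scaler0 addr0.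
have Sd := good_span_good H.
rewrite !prodg_lin //; try exact: gU.
rewrite IH (prod_rel_good g h m n H) !scalerDr !scalerA addrACA.
by rewrite [x * qq Q g h]mulrC [x * (if _ then _ else _)]mulrC.
Qed.

Definition gact (x : qgen r) (c : field) : field :=
  match x with
  | QX i m => prodg (true, i) c (- m - 1)
  | QY i m => prodg (false, i) c (- m - 1)
  end.

Let gactU x c : good_span c -> good_span (gact x c).
Proof. by case: x => i m; exact: gU. Qed.
Let gactD x c d : good_span c -> good_span d -> gact x (c + d) = gact x c + gact x d.
Proof. by case: x => i m; exact: gD. Qed.
Let gactZ x k c : good_span c -> gact x (k *: c) = k *: gact x c.
Proof. by case: x => i m; exact: gZ. Qed.

Let gact_rel t u c : qrel Q 0 t u -> good_span c -> tact gact t c = tact gact u c.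
Proof.
case=> i j m n Sc /=.
- by rewrite (prod_rel (true, i) (true, j)) // /kap /= if_same scale0r addr0.
- by rewrite (prod_rel (false, i) (false, j)) // /kap /= if_same scale0r addr0.
rewrite (prod_rel (true, i) (false, j)) // {1}/qq /= scaleNr addrAC subrr add0r.
by rewrite idxXY_eq0 /kap /=; case: (i == j); case: (_ == 0).
Qed.

Definition YW (v : VQ Q) : field := @pact K _ (qrel Q 0) _ gact (repr v) (@vacf K W).

Let Svac : good_span (@vacf K W) := good_span_good good_vac.

(** Independence of the representative: a mode n >= 0 of a generator acts on the identity field as
    the product of index -n - 1 < 0, which is 0, so the left ideal J_Q annihilates [vacf]. *)
Lemma YW_cls a : YW (lcls (@JQ_gen K r Q) a) = @pact K _ (qrel Q 0) _ gact a (@vacf K W).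
Proof.
set p := @pact _ _ _ _ gact.
have P x b c : p (x *: b + c) (@vacf K W) = x *: p b (@vacf K W) + p c (@vacf K W).
  exact: (pactP UD UZ gactU gactD gactZ gact_rel).
suff J b : left_ideal (@JQ_gen K r Q) b -> p b (@vacf K W) = 0.
  rewrite /YW; set b := repr _; have /lclsP/J : lcls (@JQ_gen K r Q) b = lcls (@JQ_gen K r Q) a.
    by rewrite /b lcls_repr.
  by rewrite addrC -scaleN1r P scaleN1r addrC => /eqP; rewrite subr_eq0 => /eqP.
elim=> {b} [|b Jb|b c _ Jb _ Jc|b c _ Jc].
- exact: (pact0 UD UZ gactU gactD gactZ gact_rel).
- have X g n w s : 0 <= n -> prodg g (@vacf K W) (- n - 1) w s = 0.
    move=> n0; rewrite (prodfE N0 (vacf_products N0 (fl g) (fL g))).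
    by rewrite (_ : - n - 1 = Negz (absz n)) ?scale0r //; lia.
  by case: Jb => i n n0; rewrite /p (pact_gen UD UZ gactU gactD gactZ gact_rel) //;
    apply/funext => w; apply/funext => s; exact: X.
- by rewrite -[b]scale1r P Jb Jc scaler0 addr0.
- rewrite /p (pactM UD UZ gactU gactD gactZ gact_rel) // [pact _ c _]Jc.
  have := pact_linear UD UZ gactU gactD gactZ b (-1) good_span0 good_span0.
  by rewrite scaler0 addr0 scaleN1r addNr.
Qed.

Lemma YW_span v : good_span (YW v).
Proof. exact: (pactU UD UZ gactU). Qed.

Lemma YW_lin x u v : YW (x *: u + v) = x *: YW u + YW v.
Proof.
elim/lquotP: u => a; elim/lquotP: v => b; rewrite -lclsZ -lclsD !YW_cls.
exact: (pactP UD UZ gactU gactD gactZ gact_rel).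
Qed.

Lemma YW_vac : YW (VQvac Q) = @vacf K W.
Proof. by rewrite YW_cls (pact1 UD UZ gactU gactD gactZ gact_rel). Qed.

Lemma YW_gen g m v : YW (VQact (gen Q 0 g m) v) = prodg g (YW v) (- m - 1).
Proof.
elim/lquotP: v => a; rewrite /VQact lactE !YW_cls (pactM UD UZ gactU gactD gactZ gact_rel) //.
have Sa := pactU UD UZ gactU a Svac.
by rewrite /gen; case: g => -[] i /=; rewrite (pact_gen UD UZ gactU gactD gactZ gact_rel).
Qed.

Lemma YW_gv g : YW (gv Q g) = fd g.
Proof.
have -> : gv Q g = VQact (gen Q 0 g (-1)) (VQvac Q) by rewrite /gv /gen; case: g.1.
rewrite YW_gen YW_vac (prodfE N0 (vacf_products N0 (fl g) (fL g))).
apply/funext => w; apply/funext => s.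
by rewrite (_ : - -1 - 1 = Posz 0) //= gbinom0 mulr0 addr0 scale1r.
Qed.

End Existence.

(** * Associativity and equivariance of Y_W *)

Section TwistedModule.
Variables (K : numFieldType) (r : nat) (Q : 'M[K]_r) (N : nat).
Hypothesis N0 : (0 < N)%N.
Hypothesis QQ : forall i j, Q i j * Q j i = 1.
Variables (W : lmodType K) (act : qalg Q N%:R^-1 -> W -> W).
Hypothesis act_mod : is_module act.
Hypothesis act_res : restricted act.
Variable Y : VQ Q -> VQ Q -> int -> VQ Q.
Hypothesis hY : is_nonlocal_va (VQvac Q) Y.
Hypothesis hX : forall i, Y (VQu Q i) = seriesX 1 (@VQact _ _ Q) i.
Hypothesis hV : forall i, Y (VQv Q i) = seriesY 1 (@VQact _ _ Q) i.
Variable z : K.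
Hypothesis zN : z ^+ N = 1.

Local Notation YWa := (YW act).
Local Notation fd := (fld act).

Let fl g : lin_field (fd g) := fld_lin N0 act_mod g.
Let fL g w : laurent (fd g w) := fld_laurent N0 act_res g w.
Let Yg := Y_gv hX hV.

Definition assoc u v := exists k, products N k (YWa u) (YWa v) (fun n => YWa (Y u v n)).

Lemma YW_props v : [/\ lin_field (YWa v), forall w, laurent (YWa v w) & forall g, compat N (fd g) (YWa v)].
Proof. exact: (good_span_props N0 act_mod act_res (YW_span N0 QQ act_mod act_res v)). Qed.

Lemma YW0 : YWa 0 = 0.
Proof.
have := YW_lin N0 QQ act_mod act_res (-1) 0 0.
by rewrite scaler0 addr0 scaleN1r addNr.
Qed.

Lemma YW_linear w s : linear (fun v => YWa v w s).
Proof. by move=> x u v; rewrite (YW_lin N0 QQ act_mod act_res). Qed.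

Lemma assoc_lin_r u x v v' : assoc u v -> assoc u v' -> assoc u (x *: v + v').
Proof.
move=> [k H] [l H']; have [ul _ _] := YW_props u.
have [m Hm] := products_comb N0 x ul H H'; exists m.
rewrite (YW_lin N0 QQ act_mod act_res); congr (products _ _ _ _ _): Hm.
by apply/funext => n; rewrite (nlva_linearr hY) (YW_lin N0 QQ act_mod act_res).
Qed.

Lemma assoc_lin_l x u u' v : assoc u v -> assoc u' v -> assoc (x *: u + u') v.
Proof.
move=> [k H] [l H']; exists (maxn k l) => w.
apply: (eq_qexp _ _ (qexp_comb x (qexp_le N0 (leq_maxl k l) (H w))
  (qexp_le N0 (leq_maxr k l) (H' w)))) => s t.
  by rewrite (YW_lin N0 QQ act_mod act_res).
by rewrite (nlva_linearl hY) (YW_lin N0 QQ act_mod act_res).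
Qed.

Lemma assoc_gv g v : assoc (gv Q g) v.
Proof.
have [_ _ vC] := YW_props v; have [k Hk] := prodfP (vC g).
exists k; rewrite YW_gv //; congr (products _ _ _ _ _): Hk; apply/funext => n.
by rewrite Yg YW_gen //; congr prodf; lia.
Qed.

Lemma assoc_vac v : assoc (VQvac Q) v.
Proof.
exists 0%N => w; rewrite YW_vac //; have [_ vL _] := YW_props v.
split; first exact: (laurent2_const N0 (vL w)).
move=> a b; rewrite subr0 (nlva_vacuum hY) [RHS](subst_const N).
by rewrite /const_series; case: eqP => // _; rewrite YW0.
Qed.

Lemma assoc_0l v : assoc 0 v.
Proof.
exists 0%N => w; apply: (eq_qexp _ _ (qexp0 N W)) => s t; first by rewrite YW0.
by rewrite (Y0 hY) YW0.
Qed.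

Lemma assoc_0r u : assoc u 0.
Proof.
exists 0%N => w; have [ul _ _] := YW_props u.
apply: (eq_qexp _ _ (qexp0 N W)) => s t; first by rewrite YW0 (linf0 (ul s)).
by rewrite (Yv0 hY) YW0.
Qed.

Let goodv v := exists lam, good act lam (YWa v).

Let goodv_gen g m v : goodv v -> goodv (VQact (gen Q 0 g m) v).
Proof.
move=> [lam H]; exists (fun h => qq Q h g * lam h).
by rewrite YW_gen //; exact: good_prod.
Qed.

Let goodv_vac : goodv (VQvac Q).
Proof. by exists (fun _ => 1); rewrite YW_vac //; exact: good_vac. Qed.

(** The vector v is first reduced to monomials: [assoc_prod] needs the generating field to be
    q-local with the fields of both u and v, which calls for charges. All orders are then raised to
    a common [k]. *)
Lemma assoc_step g m u : goodv u -> (forall v, assoc u v) ->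
  forall v, assoc (VQact (gen Q 0 g m) u) v.
Proof.
move=> [lu Hu] Au.
apply: (@VQ_span _ _ _ goodv) => //; last first.
- by move=> c v v'; exact: assoc_lin_r.
- exact: assoc_0r.
move=> v [lv Hv].
have [k1 Pe] := prodfP (good_compat N0 act_mod act_res g Hu).
have [k2 Puv] := Au v.
have [k3 Lu] := good_local_uniform Hu; have [k4 Lv] := good_local_uniform Hv.
pose k := maxn (maxn k1 k2) (maxn k3 k4).
have k1k : (k1 <= k)%N by rewrite /k !leq_max leqnn.
have k2k : (k2 <= k)%N by rewrite /k !leq_max leqnn orbT.
have k3k : (k3 <= k)%N by rewrite /k !leq_max leqnn !orbT.
have k4k : (k4 <= k)%N by rewrite /k !leq_max leqnn !orbT.
have [ul _ _] := YW_props u; have [vl _ _] := YW_props v.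
have [j0 Yj0] := nlva_laurent hY u v.
have [m0 Ym0] := nlva_laurent hY (gv Q g) u.
have [l Hl] := nlva_assoc hY (gv Q g) u v.
have Ee : prodf N (fd g) (YWa u) = fun n => YWa (Y (gv Q g) u n).
  by apply/funext => n; rewrite Yg YW_gen //; congr prodf; lia.
rewrite Ee in Pe.
have := @assoc_prod _ N N0 W (fd g) (YWa u) (YWa v) (fun n => YWa (Y (gv Q g) u n))
  (fun n => YWa (Y u v n)) (fun n i => YWa (Y (gv Q g) (Y u v n) i))
  (fun m n => YWa (Y (Y (gv Q g) u m) v n)) k (lu g) (lv g) j0 m0 l (fl g) ul vl (fL g)
  (local_le k3k (Lu g)) (local_le k4k (Lv g)) (products_le N0 k1k Pe) (products_le N0 k2k Puv).
have -> : VQact (gen Q 0 g m) u = Y (gv Q g) u (- m - 1).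
  by rewrite Yg; congr (VQact (gen _ _ _ _) _); lia.
apply.
- by move=> n; have [k' Hk] := assoc_gv g (Y u v n); exists k'; rewrite -(YW_gv N0 QQ act_mod act_res).
- by move=> n i w s nj; rewrite Yj0 // (Yv0 hY) YW0.
- by move=> n w s nm; rewrite Ym0 // YW0.
- by move=> n i w s nm; rewrite Ym0 // (Y0 hY) YW0.
move=> w s i j; have := congr1 (fun x => YWa x w s) (Hl i j).
rewrite !(mul_binom_lin _ _ _ (YW_linear w s)).
move=> <-; congr (mul_binom _ _ _ _ _ _); apply/funext => i'; apply/funext => j'.
rewrite (subst_x0Dx2_lin (YW_linear w s) (j0 := j0)) //.
by move=> i1 j1 h; rewrite Yj0 // (Yv0 hY).
Qed.

Lemma assoc_all u v : assoc u v.
Proof.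
move: u v; apply: (@VQ_span _ _ _ (fun u => goodv u /\ forall v, assoc u v)).
- by split=> //; exact: assoc_vac.
- by move=> g m u [Hu Au]; split; [exact: goodv_gen|exact: assoc_step].
- by move=> u [].
- exact: assoc_0l.
- by move=> c u u' H H' v; exact: assoc_lin_l.
Qed.

Lemma z_neq0 : z != 0.
Proof.
by apply/eqP => z0; move: zN; rewrite z0 expr0n eqn0Ngt N0 => /esym/eqP; rewrite oner_eq0.
Qed.

Lemma z_dvd (q : int) : z ^ (N%:Z * q) = 1.
Proof. by rewrite -exprz_exp -exprnP zN exp1rz. Qed.

Lemma fld_scale g w s : fd g w s = (z ^ (s + sg g)) *: fd g w s.
Proof.
have [/dvdzP[q ->]|h] := boolP (N%:Z %| s + sg g)%Z; last by rewrite (fld0 N0 act w h) scaler0.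
by rewrite mulrC z_dvd scale1r.
Qed.

Lemma VQscale_gen g m v : VQscale z (VQact (gen Q 0 g m) v) = z ^ sg g *: VQact (gen Q 0 g m) (VQscale z v).
Proof.
have z0 := z_neq0; rewrite VQscale_act //.
have -> : qscale z (gen Q 0 g m) = z ^ sg g *: gen Q 0 g m.
  by rewrite /gen /sg; case: g => -[] i /=; rewrite ?qscaleX ?qscaleY.
exact: VQactZ.
Qed.

(** For the product of a generating field with the field of v, the series twisted by the character
    z^-(s + t) has two expansions, [H1] and [H2], which agree by [qexp_uniq]. *)
Lemma YW_scale v w s : YWa (VQscale z v) w s = z^-1 ^ s *: YWa v w s.
Proof.
have z0 := z_neq0.
pose P v := forall w s, YWa (VQscale z v) w s = z^-1 ^ s *: YWa v w s.
suff : P v by exact.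
move: v; apply: (@VQ_span _ _ _ P) => //.
- move=> w' s'; rewrite VQscale_vac // YW_vac // /vacf /const_series.
  by case: eqP => [->|_]; rewrite ?scaler0 // expr0z scale1r.
- move=> g m v Pv w' s'.
  have [_ _ vC] := YW_props v; have [k Hk] := prodfP (vC g).
  have [_ _ vC'] := YW_props (VQscale z v); have [k' Hk'] := prodfP (vC' g).
  rewrite VQscale_gen -[_ *: VQact _ _]addr0 (YW_lin N0 QQ act_mod act_res) YW0 addr0.
  rewrite -[LHS]/(z ^ sg g *: YWa _ w' s') !YW_gen //; set n := - m - 1.
  (* Multiplication by x_1 - x_2 and the substitution both change the total exponent s + t by
     multiples of N only, so the character passes through since z^N = 1. *)
  have H1 : qexp N k (fun s t => z^-1 ^ (s + t) *: fd g (YWa v w' t) s)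
      (fun n s => z^-1 ^ s *: prodf N (fd g) (YWa v) n w' s).
    case: (Hk w') => L E.
    have X : mul_binom N (-1) k (fun s t => z^-1 ^ (s + t) *: fd g (YWa v w' t) s) =
        fun s t => z^-1 ^ (s + t) *: mul_binom N (-1) k (fun s t => fd g (YWa v w' t) s) s t.
      apply/funext => s1; apply/funext => t1; symmetry.
      have zNN x : z^-1 ^ (x - N%:Z) = z^-1 ^ x.
        by rewrite expfzDr ?invr_neq0 // [X in _ * X]exprz_inv opprK -exprnP zN mulr1.
      apply: (@mul_binom_additive _ _ _ (-1) N k (fun s t => *:%R (z^-1 ^ (s + t)))).
      + by move=> a b; rewrite addrAC zNN.
      + by move=> a b; rewrite addrA zNN.
      + by move=> a b c x y; rewrite scalerDr !scalerA mulrC.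
    split; rewrite X.
      by case: L => c Lc; exists c => s1 t1 st; rewrite Lc ?scaler0.
    move=> a b; rewrite E !substE -tsumZ; last exact: finsup_diag.
    apply: eq_tsum => u; rewrite !scalerA mulrC; congr (_ * _ *: _).
    rewrite [u + _]addrC subrK expfzDr ?invr_neq0 //.
    by rewrite [X in _ * X]exprz_inv -mulrN z_dvd mulr1.
  (* The support of the generating field turns z^-s into z^(sg g), and the induction hypothesis
     absorbs z^-t into [VQscale z v]. *)
  have H2 : qexp N k' (fun s t => z^-1 ^ (s + t) *: fd g (YWa v w' t) s)
      (fun n s => z ^ sg g *: prodf N (fd g) (YWa (VQscale z v)) n w' s).
    have := qexp_comb (z ^ sg g) (Hk' w') (qexp_le N0 (leq0n k') (qexp0 N W)).
    apply: eq_qexp => s1 t1; rewrite addr0 // (Pv w') (linfZ (fl g s1)).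
    rewrite [in RHS]fld_scale !scalerA; congr (_ *: _).
    by rewrite !exprz_inv -!expfzDr //; congr (_ ^ _); lia.
  exact: (qexp_uniq N0 H2 H1).
- by move=> w' s'; rewrite (linf0 (VQscale_linear (z := z) z0)) YW0 scaler0.
- move=> c u u' Pu Pu' w' s'.
  rewrite (VQscale_linear z0) !(YW_linear w' s') Pu Pu' scalerDr !scalerA.
  by rewrite [c * _]mulrC.
Qed.

End TwistedModule.

(** * The restricted module of a twisted module *)

Section TwistedModules.
Variables (K : numFieldType) (r : nat) (Q : 'M[K]_r) (N : nat).
Hypothesis N0 : (0 < N)%N.
Hypothesis QQ : forall i j, Q i j * Q j i = 1.
Variable Y : VQ Q -> VQ Q -> int -> VQ Q.
Hypothesis hY : is_nonlocal_va (VQvac Q) Y.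
Hypothesis hX : forall i, Y (VQu Q i) = seriesX 1 (@VQact _ _ Q) i.
Hypothesis hV : forall i, Y (VQv Q i) = seriesY 1 (@VQact _ _ Q) i.
Variables (z : K) (W : lmodType K).

Local Notation twisted := (is_twisted_module N z (VQvac Q) Y (VQscale z)).

Lemma YW_twisted (act : qalg Q N%:R^-1 -> W -> W) : z ^+ N = 1 ->
  is_module act -> restricted act -> twisted (YW act).
Proof.
move=> zN am ar; split.
- by move=> w s; exact: YW_linear.
- by move=> v; case: (YW_props N0 QQ am ar v).
- by move=> v; case: (YW_props N0 QQ am ar v).
- by move=> w; rewrite YW_vac.
- by move=> v w s; exact: YW_scale.
- move=> u v; have [k Hk] := assoc_all N0 QQ am ar hY hX hV u v.
  by exists k; split=> [w|w a b]; case: (Hk w).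
Qed.

Lemma tw_products (Z : VQ Q -> W -> int -> W) u v : twisted Z ->
  exists k, products N k (Z u) (Z v) (fun n => Z (Y u v n)).
Proof. by move=> hZ; have [k [L E]] := tw_assoc hZ u v; exists k => w; split. Qed.

(** Associativity exhibits the field of a_m v as a product of the fields of a and v, and products
    are unique; so agreement spreads from the generators to all monomials. *)
Lemma twisted_uniq (Z Z' : VQ Q -> W -> int -> W) : twisted Z -> twisted Z' ->
  (forall g, Z (gv Q g) = Z' (gv Q g)) -> Z = Z'.
Proof.
move=> hZ hZ' ZZ'; apply/funext; apply: (@VQ_span _ _ _ (fun v => Z v = Z' v)) => //.
- apply/funext => w; by rewrite (tw_vacuum hZ) (tw_vacuum hZ').
- move=> g m v E.
  have -> : VQact (gen Q 0 g m) v = Y (gv Q g) v (- m - 1).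
    by rewrite (Y_gv hX hV); congr (VQact (gen _ _ _ _) _); lia.
  have [k Hk] := tw_products (gv Q g) v hZ; have [l Hl] := tw_products (gv Q g) v hZ'.
  rewrite -ZZ' -E in Hl.
  by have := products_uniq N0 Hk Hl => /(congr1 (fun f => f (- m - 1))).
- apply/funext => w; apply/funext => s.
  by rewrite (linf0 (tw_linearl hZ w s)) (linf0 (tw_linearl hZ' w s)).
- move=> c u v Eu Ev; apply/funext => w; apply/funext => s.
  by rewrite (tw_linearl hZ w s) (tw_linearl hZ' w s) Eu Ev.
Qed.

Section Restricted.
Hypothesis z0 : z != 0.
Hypothesis zprim : forall q : int, z ^ q = 1 -> (N%:Z %| q)%Z.
Variable Z : VQ Q -> W -> int -> W.
Hypothesis hZ : twisted Z.
Local Notation a g := (Z (gv Q g)).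
Local Notation mulZ := (mul_binom N (-1)).
Local Notation subst := (subst_x2Dx0 N).

Let al v : lin_field (Z v) := tw_linearr hZ v.
Let aL v w : laurent (Z v w) := tw_laurent hZ v w.

Lemma VQscale_gv g : VQscale z (gv Q g) = z ^ sg g *: gv Q g.
Proof. by rewrite /gv /sg; case: g.1; rewrite ?VQscale_u ?VQscale_v. Qed.

(** A nonzero coefficient forces z^(sg g) = z^-s; primitivity of z enters here. *)
Lemma tw_supp g w s : ~~ (N%:Z %| s + sg g)%Z -> a g w s = 0.
Proof.
move=> sg0; have := tw_sigma hZ (gv Q g) w s.
rewrite VQscale_gv (linfZ (tw_linearl hZ w s)) => E.
apply/eqP/contraT => a0; case/negP: sg0; apply: zprim.
have : (z ^ sg g - z^-1 ^ s) *: a g w s == 0 by rewrite scalerBl E subrr.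
rewrite scaler_eq0 (negPf a0) orbF subr_eq0 exprz_inv => /eqP E1.
by rewrite expfzDr // E1 -expfzDr // subrr expr0z.
Qed.

Lemma Zvac : Z (VQvac Q) = @vacf K W.
Proof. by apply/funext => w; rewrite (tw_vacuum hZ). Qed.

Let R g h (i j : int) := Y (gv Q g) (Y (gv Q h) (VQvac Q) j) i.

(** Since F does not involve x_3, setting y = 0 merely renames x_2 as x_3. *)
Lemma subst2_delta (f : int -> int -> W) (F : int -> int -> int -> W) i b :
  (forall s1 s2 s3, F s1 s2 s3 = if s3 == 0 then f s1 s2 else 0) ->
  subst2 N F i 0 b = subst f i b.
Proof.
move=> FE; rewrite /subst2; congr subst_x2Dx0; apply/funext => s1; apply/funext => s3.
rewrite substE (tsum1 (t := s3)).
  by rewrite /= gbinom0 scale1r mulr0 addr0 subrr FE eqxx.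
move=> s ss; rewrite FE mulr0 addr0; case: eqP; rewrite ?scaler0 // => /subr0_eq E.
by rewrite E eqxx in ss.
Qed.

Lemma mul12_vac g h k w s1 s2 s3 :
  mul12 N k (triple (a g) (a h) (@vacf K W) w) s1 s2 s3 =
  if s3 == 0 then mulZ k (fun s t => a g (a h w t) s) s1 s2 else 0.
Proof.
rewrite /mul12 /triple /vacf /const_series; case: eqP => // _.
rewrite -[RHS](mul_binom0 W (-1) N k s1 s2); congr (mul_binom _ _ _ _ _ _).
by apply/funext => t1; apply/funext => t2; rewrite (linf0 (al _ _)) (linf0 (al _ _)).
Qed.

Lemma laurent3_vac g h k w : laurent2 (mulZ k (fun s t => a g (a h w t) s)) ->
  laurent3 (mul12 N k (triple (a g) (a h) (@vacf K W) w)).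
Proof.
case=> s0 L0; exists (Num.min 0 s0) => s1 s2 s3; rewrite !lt_min mul12_vac => st.
by case: eqP => // s30; apply: L0; lia.
Qed.

(** Placing the vacuum at x_3 makes the vectors g_i h_j 1 of V_Q appear as coefficients, so that the
    relations of A_Q can be used. No factors x_1 - x_3, x_2 - x_3 are cleared: once (x_1 - x_2)^k
    is, the triple product is bounded below. *)
Lemma tw_triple g h k w i j b : laurent2 (mulZ k (fun s t => a g (a h w t) s)) ->
  subst2 N (mul12 N k (triple (a g) (a h) (@vacf K W) w)) i j b =
  mul_binom 1 (-1) k (fun i j => Z (R g h i j) w b) i j.
Proof.
move=> L; have L3 := laurent3_vac L.
have P0 : products N 0 (a h) (@vacf K W) (fun n => Z (Y (gv Q h) (VQvac Q) n)).
  have [l Hl] := tw_products (gv Q h) (VQvac Q) hZ; rewrite Zvac in Hl.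
  by have := vacf_products N0 (al (gv Q h)) (aL (gv Q h)) => H; rewrite (products_uniq N0 Hl H).
have [S1 HD] := products_slice1 w (al (gv Q g)) P0.
have H n : exists l, qexp N l (fun s1 s3 => a g (Z (Y (gv Q h) (VQvac Q) n) w s3) s1)
    (fun i b => Z (R g h i n) w b).
  by have [l Hl] := tw_products (gv Q g) (Y (gv Q h) (VQvac Q) n) hZ; exists l; exact: Hl.
rewrite [LHS](@subst2_triple _ N N0 W (triple (a g) (a h) (@vacf K W) w)
  (fun n s1 s3 => a g (Z (Y (gv Q h) (VQvac Q) n) w s3) s1)
  (fun n i b => Z (R g h i n) w b) k 0 0 i j b S1 HD H L3).
by congr mul_binom; apply/funext => i1; apply/funext => j1; rewrite !subr0.
Qed.

Lemma R_rel g h i j : R g h i j =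
  qq Q g h *: R h g j i + (if i + j + 1 == 0 then kap Q g h else 0) *: VQvac Q.
Proof.
rewrite /R !(Y_gv hX hV) -!VQactM gen_rel // VQactP VQactZ VQact1.
congr (_ + _ *: _).
by rewrite (_ : (- i - 1 + (- j - 1) + 1 == 0) = (i + j + 1 == 0)) //; apply/eqP/eqP; lia.
Qed.

(** By [subst_inj] it is enough to compare expansions. By [R_rel] these differ by a term that
    depends on i + j only, which a single factor t - y kills: hence the successor in the choice of
    [k]. *)
Lemma tw_local g h : exists k, [/\ local N k (qq Q g h) (a g) (a h) &
  products N k (a g) (a h) (fun n => Z (Y (gv Q g) (gv Q h) n))].
Proof.
have [k1 H1] := tw_products (gv Q g) (gv Q h) hZ.
have [k2 H2] := tw_products (gv Q h) (gv Q g) hZ.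
pose k := (maxn k1 k2).+1; exists k.
have k1k : (k1 <= k)%N by rewrite /k ltnW // ltnS leq_maxl.
have k2k : (k2 <= k)%N by rewrite /k ltnW // ltnS leq_maxr.
split; last exact: (products_le N0 k1k H1).
move=> w; have [Lgh _] := qexp_le N0 k1k (H1 w); have [Lhg _] := qexp_le N0 k2k (H2 w).
have Lhg' : laurent2 (mulZ k (fun s t => a h (a g w s) t)).
  case: Lhg => s0 L0; exists s0 => s t st; rewrite mul_binom_antisym.
  by rewrite (L0 t s) ?scaler0 // orbC.
move=> s t; apply/eqP; rewrite -subr_eq0 -scaleNr addrC; apply/eqP.
pose D s t := (- qq Q g h) *: mulZ k (fun s t => a h (a g w s) t) s t +
  mulZ k (fun s t => a g (a h w t) s) s t.
rewrite -/(D s t); apply: (subst_inj N0) => {s t} [|i b].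
  exact: laurent2_comb.
rewrite subst_comb // scaleNr addrC; apply/eqP; rewrite subr_eq0; apply/eqP.
rewrite -(subst2_delta i b (mul12_vac g h k w)) tw_triple //.
pose F' := mul12 N k (triple (a h) (a g) (@vacf K W) w).
have LF' : laurent3 F' by exact: laurent3_vac.
have Ls : laurent2 (fun s t => mulZ k (fun s t => a h (a g w t) s) t s).
  by case: Lhg => s0 L0; exists s0 => s t st; rewrite L0 // orbC.
have -> : subst (mulZ k (fun s t => a h (a g w s) t)) i b = (-1) ^+ k *: subst2 N F' 0 i b.
  rewrite -(subst2_swap N 0 i b LF') (subst2_delta (F := swap12 F') i b (fun s1 s2 s3 => mul12_vac h g k w s2 s1 s3)).
  rewrite -substZ //; congr subst_x2Dx0; apply/funext => s1; apply/funext => s2.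
  exact: mul_binom_antisym.
rewrite (@tw_triple h g k w 0 i b) //.
rewrite -(mul_binom_antisym 1 k (fun i j => Z (R h g i j) w b)).
pose dl (i j : int) := Z ((if i + j + 1 == 0 then kap Q g h else 0) *: VQvac Q) w b.
have -> : (fun i j => Z (R g h i j) w b) = fun i j => qq Q g h *: Z (R h g j i) w b + dl i j.
  apply/funext => i1; apply/funext => j1; rewrite R_rel.
  exact: (tw_linearl hZ w b).
rewrite mul_binom_comb -[RHS]addr0; congr (_ + _).
rewrite mul_binomSr -[RHS](mul_binom0 W (-1) 1 (maxn k1 k2) i 0).
congr (mul_binom _ _ _ _ _ _); apply/funext => i1; apply/funext => j1.
rewrite mul_binomS /= /dl (_ : i1 - 1 + j1 = i1 + (j1 - 1)) ?scaleN1r ?subrr //; lia.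
Qed.

(** The pole of the two fields is read off in V_Q: nonnegative modes kill the vacuum, so [R_rel]
    leaves at most a simple pole, whose coefficient is [kap Q g h] times the vacuum. *)
Lemma tw_commutator g h w s t :
  a g (a h w t) s = qq Q g h *: a h (a g w s) t +
    (if (N%:Z %| s + sg g)%Z then const_series (kap Q g h *: w) (s + t + N%:Z) else 0).
Proof.
have [k [L P]] := tw_local g h.
have Yn (n : int) : Y (gv Q g) (gv Q h) n = R g h n 0.
  by rewrite /R [Y (gv Q h) _ _](Y_gv hX hV) /gv /gen; case: h.1.
have Y0n n : n < -1 -> Y (gv Q g) (gv Q h) n = 0.
  move=> n1; rewrite Yn R_rel addr0 (_ : (n + 1 == 0) = false); last by apply/eqP; lia.
  rewrite scale0r addr0 /R [Y (gv Q g) (VQvac Q) n](Y_gv hX hV) VQact_vac; last by lia.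
  by rewrite (Yv0 hY) scaler0.
have Y1 : Y (gv Q g) (gv Q h) (-1) = kap Q g h *: VQvac Q.
  rewrite Yn R_rel addr0 addNr eqxx /R [Y (gv Q g) (VQvac Q) _](Y_gv hX hV) VQact_vac //.
  by rewrite (Yv0 hY) scaler0 add0r.
have [s0 g0] := aL (gv Q g) w; have [t0 h0] := aL (gv Q h) w.
have H := @commutator_formula _ N N0 W k (fun s t => a g (a h w t) s)
  (fun s t => qq Q g h *: a h (a g w s) t) _ (- sg g) s0 t0 _ _ _ _ _ (P w).
rewrite [LHS]H; last first.
- by move=> n b n1; rewrite Y0n // (linf0 (tw_linearl hZ w b)).
- by move=> s1 t1; rewrite L mul_binomZ1.
- by move=> s1 t1; rewrite opprK => ss; rewrite (tw_supp _ ss) (linf0 (al _ _)) scaler0.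
- by move=> s1 t1; rewrite opprK => ss; rewrite (tw_supp _ ss).
- by move=> s1 t1 ss; rewrite g0 // (linf0 (al _ _)) scaler0.
- by move=> s1 t1 tt; rewrite h0 // (linf0 (al _ _)).
rewrite opprK Y1 (linfZ (tw_linearl hZ w _)) (tw_vacuum hZ) /const_series.
by congr (_ + _); case: ifP => // _; case: eqP; rewrite ?scaler0.
Qed.

End Restricted.
End TwistedModules.

(** * The action of the twisted algebra on a twisted module *)

Section RestrictedModule.
Variables (K : numFieldType) (r : nat) (Q : 'M[K]_r) (N : nat).
Hypothesis N0 : (0 < N)%N.
Hypothesis QQ : forall i j, Q i j * Q j i = 1.
Variable Y : VQ Q -> VQ Q -> int -> VQ Q.
Hypothesis hY : is_nonlocal_va (VQvac Q) Y.
Hypothesis hX : forall i, Y (VQu Q i) = seriesX 1 (@VQact _ _ Q) i.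
Hypothesis hV : forall i, Y (VQv Q i) = seriesY 1 (@VQact _ _ Q) i.
Variables (z : K) (W : lmodType K).
Hypothesis z0 : z != 0.
Hypothesis zprim : forall q : int, z ^ q = 1 -> (N%:Z %| q)%Z.
Variable Z : VQ Q -> W -> int -> W.
Hypothesis hZ : is_twisted_module N z (VQvac Q) Y (VQscale z) Z.
Local Notation a g := (Z (gv Q g)).

Definition tw_gact (x : qgen r) (w : W) : W :=
  match x with
  | QX i m => a (true, i) w (expo N (true, i) m)
  | QY i m => a (false, i) w (expo N (false, i) m)
  end.

Lemma tw_commutator_expo g h m n w :
  a g (a h w (expo N h n)) (expo N g m) = qq Q g h *: a h (a g w (expo N g m)) (expo N h n) +
    (if m + n + 1 == 0 then kap Q g h else 0) *: w.
Proof.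
rewrite (tw_commutator N0 QQ hY hX hV z0 zprim hZ) expo_dvd const_series_expo //.
by case: ifP => // _; rewrite scale0r.
Qed.

Let U (w : W) := True.
Let UD (c d : W) : U c -> U d -> U (c + d). Proof. by []. Qed.
Let UZ (k : K) (c : W) : U c -> U (k *: c). Proof. by []. Qed.
Let gactU x c : U c -> U (tw_gact x c). Proof. by []. Qed.
Let gactD x c d : U c -> U d -> tw_gact x (c + d) = tw_gact x c + tw_gact x d.
Proof. by case: x => i m _ _; exact: (linfD (tw_linearr hZ _ _)). Qed.
Let gactZ x k c : U c -> tw_gact x (k *: c) = k *: tw_gact x c.
Proof. by case: x => i m _; exact: (linfZ (tw_linearr hZ _ _)). Qed.

Let gact_rel t u c : qrel Q N%:R^-1 t u -> U c -> tact tw_gact t c = tact tw_gact u c.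
Proof.
case=> i j m n _ /=.
- by rewrite tw_commutator_expo /kap /= if_same scale0r addr0.
- by rewrite tw_commutator_expo /kap /= if_same scale0r addr0.
rewrite tw_commutator_expo {1}/qq /= scaleNr addrAC subrr add0r.
by rewrite idxXY_eq0 /kap /=; case: (i == j); case: (_ == 0).
Qed.

Definition tw_act : qalg Q N%:R^-1 -> W -> W := @pact K _ (qrel Q N%:R^-1) W tw_gact.

Lemma tw_act_module : is_module tw_act.
Proof.
split=> [w c x y|x c u v|w|x y w].
- exact: (pactP UD UZ gactU gactD gactZ gact_rel).
- exact: (pact_linear UD UZ gactU gactD gactZ).
- exact: (pact1 UD UZ gactU gactD gactZ gact_rel).
- exact: (pactM UD UZ gactU gactD gactZ gact_rel).
Qed.

Lemma tw_act_gen g m w : tw_act (gen Q N%:R^-1 g m) w = a g w (expo N g m).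
Proof.
by rewrite /gen; case: g => -[] i /=; rewrite [LHS](pact_gen UD UZ gactU gactD gactZ gact_rel).
Qed.

Lemma fld_tw_act g : fld tw_act g = a g.
Proof.
apply/funext => w; apply/funext => s.
have [/(expo_cls N0)[m ->]|h] := boolP (N%:Z %| s + sg g)%Z; first by rewrite fldE // tw_act_gen.
by rewrite (fld0 N0 tw_act w h) (tw_supp z0 zprim hZ _ h).
Qed.

Lemma tw_act_restricted : restricted tw_act.
Proof.
have N1 : (N%:R : rat)^-1 <= 1 by rewrite invf_le1 ?ltr0n // ler1n.
have N2 : 0 <= (N%:R : rat)^-1 by rewrite invr_ge0 ler0n.
have van g w s0 m : (forall s, s < s0 -> a g w s = 0) -> `|s0| + 1 <= m ->
    tw_act (gen Q N%:R^-1 g m) w = 0.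
  move=> H sm; rewrite tw_act_gen H //.
  have : N%:Z * (`|s0| + 2) <= N%:Z * (m + 1) by rewrite ler_wpM2l //; lia.
  have : `|s0| + 2 <= N%:Z * (`|s0| + 2) by rewrite ler_peMl //; lia.
  by rewrite /expo /sg; case: g.1; lia.
move=> w i; have [s0 Hs] := tw_laurent hZ (gv Q (true, i)) w.
have [t0 Ht] := tw_laurent hZ (gv Q (false, i)) w.
(* One unit of the 2 pays for the offset 1/N of the index; the other gives m the margin over the
   absolute bound that [van] requires. *)
exists ((`|s0| + `|t0| + 2)%:~R); split=> m.
  rewrite /idxX => sm; apply: (van (true, i) w s0 m Hs).
  have : (`|s0| + `|t0| + 2)%:~R <= (m + 1)%:~R :> rat.
    by apply: le_trans sm _; rewrite rmorphD /= addrC lerD2l.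
  by rewrite ler_int; lia.
rewrite /idxY => sm; apply: (van (false, i) w t0 m Ht).
have : (`|s0| + `|t0| + 2)%:~R <= m%:~R :> rat.
  by apply: le_trans sm _; rewrite addrC gerBl.
by rewrite ler_int; lia.
Qed.

End RestrictedModule.

(** * Primitivity of omega_N *)

Section Omega.
Variables (R : realType) (N : nat).
Hypothesis N0 : (0 < N)%N.

Lemma omegaE k : omega R N ^+ k =
  (cos (2 * pi / N%:R *+ k) +i* sin (2 * pi / N%:R *+ k))%C.
Proof.
elim: k => [|k IH]; first by rewrite expr0 !mulr0n cos0 sin0.
rewrite exprS IH (mulrS (2 * pi / N%:R)) cosD sinD /omega; simpc.
by congr (_ +i* _)%C; rewrite addrC.
Qed.

(** For 0 < k < N the half angle x = pi k / N lies strictly between 0 and pi, so sin x > 0, whereas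
    cos (2x) = 1 forces sin x = 0. *)
Lemma omega_prim_nat k : (k < N)%N -> omega R N ^+ k = 1 -> k = 0%N.
Proof.
move=> kN; rewrite omegaE => -[c1 _].
apply/eqP; rewrite -leqn0 leqNgt; apply/negP => k0.
pose x : R := pi / N%:R *+ k.
have NR : 0 < N%:R :> R by rewrite ltr0n.
have x2 : 2 * pi / N%:R *+ k = x *+ 2 by rewrite /x -mulrA -mulrnAr mulr_natl.
have sx : 0 < sin x.
  apply: sin_gt0_pi; rewrite /x -mulr_natr mulr_gt0 ?divr_gt0 ?pi_gt0 ?ltr0n //=.
  by rewrite mulrAC ltr_pdivrMr // ltr_pM2l ?pi_gt0 // ltr_nat.
move: c1; rewrite x2 cos_mulr2n cos2sin2 => c1.
have : sin x ^+ 2 = 0 by lra.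
by move/eqP; rewrite expf_eq0 /= gt_eqF.
Qed.

Lemma omega_prim (q : int) : omega R N ^ q = 1 -> (N%:Z %| q)%Z.
Proof.
move=> wq; have w0 := omega_neq0 R N0.
have E : q = (q %/ N%:Z)%Z * N%:Z + (q %% N%:Z)%Z by exact: divz_eq.
have m0 : 0 <= (q %% N%:Z)%Z by rewrite modz_ge0 // -[_ == _]/(N == 0%N) -lt0n.
have mN : (q %% N%:Z)%Z < N%:Z by rewrite ltz_pmod.
move: wq; rewrite {1}E expfzDr // [_ * N%:Z]mulrC -exprz_exp -exprnP omegaX // exp1rz mul1r.
move=> {E}; case Ek: (q %% N%:Z)%Z m0 mN => [k|k] // _ kN wk.
by apply/dvdz_mod0P; rewrite Ek (omega_prim_nat _ wk).
Qed.

End Omega.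

Theorem theorem4p2 (R : realType) (N r : nat) (Q : 'M[R[i]]_r)
    (Y : VQ Q -> VQ Q -> int -> VQ Q) :
  (0 < N)%N -> (0 < r)%N ->
  (forall i j, Q i j * Q j i = 1) ->
  (* Y is the vertex algebra structure of V_Q *)
  is_nonlocal_va (VQvac Q) Y ->
  (forall i, Y (VQu Q i) = seriesX 1 (@VQact _ _ Q) i) ->
  (forall i, Y (VQv Q i) = seriesY 1 (@VQact _ _ Q) i) ->
  (forall (W : lmodType R[i]) (act : qalg Q (N%:R^-1) -> W -> W),
     is_module act -> restricted act ->
     exists! YW : VQ Q -> W -> int -> W,
       [/\ is_twisted_module N (omega R N) (VQvac Q) Y (@theta R N r Q) YW,
           forall i, YW (VQu Q i) = seriesX N act i
         & forall i, YW (VQv Q i) = seriesY N act i]) /\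
  (forall (W : lmodType R[i]) (YW : VQ Q -> W -> int -> W),
     is_twisted_module N (omega R N) (VQvac Q) Y (@theta R N r Q) YW ->
     exists act : qalg Q (N%:R^-1) -> W -> W,
       [/\ is_module act, restricted act,
           forall i, seriesX N act i = YW (VQu Q i)
         & forall i, seriesY N act i = YW (VQv Q i)]).
Proof.
move=> N0 _ QQ hY hX hV; split=> [W act am ar|W Z hZ].
  exists (YW act); split.
    split; first exact: (YW_twisted N0 QQ hY hX hV (omegaX R N0) am ar).
      by move=> i; exact: (YW_gv N0 QQ am ar (true, i)).
    by move=> i; exact: (YW_gv N0 QQ am ar (false, i)).
  move=> Z [hZ ZX ZY].
  apply: (twisted_uniq N0 hX hV (YW_twisted N0 QQ hY hX hV (omegaX R N0) am ar) hZ).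
  by move=> g; rewrite (YW_gv N0 QQ am ar); case: g => -[] i; rewrite /gv /= ?ZX ?ZY.
have w0 := omega_neq0 R N0; have wp := @omega_prim R N N0.
exists (tw_act Z); split.
- exact: (tw_act_module N0 QQ hY hX hV w0 wp hZ).
- exact: (tw_act_restricted N0 QQ hY hX hV w0 wp hZ).
- by move=> i; exact: (fld_tw_act N0 QQ hY hX hV w0 wp hZ (true, i)).
- by move=> i; exact: (fld_tw_act N0 QQ hY hX hV w0 wp hZ (false, i)).
Qed.
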